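(* Let $\gamma\in\mathbb R$. If $u_0$ is a (real-valued) real-analytic function on $S^1$, then the Cauchy problem $$u_t+2\mu(u)uu_x-\tfrac13u_x^3+\partial_xA^{-1}\big[2\mu^2(u)u+\mu(u)u_x^2+\gamma u\big]+\tfrac13\mu(u_x^3)=0,\qquad u(0,x)=u_0(x),$$ has a holomorphic solution near $t=0$. More precisely: (i) There exists $\Delta>0$ such that $u_0\in G^{\Delta,s+2}$ for any $s\ge0$. (ii) With such a $\Delta$, if $s>1/2$, there exists a positive time $T_\Delta=T(u_0,s,\Delta)$ such that for every $d\in(0,1)$, the Cauchy problem has a unique solution which is a holomorphic function valued in $G^{\Delta d,s+2}$ in the disk $D(0,T_\Delta(1-d))$. Furthermore, when $\Delta$ is fixed: if $\gamma=0$, the analytic lifespan $T_\Delta$ satisfies, for $u_0\ne0$, $$T_\Delta=\frac{\mathrm{const.}}{\|(u_0,u_0')\|_{\Delta,s+1}^2};$$ if $\gamma\ne0$, we have the asymptotic behavior $$T_\Delta\approx\frac{\mathrm{const.}}{\|(u_0,u_0')\|_{\Delta,s+1}^2}\ (\text{large initial values}),\qquad T_\Delta\approx\mathrm{const.}\ (\text{small initial values}),$$ that is, $T_\Delta\|(u_0,u_0')\|_{\Delta,s+1}^2$ approaches a positive constant as $\|(u_0,u_0')\|_{\Delta,s+1}\to\infty$, and $T_\Delta$ approaches a positive constant as $\|(u_0,u_0')\|_{\Delta,s+1}\to0$. Here the constants do not depend on $u_0$ (they may depend on $s$, $\Delta$ and $\gamma$).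
   Context: $S^1=\mathbb R/\mathbb Z$; $L^2(S^1)$ denotes real-valued square-integrable functions; $\hat\varphi(k)=\int_{S^1}\varphi(x)e^{-2k\pi ix}\,dx$; $\langle k\rangle=(1+k^2)^{1/2}$. For $\delta\ge0,s\ge0$, $G^{\delta,s}=\{\varphi\in L^2(S^1):\|\varphi\|_{\delta,s}<\infty\}$ with $\|\varphi\|_{\delta,s}^2=\sum_{k\in\mathbb Z}\langle k\rangle^{2s}e^{4\pi\delta|k|}|\hat\varphi(k)|^2$. For pairs, $\|(u,v)\|_{\delta,s+1}=\|u\|_{\delta,s+1}+\|v\|_{\delta,s+1}$. $u_0'=\partial_xu_0$. $\mu(\varphi)=\int_{S^1}\varphi\,dx$ (integration in $x$), $\mu^2(u)=(\mu(u))^2$; the operator $A(\varphi)=\mu(\varphi)-\varphi_{xx}$ has inverse $A^{-1}(\varphi)=\hat\varphi(0)+\sum_{k\ne0}\frac{\hat\varphi(k)}{(2\pi k)^2}e^{2k\pi ix}$. $D(0,r)=\{t\in\mathbb C:|t|<r\}$. For complex $t$ the values of a holomorphic function of $t$ are taken in the complexification of the spaces (complex-valued functions, same norm), with $\mu$, $A^{-1}$, $\partial_x$ and products extended by the same formulas. *)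

(* Defs.v *)
From HB Require Import structures.
From mathcomp Require Import all_boot all_order all_algebra.
From mathcomp Require Import complex.
From mathcomp Require Import all_classical all_reals all_analysis.

Set Implicit Arguments.
Unset Strict Implicit.
Unset Printing Implicit Defensive.

Import Order.TTheory GRing.Theory Num.Theory.
Import numFieldNormedType.Exports.

Local Open Scope classical_set_scope.
Local Open Scope ring_scope.
Local Open Scope complex_scope.

(* A function on S^1 = R/Z is a 1-periodic function on the line; integrals
   over S^1 are Lebesgue integrals over [0, 1]. *)
Section Circle.
Context {R : realType}.

Local Notation leb := (@lebesgue_measure R).

Local Notation Re := complex.Re.
Local Notation Im := complex.Im.
Local Notation cmod := ComplexField.Normc.normc.

Definition periodic1 (T : Type) (f : R -> T) : Prop :=
  forall x, f (x + 1) = f x.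

Definition mu (f : R -> R[i]) : R[i] :=
  (\int[leb]_(x in `[0, 1]) Re (f x)) +i* (\int[leb]_(x in `[0, 1]) Im (f x)).

(* e^{2 k pi i x} *)
Definition expi2pi (k : int) (x : R) : R[i] :=
  cos (2 * k%:~R * pi * x) +i* sin (2 * k%:~R * pi * x).

Definition fourier (f : R -> R[i]) (k : int) : R[i] :=
  mu (fun x => f x * expi2pi (- k) x).

Definition cL2 (f : R -> R[i]) : Prop :=
  [/\ periodic1 f,
      measurable_fun setT (fun x => Re (f x)),
      measurable_fun setT (fun x => Im (f x)) &
      leb.-integrable `[0, 1] (fun x => (cmod (f x) ^+ 2)%:E)].

Definition jap (k : int) : R := Num.sqrt (1 + k%:~R ^+ 2).

(* ||f||_{delta,s} as an extended real, possibly +oo *)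
Definition Gnorm (delta s : R) (f : R -> R[i]) : \bar R :=
  sqrte (\esum_(k in [set: int])
    (jap k `^ (2 * s) * expR (4 * pi * delta * `|k%:~R|)
       * cmod (fourier f k) ^+ 2)%:E)%E.

(* The complexification of G^{delta,s}; a real-valued function f belongs to
   G^{delta,s} when its embedding (toC f) does. *)
Definition Gspace (delta s : R) (f : R -> R[i]) : Prop :=
  cL2 f /\ (Gnorm delta s f < +oo)%E.

Definition toC (f : R -> R) : R -> R[i] := fun x => (f x)%:C.

Definition ccontinuous (f : R -> R[i]) : Prop :=
  continuous (fun x => Re (f x)) /\ continuous (fun x => Im (f x)).

Definition dx (f : R -> R[i]) : R -> R[i] := fun x =>
  derive1 (fun y => Re (f y)) x +i* derive1 (fun y => Im (f y)) x.

Definition csum (a : nat -> R[i]) : R[i] :=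
  limn (series (fun n => Re (a n))) +i* limn (series (fun n => Im (a n))).

(* The inverse of A = mu - d^2/dx^2, as a Fourier series; the n-th term groups
   the frequencies n+1 and -(n+1). *)
Definition Ainv (f : R -> R[i]) : R -> R[i] := fun x =>
  let term (k : int) :=
    fourier f k / ((2 * pi * k%:~R) ^+ 2)%:C * expi2pi k x in
  fourier f 0 + csum (fun n : nat => term n.+1%:Z + term (- n.+1%:Z)).

Definition real_analytic (f : R -> R) : Prop :=
  forall x0 : R, exists2 r : R, 0 < r & exists a : nat -> R,
    forall x, `|x - x0| < r ->
      series (fun n => a n * (x - x0) ^+ n) @ \oo --> f x.

(* u and ut take values in G^{delta,s} on D(0,rho), and ut is the complex
   derivative of u there, for the norm of G^{delta,s}. *)
Definition holomorphic_in (delta s rho : R) (u ut : R[i] -> R -> R[i]) : Prop :=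
  forall t, cmod t < rho ->
    [/\ Gspace delta s (u t), Gspace delta s (ut t) &
        forall e : R, 0 < e -> exists2 eta : R, 0 < eta &
          forall h : R[i], h != 0 -> cmod h < eta ->
            (Gnorm delta s
               (fun x => h^-1 * (u (t + h) x - u t x) - ut t x)%R
             <= e%:E)%E].

Definition lhs (gamma : R) (u ut : R -> R[i]) (x : R) : R[i] :=
  let ux := dx u in
  ut x + 2 * mu u * u x * ux x - 3^-1 * ux x ^+ 3
  + dx (Ainv (fun y => 2 * mu u ^+ 2 * u y + mu u * ux y ^+ 2
                       + gamma%:C * u y)) x
  + 3^-1 * mu (fun y => ux y ^+ 3).

(* An element of G^{delta,s+2} (s > 1/2) is an L^2 class containing exactly one
   continuous function, which is C^2; each u t is required to be that one, so
   the equation and the initial condition are meant pointwise, and dx is the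
   classical derivative. *)
Definition is_solution (gamma : R) (u0 : R -> R) (delta s rho : R)
    (u : R[i] -> R -> R[i]) : Prop :=
  exists ut : R[i] -> R -> R[i],
    [/\ holomorphic_in delta (s + 2) rho u ut,
        forall t, cmod t < rho -> ccontinuous (u t),
        forall t, cmod t < rho -> forall x, lhs gamma (u t) (ut t) x = 0 &
        u 0 = toC u0].

(* Two solutions are identified when they agree on the disk. *)
Definition unique_solution (gamma : R) (u0 : R -> R) (delta s rho : R) : Prop :=
  exists2 u, is_solution gamma u0 delta s rho u &
    forall v, is_solution gamma u0 delta s rho v ->
      forall t, cmod t < rho -> v t = u t.

(* The initial data considered once Delta is fixed. *)
Definition datum (Delta : R) (u0 : R -> R) : Prop :=
  [/\ periodic1 u0, real_analytic u0 &
      forall s, 0 <= s -> Gspace Delta (s + 2) (toC u0)].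

(* ||(u0, u0')||_{delta,s}; finite for the data considered, hence the fine *)
Definition pair_norm (delta s : R) (u0 : R -> R) : R :=
  fine (Gnorm delta s (toC u0) + Gnorm delta s (toC (derive1 u0)))%E.

End Circle.

(* Main.v *)
Require Import Defs.
From mathcomp Require Import all_boot all_order all_algebra.
From mathcomp Require Import complex.
From mathcomp Require Import all_classical all_reals all_analysis.
From mathcomp Require Import ring lra zify.

(** The equation reads u_t = F u, where F u = [cubic u u u - gamma * dxAinv u]: a trilinear
    form in u and its first derivative, and a bounded linear term. In spaces of functions
    holomorphic on a strip, F loses one derivative, that is, a factor 1 / (e - d) when the
    half-width of the strip shrinks from e to d; this is the setting of the abstract
    Cauchy-Kovalevskaya theorem, whose proof is followed here.

    The working norm is the weighted l^1 norm of the Fourier coefficients, with weight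
    (1 + |k|)^p e^(2 pi d |k|); [W p d f B] says that it is at most B. Since the weight is
    submultiplicative these spaces are algebras ([W_M]), d/dx costs one unit of p ([W_dx]),
    the operator d/dx A^-1 costs nothing ([W_dxAinv]), and one unit of p is bought by shrinking
    the strip ([W_loss]). All manipulations of u then reduce to those of its Fourier
    coefficients, because a continuous function is determined by them ([fourier_inj0]).

    Existence: the equation fixes the Taylor coefficients a_n of u in t. If A bounds the
    datum in [W 1 D], induction on n, shrinking the strip by (D - d) / (n + 1) to reach the
    n-th coefficient, gives the bound A (B / (D - d))^n / (n + 1)^2 in [W 1 d], where
    B = kappa (A^2 + |gamma|) ([taylor_bound]); the weights 1 / (n + 1)^2 are stable
    under convolution, so the cubic term does not destroy the bound. Hence the series
    converges in [W 1 d] as soon as |t| B < D - d, and it solves the equation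
    ([taylor_solution]). With D d in place of d this is the disk of radius T (1 - d), T = D / B.
    On that disk the inequality is strict, and the width that is left over absorbs the Sobolev
    weight <k>^(s+2) together with the passage between l^1 and l^2 sums ([W_Gnorm]).
    The norm of (u0, u0') dominates the [W 1 D] norm of u0 up to a factor 3
    ([datum_pair_norm]), so A may be three times this norm N, and T = D / (kappa (9 N^2 + |gamma|))
    has the asymptotics that are claimed.

    Uniqueness: along a ray from 0, the difference w of two solutions satisfies w' = O(w) with
    the loss of one derivative. Integrating n times while losing d / (2 n) each time costs
    n^n / n! <= e^n, which a short interval compensates; so w vanishes on an interval of
    fixed length, and step by step on the whole ray ([unique_step], [unique_in_disk]).

    A real-analytic periodic function has |f^(m)| <= M m! M^m by compactness; summing
    these bounds against (2 M)^-m / m! shows that its Fourier coefficients decay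
    exponentially ([analytic_fourier_decay]), which gives the first assertion. *)

Set Implicit Arguments.
Unset Strict Implicit.
Unset Printing Implicit Defensive.

Import Order.TTheory GRing.Theory Num.Theory.
Import numFieldNormedType.Exports.

Local Open Scope classical_set_scope.
Local Open Scope ring_scope.
Local Open Scope complex_scope.

Local Notation Re := complex.Re.
Local Notation Im := complex.Im.
Local Notation cmod := ComplexField.Normc.normc.

(** * Moduli and sequences of complex numbers *)

Section Modulus.
Context {R : realType}.
Implicit Types (z w : R[i]) (x : R).

Lemma cmod_ge0 z : 0 <= cmod z.
Proof. by case: z => a b; rewrite sqrtr_ge0. Qed.

Lemma cmodD z w : cmod (z + w) <= cmod z + cmod w.
Proof. exact: le_normcD. Qed.

Lemma cmodM z w : cmod (z * w) = cmod z * cmod w.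
Proof. exact: ComplexField.Normc.normcM. Qed.

Lemma cmodN z : cmod (- z) = cmod z.
Proof. exact: normcN. Qed.

Lemma cmod0 : cmod (0 : R[i]) = 0.
Proof. exact: ComplexField.Normc.normc0. Qed.

Lemma cmod1 : cmod (1 : R[i]) = 1.
Proof. exact: ComplexField.Normc.normc1. Qed.

Lemma cmodB z w : cmod (z - w) = cmod (w - z).
Proof. by rewrite -cmodN opprB. Qed.

Lemma cmodV z : cmod z^-1 = (cmod z)^-1.
Proof. exact: ComplexField.Normc.normcV. Qed.

Lemma cmodX z n : cmod (z ^+ n) = cmod z ^+ n.
Proof. by elim: n => [|n IH]; rewrite ?cmod1 // !exprS cmodM IH. Qed.

Lemma cmod_eq0 z : (cmod z == 0) = (z == 0).
Proof.
apply/eqP/eqP => [|->]; [exact: ComplexField.Normc.eq0_normc|exact: cmod0].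
Qed.

Lemma cmod_real x : cmod x%:C = `|x|.
Proof. by rewrite /= expr0n /= addr0 sqrtr_sqr. Qed.

Lemma cmod_nat n : cmod (n%:R : R[i]) = n%:R.
Proof.
have -> : (n%:R : R[i]) = (n%:R : R)%:C by rewrite rmorph_nat.
by rewrite cmod_real ger0_norm.
Qed.

Lemma cRe_le z : `|Re z| <= cmod z.
Proof.
case: z => a b /=; rewrite -sqrtr_sqr ler_sqrt ?addr_ge0 ?sqr_ge0 //.
by rewrite lerDl sqr_ge0.
Qed.

Lemma cIm_le z : `|Im z| <= cmod z.
Proof.
case: z => a b /=; rewrite -sqrtr_sqr ler_sqrt ?addr_ge0 ?sqr_ge0 //.
by rewrite lerDr sqr_ge0.
Qed.

Lemma cmod_le_ReIm z : cmod z <= `|Re z| + `|Im z|.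
Proof.
have -> : z = (Re z)%:C + (Im z)%:C * 'i.
  by case: z => a b /=; apply/eqP; rewrite eq_complex /=; apply/andP; split;
     apply/eqP; ring.
apply: le_trans (cmodD _ _) _; rewrite cmodM !cmod_real /=.
rewrite expr0n expr1n /= add0r sqrtr1 mulr1 !(mulr0, mulr1, mul0r, subr0, addr0, add0r, subrr, oppr0).
by [].
Qed.

Lemma cmod_sum (I : Type) (s : seq I) (P : pred I) (F : I -> R[i]) :
  cmod (\sum_(i <- s | P i) F i) <= \sum_(i <- s | P i) cmod (F i).
Proof.
elim/big_rec2: _ => [|i x y _ le]; first by rewrite cmod0.
by apply: le_trans (cmodD _ _) _; rewrite lerD2l.
Qed.

Lemma cReD z w : Re (z + w) = Re z + Re w. Proof. by case: z w => [? ?] []. Qed.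
Lemma cImD z w : Im (z + w) = Im z + Im w. Proof. by case: z w => [? ?] []. Qed.
Lemma cReM z w : Re (z * w) = Re z * Re w - Im z * Im w.
Proof. by case: z w => [? ?] []. Qed.
Lemma cImM z w : Im (z * w) = Re z * Im w + Im z * Re w.
Proof. by case: z w => [? ?] []. Qed.
Lemma cReN z : Re (- z) = - Re z. Proof. by case: z. Qed.
Lemma cImN z : Im (- z) = - Im z. Proof. by case: z. Qed.
Lemma ReIm z : z = Re z +i* Im z. Proof. by case: z. Qed.
Lemma complexP z w : Re z = Re w -> Im z = Im w -> z = w.
Proof. by case: z w => [? ?] [? ?] /= -> ->. Qed.
Lemma cRe_sum (I : Type) (s : seq I) (P : pred I) (F : I -> R[i]) :
  Re (\sum_(i <- s | P i) F i) = \sum_(i <- s | P i) Re (F i).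
Proof. by elim/big_rec2: _ => // i y x _ <-; rewrite cReD. Qed.
Lemma cIm_sum (I : Type) (s : seq I) (P : pred I) (F : I -> R[i]) :
  Im (\sum_(i <- s | P i) F i) = \sum_(i <- s | P i) Im (F i).
Proof. by elim/big_rec2: _ => // i y x _ <-; rewrite cImD. Qed.

(** Turns a bound on a modulus into a bound on a real part, for which monotonicity of the
    integral and the mean value theorem are available. *)
Lemma cmod_phase z : exists2 th : R[i], cmod th = 1 & th * z = (cmod z)%:C.
Proof.
have [->|z0] := eqVneq z 0; first by exists 1; rewrite ?cmod1 // mulr0 cmod0.
exists ((cmod z)%:C / z).
  rewrite cmodM cmodV cmod_real ger0_norm ?cmod_ge0 // mulfV //.
  by rewrite cmod_eq0.
by rewrite mulfVK.
Qed.

Lemma cmod_lt_eq0 z : (forall e, 0 < e -> cmod z <= e) -> z = 0.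
Proof.
move=> h; apply/eqP; rewrite -cmod_eq0 eq_le cmod_ge0 andbT.
by apply/ler_addgt0Pr => e e0; rewrite add0r h.
Qed.

Lemma cmod_sqr z : cmod z ^+ 2 = Re z ^+ 2 + Im z ^+ 2.
Proof. by case: z => a b /=; rewrite sqr_sqrtr // addr_ge0 ?sqr_ge0. Qed.

End Modulus.

Section ComplexSequences.
Context {R : realType}.
Implicit Types (z w : nat -> R[i]) (a b : R[i]).

(** Convergence for the modulus, whereas [csum] takes the limits of real and imaginary parts
    separately; the two agree by [ccvg_ReIm] and [ReIm_ccvg]. *)
Definition ccvg z a :=
  forall e : R, 0 < e -> exists N, forall n, (N <= n)%N -> cmod (z n - a) <= e.

Lemma ccvg_unique z a b : ccvg z a -> ccvg z b -> a = b.
Proof.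
move=> za zb; apply/eqP; rewrite -subr_eq0; apply/eqP; apply: cmod_lt_eq0 => e e0.
have [N hN] := za (e / 2) ltac:(lra); have [M hM] := zb (e / 2) ltac:(lra).
have -> : a - b = (z (maxn N M) - b) - (z (maxn N M) - a) by ring.
apply: le_trans (cmodD _ _) _; rewrite cmodN.
by rewrite (splitr e) lerD ?hN ?hM ?leq_maxl ?leq_maxr.
Qed.

Lemma ccvg_cst a : ccvg (fun=> a) a.
Proof. by move=> e e0; exists 0%N => n _; rewrite subrr cmod0 ltW. Qed.

Lemma ccvgD z w a b : ccvg z a -> ccvg w b -> ccvg (fun n => z n + w n) (a + b).
Proof.
move=> za zb e e0.
have [N hN] := za (e / 2) ltac:(lra); have [M hM] := zb (e / 2) ltac:(lra).
exists (maxn N M) => n; rewrite geq_max => /andP[nN nM].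
have -> : z n + w n - (a + b) = (z n - a) + (w n - b) by ring.
apply: le_trans (cmodD _ _) _.
by rewrite (splitr e) lerD ?hN ?hM.
Qed.

Lemma ccvgZ z a b : ccvg z a -> ccvg (fun n => b * z n) (b * a).
Proof.
move=> za e e0.
have c0 : 0 < cmod b + 1 by rewrite ltr_wpDl ?cmod_ge0.
have [N hN] := za (e / (cmod b + 1)) (divr_gt0 e0 c0).
exists N => n nN; rewrite -mulrBr cmodM.
apply: le_trans (_ : (cmod b + 1) * (e / (cmod b + 1)) <= _).
  by rewrite ler_pM ?cmod_ge0 ?hN // lerDl.
by rewrite mulrC divfK // gt_eqF.
Qed.

Lemma ccvg_squeeze z a (b : nat -> R) : (forall n, cmod (z n - a) <= b n) ->
  b @ \oo --> (0 : R) -> ccvg z a.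
Proof.
move=> zb /cvgrPdist_le b0 e e0; have [N _ hN] := b0 e e0.
exists N => n nN; apply: le_trans (zb n) _.
by have := hN n nN; rewrite /= sub0r normrN; apply: le_trans; exact: ler_norm.
Qed.

Lemma ccvg_le z a (B : R) : ccvg z a -> (forall n, cmod (z n) <= B) -> cmod a <= B.
Proof.
move=> za zB; apply/ler_addgt0Pr => e /za[N hN].
have -> : a = z N - (z N - a) by ring.
apply: le_trans (cmodD _ _) _; rewrite cmodN lerD ?hN //.
Qed.

Lemma ccvg_shift z a m : ccvg z a -> ccvg (fun n => z (m + n)%N) a.
Proof.
move=> za e /za[N hN]; exists N => n nN; apply: hN.
by rewrite (leq_trans nN) ?leq_addl.
Qed.

Lemma ccvg_ReIm z a : ccvg z a -> (fun n => Re (z n)) @ \oo --> Re a /\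
  (fun n => Im (z n)) @ \oo --> Im a.
Proof.
move=> za; split; apply/cvgrPdist_le => e /za[N hN]; exists N => // n /= nN.
  by rewrite -cReN -cReD; apply: le_trans (cRe_le _) _; rewrite cmodB hN.
by rewrite -cImN -cImD; apply: le_trans (cIm_le _) _; rewrite cmodB hN.
Qed.

Lemma ReIm_ccvg z a : (fun n => Re (z n)) @ \oo --> Re a ->
  (fun n => Im (z n)) @ \oo --> Im a -> ccvg z a.
Proof.
move=> /cvgrPdist_le zr /cvgrPdist_le zi e e0.
have e2 : 0 < e / 2 by rewrite divr_gt0.
have [N _ hN] := zr _ e2; have [M _ hM] := zi _ e2.
exists (maxn N M) => n; rewrite geq_max => /andP[nN nM].
apply: le_trans (cmod_le_ReIm _) _; rewrite (splitr e) lerD //.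
  by rewrite cReD cReN distrC; exact: hN.
by rewrite cImD cImN distrC; exact: hM.
Qed.

Lemma csum_eq z a : ccvg (fun n => \sum_(i < n) z i) a -> csum z = a.
Proof.
move=> /ccvg_ReIm[hr hi]; rewrite /csum [RHS]ReIm; congr (_ +i* _);
  apply: cvg_lim => //; rewrite /series /=;
  [under eq_fun do rewrite big_mkord -cRe_sum; exact: hr
  |under eq_fun do rewrite big_mkord -cIm_sum; exact: hi].
Qed.

Lemma bounded_sum_tail (b : nat -> R) (B : R) : (forall n, 0 <= b n) ->
  (forall n, \sum_(i < n) b i <= B) ->
  forall e, 0 < e -> exists N, forall m n, (N <= m)%N -> \sum_(m <= i < n) b i <= e.
Proof.
move=> b0 bB e e0.
have cv : cvgn (series b).
  apply: nondecreasing_is_cvgn.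
    apply/nondecreasing_seqP => n; rewrite /series /= big_nat_recr //=.
    by rewrite lerDl.
  by exists B => _ [n _ <-]; rewrite /series /= big_mkord.
have /cvg_cauchy/cauchy_seriesP/(_ e e0) := cv.
case=> -[A1 A2] [/= [N1 _ h1] [N2 _ h2]] h.
exists (maxn N1 N2) => m n; rewrite geq_max => /andP[m1 m2].
have [nm|mn] := leqP n m; first by rewrite big_geq // ltW.
apply: ltW; apply: le_lt_trans (ler_norm _) _.
apply: (h (m, n)); split; [exact: h1|apply: h2].
by rewrite /= (leq_trans m2) // ltnW.
Qed.

Lemma csum_cvg z (B : R) : (forall n, \sum_(i < n) cmod (z i) <= B) ->
  ccvg (fun n => \sum_(i < n) z i) (csum z).
Proof.
move=> zB.
have ncv (f : R[i] -> R) : (forall a, `|f a| <= cmod a) -> cvgn (series (fun n => f (z n))).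
  move=> fle; apply: normed_cvg; apply: nondecreasing_is_cvgn.
    apply/nondecreasing_seqP => n; rewrite /= /series /= big_nat_recr //=.
    by rewrite lerDl.
  exists B => _ [n _ <-]; rewrite /= /series /= big_mkord; apply: le_trans (zB n).
  by apply: ler_sum => i _; exact: fle.
apply: ReIm_ccvg => /=.
  have := ncv (@complex.Re R) (@cRe_le _); rewrite /series /=.
  by under eq_fun do rewrite big_mkord -cRe_sum.
have := ncv (@complex.Im R) (@cIm_le _); rewrite /series /=.
by under eq_fun do rewrite big_mkord -cIm_sum.
Qed.

Lemma csum_tail z (B : R) n : (forall m, \sum_(i < m) cmod (z i) <= B) ->
  forall e, (forall m, \sum_(n <= i < m) cmod (z i) <= e) ->
  cmod (csum z - \sum_(i < n) z i) <= e.
Proof.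
move=> zB e ze.
have h := ccvgD (ccvg_shift n (csum_cvg zB)) (ccvg_cst (- \sum_(i < n) z i)).
apply: (ccvg_le h) => m.
rewrite -!(big_mkord xpredT) (big_cat_nat (n := n)) ?leq_addr //=.
rewrite addrAC subrr add0r; apply: le_trans (cmod_sum _ _ _) _; exact: ze.
Qed.

End ComplexSequences.

(** * Means and exponentials on the circle *)

Section Means.
Context {R : realType}.
Implicit Types (f g : R -> R[i]) (c : R[i]).
Local Notation leb := (@lebesgue_measure R).

Lemma ccont_cst c : ccontinuous (fun _ : R => c).
Proof. by split; move=> x; exact: cvg_cst. Qed.

Lemma ccontD f g : ccontinuous f -> ccontinuous g -> ccontinuous (fun x => f x + g x).
Proof.
move=> [fr fi] [gr gi]; split => x.
  by under eq_fun do rewrite cReD; apply: cvgD; [exact: fr|exact: gr].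
by under eq_fun do rewrite cImD; apply: cvgD; [exact: fi|exact: gi].
Qed.

Lemma ccontM f g : ccontinuous f -> ccontinuous g -> ccontinuous (fun x => f x * g x).
Proof.
move=> [fr fi] [gr gi]; split => x.
  under eq_fun do rewrite cReM; apply: cvgB; apply: cvgM;
  by [exact: fr|exact: gr|exact: fi|exact: gi].
under eq_fun do rewrite cImM; apply: cvgD; apply: cvgM;
by [exact: fr|exact: gr|exact: fi|exact: gi].
Qed.

Lemma ccontZ c f : ccontinuous f -> ccontinuous (fun x => c * f x).
Proof. by move=> cf; apply: ccontM => //; exact: ccont_cst. Qed.

Lemma ccontN f : ccontinuous f -> ccontinuous (fun x => - f x).
Proof. by move=> cf; under eq_fun do rewrite -mulN1r; exact: ccontZ. Qed.

Lemma ccontB f g : ccontinuous f -> ccontinuous g -> ccontinuous (fun x => f x - g x).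
Proof. by move=> cf cg; apply: ccontD => //; exact: ccontN. Qed.

Lemma ccont_sum (I : Type) (s : seq I) (P : pred I) (F : I -> R -> R[i]) :
  (forall i, ccontinuous (F i)) -> ccontinuous (fun x => \sum_(i <- s | P i) F i x).
Proof.
move=> cF; elim: s => [|i s IH].
  by under eq_fun do rewrite big_nil; exact: ccont_cst.
under eq_fun do rewrite big_cons; case: (P i) => //; exact: ccontD.
Qed.

Lemma ccontX f n : ccontinuous f -> ccontinuous (fun x => f x ^+ n).
Proof.
move=> cf; elim: n => [|n IH]; first exact: ccont_cst.
by under eq_fun do rewrite exprS; exact: ccontM.
Qed.

Lemma continuous_unif_lim (f : R -> R) :
  (forall e, 0 < e -> exists2 g : R -> R, continuous g &
    forall x, `|f x - g x| <= e) -> continuous f.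
Proof.
move=> h x; apply/cvgrPdist_le => e e0.
have [g cg fg] := h (e / 3) ltac:(lra).
have /cvgrPdist_le/(_ (e / 3) ltac:(lra)) := cg x.
apply: filterS => y hy.
have -> : f x - f y = (f x - g x) + (g x - g y) - (f y - g y) by ring.
apply: le_trans (ler_normB _ _) _; apply: le_trans (lerD (ler_normD _ _) (fg _)) _.
have := fg x; move: hy => /=; lra.
Qed.

Lemma ccont_unif_lim f :
  (forall e, 0 < e -> exists2 g, ccontinuous g & forall x, cmod (f x - g x) <= e) ->
  ccontinuous f.
Proof.
move=> h; split; apply: continuous_unif_lim => e /h[g [gr gi] fg].
  by exists (fun x => Re (g x)) => // x; rewrite -cReN -cReD; apply: le_trans (cRe_le _) _.
by exists (fun x => Im (g x)) => // x; rewrite -cImN -cImD; apply: le_trans (cIm_le _) _.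
Qed.

Lemma cont_integrable01 (f : R -> R) : continuous f ->
  leb.-integrable `[0, 1] (EFin \o f).
Proof.
move=> cf; apply: continuous_compact_integrable; first exact: segment_compact.
exact: continuous_subspaceT.
Qed.

Lemma Rint01D (f g : R -> R) : continuous f -> continuous g ->
  \int[leb]_(x in `[0, 1]) (f x + g x) =
  \int[leb]_(x in `[0, 1]) f x + \int[leb]_(x in `[0, 1]) g x.
Proof. by move=> cf cg; apply: RintegralD => //; exact: cont_integrable01. Qed.

Lemma Rint01Z (f : R -> R) r : continuous f ->
  \int[leb]_(x in `[0, 1]) (r * f x) = r * \int[leb]_(x in `[0, 1]) f x.
Proof. by move=> cf; apply: RintegralZl => //; exact: cont_integrable01. Qed.

Lemma Rint01_cst (r : R) : \int[leb]_(x in `[0, 1]) r = r.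
Proof.
rewrite Rintegral_cst //.
have /= -> := lebesgue_measure_itv `[0 : R, 1].
by rewrite lte_fin ltr01 -EFinB subr0 /= mulr1.
Qed.

Lemma Rint01_le (f : R -> R) B : continuous f -> (forall x, f x <= B) ->
  \int[leb]_(x in `[0, 1]) f x <= B.
Proof.
move=> cf fB; rewrite -[leRHS]Rint01_cst; apply: le_Rintegral => //.
- exact: cont_integrable01.
- by apply: (@cont_integrable01 (fun=> B)) => x; exact: cvg_cst.
Qed.

Lemma muD f g : ccontinuous f -> ccontinuous g -> mu (fun x => f x + g x) = mu f + mu g.
Proof.
move=> [fr fi] [gr gi]; apply: complexP; rewrite /= -?Rint01D //;
  by apply: eq_Rintegral => x _; rewrite ?cReD ?cImD.
Qed.

Lemma continuousZ (f : R -> R) r : continuous f -> continuous (fun x => r * f x).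
Proof. by move=> cf x; apply: cvgM; [exact: cvg_cst|exact: cf]. Qed.

Lemma muZ c f : ccontinuous f -> mu (fun x => c * f x) = c * mu f.
Proof.
move=> [fr fi]; apply: complexP; rewrite /= ?cReM ?cImM /= -?Rint01Z //.
  have -> (a b : R) : a - b = a + (- 1) * b by rewrite mulN1r.
  rewrite -(@Rint01Z (fun x => Im c * Im (f x))); last exact: continuousZ.
  rewrite -Rint01D; last 2 first.
  - exact: continuousZ.
  - by do 2 apply: continuousZ.
  by apply: eq_Rintegral => x _; rewrite cReM mulN1r.
rewrite -Rint01D //; try exact: continuousZ.
by apply: eq_Rintegral => x _; rewrite cImM.
Qed.

Lemma mu_cst c : mu (fun=> c) = c.
Proof. by rewrite /mu !Rint01_cst -ReIm. Qed.

Lemma mu_sum (I : Type) (s : seq I) (P : pred I) (F : I -> R -> R[i]) :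
  (forall i, ccontinuous (F i)) ->
  mu (fun x => \sum_(i <- s | P i) F i x) = \sum_(i <- s | P i) mu (F i).
Proof.
move=> cF; elim: s => [|i s IH].
  by under eq_fun do rewrite big_nil; rewrite mu_cst big_nil.
under eq_fun do rewrite big_cons; rewrite big_cons; case: (P i) => //.
by rewrite muD // ?IH //; exact: ccont_sum.
Qed.

(** Rotating the mean onto the positive real axis avoids integrating the modulus of f. *)
Lemma mu_le f B : ccontinuous f -> (forall x, cmod (f x) <= B) -> cmod (mu f) <= B.
Proof.
move=> cf fB; have [th th1 thE] := cmod_phase (mu f).
have -> : cmod (mu f) = Re (mu (fun x => th * f x)) by rewrite muZ // thE.
apply: Rint01_le; first by case: (ccontZ th cf).
move=> x; apply: le_trans (ler_norm _) _; apply: le_trans (cRe_le _) _.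
by rewrite cmodM th1 mul1r.
Qed.

End Means.

Section Exponentials.
Context {R : realType}.
Implicit Types (f g : R -> R[i]) (k : int) (x : R).
Local Notation leb := (@lebesgue_measure R).

Lemma cmod_expi k x : cmod (expi2pi k x) = 1.
Proof. by rewrite /= cos2Dsin2 sqrtr1. Qed.

Lemma expiD j k x : expi2pi (j + k) x = expi2pi j x * expi2pi k x.
Proof.
have e : 2 * (j + k)%:~R * pi * x = 2 * j%:~R * pi * x + 2 * k%:~R * pi * x :> R.
  by rewrite rmorphD; ring.
by rewrite /expi2pi e cosD sinD; apply: complexP; rewrite /=; ring.
Qed.

Lemma expi0 x : expi2pi 0 x = 1.
Proof. by rewrite /expi2pi mulr0 !mul0r cos0 sin0. Qed.

Lemma expi_periodic k : periodic1 (@expi2pi R k).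
Proof.
have h (n : nat) x : expi2pi n%:Z (x + 1) = expi2pi n%:Z x :> R[i].
  have e : 2 * n%:~R * pi * (x + 1) = 2 * n%:~R * pi * x + pi *+ 2 *+ n :> R.
    rewrite mulrDr mulr1 -[pi *+ 2 *+ n]mulr_natr -[pi *+ 2]mulr_natr.
    by congr (_ + _); rewrite [LHS]mulrC mulrA.
  rewrite /expi2pi e; elim: n {e} (2 * n%:~R * pi * x) => [|n IH] y.
    by rewrite addr0.
  by rewrite mulrSr addrA cosD2pi sinD2pi.
case: k => n x; first exact: h.
rewrite NegzE; apply: (mulIf (_ : expi2pi n.+1%:Z x != 0)).
  by rewrite -cmod_eq0 cmod_expi oner_eq0.
by rewrite -[in LHS]h -!expiD addrC subrr !expi0.
Qed.

Lemma is_derive_mull (a x : R) : is_derive x 1 (fun y => a * y) a.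
Proof.
have := is_deriveZ a (is_derive_id x (1 : R)).
by rewrite /GRing.scale /= mulr1.
Qed.

Lemma is_derive_cosZ (a x : R) : is_derive x 1 (fun y => cos (a * y)) (- a * sin (a * x)).
Proof.
have := is_derive1_comp (is_derive_cos (a * x)) (is_derive_mull a x).
by rewrite mulrC mulrN mulNr.
Qed.

Lemma is_derive_sinZ (a x : R) : is_derive x 1 (fun y => sin (a * y)) (a * cos (a * x)).
Proof.
have := is_derive1_comp (is_derive_sin (a * x)) (is_derive_mull a x).
by rewrite mulrC.
Qed.

Lemma continuous_cosZ (a : R) : continuous (fun y => cos (a * y)).
Proof.
move=> x; apply: continuous_comp; last exact: continuous_cos.
by apply: cvgM; [exact: cvg_cst|exact: cvg_id].
Qed.

Lemma continuous_sinZ (a : R) : continuous (fun y => sin (a * y)).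
Proof.
move=> x; apply: continuous_comp; last exact: continuous_sin.
by apply: cvgM; [exact: cvg_cst|exact: cvg_id].
Qed.

Lemma expi_cont k : ccontinuous (@expi2pi R k).
Proof. by split; [exact: continuous_cosZ|exact: continuous_sinZ]. Qed.

Lemma FTC01 (f F : R -> R) : continuous f -> (forall x, is_derive x 1 F (f x)) ->
  \int[leb]_(x in `[0, 1]) f x = F 1 - F 0.
Proof.
move=> cf dF; rewrite /Rintegral.
have cF : continuous F.
  by move=> x; apply/differentiable_continuous/derivable1_diffP; exact: ex_derive.
rewrite (@continuous_FTC2 _ _ F) //.
- exact: continuous_subspaceT.
- split; [by move=> x _; exact: ex_derive| |].
  + by apply: cvg_at_right_filter; exact: cF.
  + by apply: cvg_at_left_filter; exact: cF.
- by move=> x _; rewrite derive1E; apply: derive_val.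
Qed.

Lemma mu_expi k : mu (@expi2pi R k) = (k == 0)%:R.
Proof.
have [->|k0] := eqVneq k 0.
  have -> : @expi2pi R 0 = fun=> 1 by apply/funext => x; rewrite expi0.
  exact: mu_cst.
set a : R := 2 * k%:~R * pi.
have a0 : a != 0 by rewrite !mulf_neq0 ?intr_eq0 // gt_eqF ?pi_gt0.
have ec : cos (a * 1) = cos (a * 0) :> R.
  by have := congr1 (@complex.Re R) (@expi_periodic k 0); rewrite add0r.
have es : sin (a * 1) = sin (a * 0) :> R.
  by have := congr1 (@complex.Im R) (@expi_periodic k 0); rewrite add0r.
apply: complexP.
  have d (x : R) : is_derive x 1 (fun y => a^-1 * sin (a * y)) (cos (a * x)).
    have := is_deriveZ a^-1 (is_derive_sinZ a x).
    by rewrite /GRing.scale /= mulKf.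
  by rewrite [LHS](FTC01 (@continuous_cosZ a) d) es subrr.
have d (x : R) : is_derive x 1 (fun y => - a^-1 * cos (a * y)) (sin (a * x)).
  have := is_deriveZ (- a^-1) (is_derive_cosZ a x).
  by rewrite /GRing.scale /= mulrA mulrNN mulVf // mul1r.
by rewrite [LHS](FTC01 (@continuous_sinZ a) d) ec subrr.
Qed.

End Exponentials.

(** * Fourier series with summable coefficients *)

Section FourierSeries.
Context {R : realType}.
Implicit Types (f g : R -> R[i]) (k : int) (x : R) (c : int -> R[i]) (w : int -> R).
Local Notation leb := (@lebesgue_measure R).

(** A weighted l^1 norm, bounded through all finite sets of frequencies: no order of
    summation has to be chosen and no convergence established. *)
Definition nle w c (B : R) :=
  forall s : seq int, uniq s -> \sum_(k <- s) w k * cmod (c k) <= B.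

Lemma nle_mono w v c B C : (forall k, v k <= w k) -> B <= C -> nle w c B -> nle v c C.
Proof.
move=> vw BC h s us; apply: le_trans BC; apply: le_trans (h s us).
by apply: ler_sum => k _; rewrite ler_wpM2r ?cmod_ge0.
Qed.

Lemma nle_ge0 w c B : nle w c B -> 0 <= B.
Proof. by move=> /(_ [::] isT); rewrite big_nil. Qed.

(** The order of summation is the one in which the series defining [Ainv] groups opposite
    frequencies. *)
Fixpoint zseg n : seq int :=
  if n is m.+1 then [:: m.+1%:Z, - m.+1%:Z & zseg m] else [:: 0].

Lemma mem_zseg n k : (k \in zseg n) = (`|k| <= n)%N.
Proof.
elim: n => [|n IH] /=; first by rewrite inE leqn0 absz_eq0.
rewrite !inE IH; case: k {IH} => k; first by rewrite /= eqz_nat; lia.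
by rewrite NegzE eqr_opp eqz_nat /=; lia.
Qed.

Lemma uniq_zseg n : uniq (zseg n).
Proof.
elim: n => // n IH; rewrite [zseg _]/= !cons_uniq IH !inE !mem_zseg /=; lia.
Qed.

Definition trig c n x := \sum_(k <- zseg n) c k * expi2pi k x.

Definition fser_term c x n : R[i] :=
  c n.+1%:Z * expi2pi n.+1%:Z x + c (- n.+1%:Z) * expi2pi (- n.+1%:Z) x.

Definition fser c x := c 0 + csum (fser_term c x).

Lemma sum_zseg (V : zmodType) (F : int -> V) n : \sum_(k <- zseg n) F k =
  F 0 + \sum_(i < n) (F i.+1%:Z + F (- i.+1%:Z)).
Proof.
elim: n => [|n IH]; first by rewrite /= big_seq1 big_ord0 addr0.
by rewrite [zseg _]/= !big_cons IH big_ord_recr /= [RHS]addrA [RHS]addrC !addrA.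
Qed.

Lemma trigE c n x : trig c n x = c 0 + \sum_(i < n) fser_term c x i.
Proof. by rewrite /trig sum_zseg expi0 mulr1. Qed.

Lemma fser_term_le c x n : cmod (fser_term c x n) <= cmod (c n.+1%:Z) + cmod (c (- n.+1%:Z)).
Proof. by apply: le_trans (cmodD _ _) _; rewrite !cmodM !cmod_expi !mulr1. Qed.

Lemma nle_pairs c B : nle (fun=> 1) c B ->
  forall n, \sum_(i < n) (cmod (c i.+1%:Z) + cmod (c (- i.+1%:Z))) <= B.
Proof.
move=> h n; apply: le_trans (h _ (uniq_zseg n)).
under [leRHS]eq_bigr do rewrite mul1r.
by rewrite sum_zseg lerDr cmod_ge0.
Qed.

(** Uniformity in x is what gives continuity of the sum and lets the Fourier coefficients be
    computed term by term. *)
Lemma fser_trig c B : nle (fun=> 1) c B -> forall e, 0 < e ->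
  exists N, forall n, (N <= n)%N -> forall x, cmod (fser c x - trig c n x) <= e.
Proof.
move=> h e e0.
have h0 n : 0 <= cmod (c n.+1%:Z) + cmod (c (- n.+1%:Z)) by rewrite addr_ge0 ?cmod_ge0.
have [N hN] := bounded_sum_tail h0 (nle_pairs h) e0.
exists N => n nN x; rewrite trigE /fser opprD addrACA subrr add0r.
apply: csum_tail => m.
  by apply: le_trans (nle_pairs h m); apply: ler_sum => i _; exact: fser_term_le.
by apply: le_trans (hN n m nN); apply: ler_sum => i _; exact: fser_term_le.
Qed.

Lemma trig_cont c n : ccontinuous (trig c n).
Proof. by apply: ccont_sum => k; apply: ccontZ; exact: expi_cont. Qed.

Lemma fser_cont c B : nle (fun=> 1) c B -> ccontinuous (fser c).
Proof.
move=> h; apply: ccont_unif_lim => e /(fser_trig h)[N hN].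
by exists (trig c N); [exact: trig_cont|exact: hN].
Qed.

Lemma fser_periodic c : periodic1 (fser c).
Proof.
move=> x; rewrite /fser; congr (_ + csum _); apply/funext => n.
by rewrite /fser_term !expi_periodic.
Qed.

Lemma fser_le c B x : nle (fun=> 1) c B -> cmod (fser c x) <= B.
Proof.
move=> h; apply/ler_addgt0Pr => e /(fser_trig h)[N /(_ N (leqnn _) x) hN].
rewrite -[fser c x](subrK (trig c N x)); apply: le_trans (cmodD _ _) _.
rewrite addrC lerD //; apply: le_trans (cmod_sum _ _ _) _.
apply: le_trans (h _ (uniq_zseg N)); apply: ler_sum => k _.
by rewrite cmodM cmod_expi mulr1 mul1r.
Qed.

Lemma ccont_fourier f k : ccontinuous f -> ccontinuous (fun x => f x * expi2pi (- k) x).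
Proof. by move=> cf; apply: ccontM => //; exact: expi_cont. Qed.

Lemma fourierD f g k : ccontinuous f -> ccontinuous g ->
  fourier (fun x => f x + g x) k = fourier f k + fourier g k.
Proof.
move=> cf cg; rewrite /fourier -muD; try exact: ccont_fourier.
by congr mu; apply/funext => x; rewrite mulrDl.
Qed.

Lemma fourierZ a f k : ccontinuous f -> fourier (fun x => a * f x) k = a * fourier f k.
Proof.
move=> cf; rewrite /fourier -muZ; last exact: ccont_fourier.
by congr mu; apply/funext => x; rewrite mulrA.
Qed.

Lemma fourierB f g k : ccontinuous f -> ccontinuous g ->
  fourier (fun x => f x - g x) k = fourier f k - fourier g k.
Proof.
move=> cf cg; rewrite fourierD //; last exact: ccontN.
by under [in X in _ + X]eq_fun do rewrite -mulN1r; rewrite fourierZ // mulN1r.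
Qed.

Lemma fourier_sum (I : Type) (s : seq I) (P : pred I) (F : I -> R -> R[i]) k :
  (forall i, ccontinuous (F i)) ->
  fourier (fun x => \sum_(i <- s | P i) F i x) k = \sum_(i <- s | P i) fourier (F i) k.
Proof.
move=> cF; rewrite /fourier -mu_sum; last by move=> i; exact: ccont_fourier.
by congr mu; apply/funext => x; rewrite mulr_suml.
Qed.

Lemma fourier_le f k B : ccontinuous f -> (forall x, cmod (f x) <= B) ->
  cmod (fourier f k) <= B.
Proof.
move=> cf fB; apply: mu_le; first exact: ccont_fourier.
by move=> x; rewrite cmodM cmod_expi mulr1.
Qed.

Lemma fourier0 f : fourier f 0 = mu f.
Proof. by congr mu; apply/funext => x; rewrite oppr0 expi0 mulr1. Qed.

Lemma fourier_expiM f j k : fourier (fun x => expi2pi j x * f x) k = fourier f (k - j).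
Proof.
congr mu; apply/funext => x; rewrite mulrAC mulrC -expiD.
by congr (_ * expi2pi _ _); ring.
Qed.

Lemma fourier_expi j k : fourier (@expi2pi R j) k = (k == j)%:R.
Proof.
rewrite -[RHS](_ : (j - k == 0)%:R = _); last by rewrite subr_eq0 eq_sym.
by rewrite -mu_expi; congr mu; apply/funext => x; rewrite expiD.
Qed.

Lemma fourier_trig c n k : (k \in zseg n) -> fourier (trig c n) k = c k.
Proof.
move=> kn; rewrite fourier_sum; last by move=> j; apply: ccontZ; exact: expi_cont.
rewrite (bigD1_seq k) ?uniq_zseg //= fourierZ; last exact: expi_cont.
rewrite fourier_expi eqxx mulr1 big1 ?addr0 // => j jk.
by rewrite fourierZ ?fourier_expi 1?eq_sym ?(negbTE jk) ?mulr0 //; exact: expi_cont.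
Qed.

Lemma fourier_fser c B : nle (fun=> 1) c B -> fourier (fser c) = c.
Proof.
move=> h; apply/funext => k; apply/eqP; rewrite -subr_eq0; apply/eqP.
apply: cmod_lt_eq0 => e /(fser_trig h)[N hN].
have kN : k \in zseg (maxn N `|k|%N) by rewrite mem_zseg leq_maxr.
rewrite -(fourier_trig c kN) -fourierB; last exact: trig_cont.
  apply: fourier_le; last by apply: hN; rewrite leq_maxl.
  by apply: ccontB; [exact: fser_cont h|exact: trig_cont].
exact: fser_cont h.
Qed.

Lemma periodic_int (T : Type) (f : R -> T) : periodic1 f ->
  forall (k : int) x, f (x + k%:~R) = f x.
Proof.
move=> pf; have h (n : nat) x : f (x + n%:R) = f x.
  elim: n x => [|n IH] x; first by rewrite addr0.
  by rewrite -natr1 addrA pf.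
case=> n x; first exact: h.
by rewrite NegzE mulrNz -(h n.+1) subrK.
Qed.

Lemma periodic_bounded f : periodic1 f -> ccontinuous f ->
  exists M, forall x, cmod (f x) <= M.
Proof.
move=> pf [fr fi].
have cf : continuous (fun x => `|Re (f x)| + `|Im (f x)|).
  by move=> x; apply: cvgD; apply: cvg_norm; [exact: fr|exact: fi].
have [y _ hy] := EVT_max (@ler01 R) (continuous_subspaceT cf).
exists (`|Re (f y)| + `|Im (f y)|) => x.
rewrite -(periodic_int pf (- Num.floor x)); apply: le_trans (cmod_le_ReIm _) _.
apply: hy; rewrite in_itv /= mulrNz subr_ge0 floor_le lerBlDr addrC.
by rewrite ltW // -[1]/(1%:~R) -intrD floorD1_gt.
Qed.

Lemma Rint01_ge (h : R -> R) (a b q : R) : continuous h ->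
  0 <= a -> a <= b -> b <= 1 -> (forall x, 0 <= h x) ->
  (forall x, a <= x <= b -> q <= h x) ->
  q * (b - a) <= \int[leb]_(x in `[0, 1]) h x.
Proof.
move=> ch a0 ab b1 h0 hq.
have sub : `[a, b] `<=` `[0, 1].
  by move=> x /=; rewrite !in_itv /= => /andP[ax xb]; rewrite (le_trans a0) ?(le_trans xb).
have ih := cont_integrable01 ch.
have ihab : leb.-integrable `[a, b] (EFin \o h) by apply: integrableS ih.
have : \int[leb]_(x in `[a, b]) q <= \int[leb]_(x in `[a, b]) h x.
  apply: le_Rintegral => //.
    by apply: integrableS (cont_integrable01 (_ : continuous (fun=> q))) => // x; exact: cvg_cst.
rewrite Rintegral_cst //; have /= -> := lebesgue_measure_itv `[a, b].
rewrite lte_fin.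
have -> : fine (if a < b then (b%:E - a%:E)%E else 0) = b - a.
  case: ifP => // /negbT; rewrite -leNgt => ba.
  by apply/eqP; rewrite eq_sym subr_eq0 eq_le ba ab.
move=> /le_trans; apply.
rewrite /Rintegral fine_le //.
- exact: integrable_fin_num.
- exact: integrable_fin_num.
- apply: ge0_subset_integral => //; last by move=> x _; rewrite lee_fin.
  exact: measurable_int ih.
Qed.

End FourierSeries.

(** * Fourier coefficients determine a continuous function *)

Section Inversion.
Context {R : realType}.
Implicit Types (f g : R -> R[i]) (k : int) (x : R) (c : int -> R[i]).
Local Notation leb := (@lebesgue_measure R).

Lemma bernoulli_ge (eta : R) n : 0 <= eta -> 1 + n%:R * eta <= (1 + eta) ^+ n.
Proof.
move=> e0; elim: n => [|n IH]; first by rewrite mul0r addr0.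
rewrite exprS; apply: le_trans (_ : (1 + eta) * (1 + n%:R * eta) <= _); last first.
  by rewrite ler_wpM2l // addr_ge0.
rewrite -natr1; have : 0 <= n%:R * eta * eta by rewrite !mulr_ge0.
lra.
Qed.

(** Multiplying f by exponentials only shifts its Fourier coefficients, so they all remain
    zero. *)
Lemma fourier0_mul f (al be ga : R[i]) n : ccontinuous f ->
  (forall k, fourier f k = 0) -> forall k,
  fourier (fun x => (al + be * expi2pi 1 x + ga * expi2pi (-1) x) ^+ n * f x) k = 0.
Proof.
move=> cf f0; elim: n => [|n IH] k.
  by under eq_fun do rewrite expr0 mul1r; exact: f0.
set P := fun x : R => al + be * expi2pi 1 x + ga * expi2pi (-1) x.
set F := fun x => P x ^+ n * f x.
have cP : ccontinuous P.
  apply: ccontD; first apply: ccontD; first exact: ccont_cst;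
    by apply: ccontZ; exact: expi_cont.
have cF : ccontinuous F by apply: ccontM => //; exact: ccontX.
have F0 j : fourier F j = 0 by exact: IH.
have -> : (fun x => (al + be * expi2pi 1 x + ga * expi2pi (-1) x) ^+ n.+1 * f x) =
   (fun x => al * F x + be * (expi2pi 1 x * F x) + ga * (expi2pi (-1) x * F x)).
  by apply/funext => x; rewrite exprS /F /P; ring.
have ce j : ccontinuous (fun x => expi2pi j x * F x).
  by apply: ccontM => //; exact: expi_cont.
rewrite !fourierD ?fourierZ ?fourier_expiM ?F0 ?mulr0 ?addr0 //;
  do ?[exact: ccontZ]; by apply: ccontD; exact: ccontZ.
Qed.

Lemma expi1E (x : R) : expi2pi 1 x = cos (2 * pi * x) +i* sin (2 * pi * x).
Proof. by rewrite /expi2pi mulr1. Qed.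

Lemma expiN1E (x : R) : expi2pi (-1) x = cos (2 * pi * x) +i* - sin (2 * pi * x).
Proof.
have e : 2 * (-1)%:~R * pi * x = - (2 * pi * x) :> R by rewrite mulrN1z; ring.
by rewrite /expi2pi e cosN sinN.
Qed.

(** Writes the peaked kernel as a trigonometric polynomial of degree 1, to which
    [fourier0_mul] applies. *)
Lemma kernelE (c x0 x : R) :
  (1 + cos (2 * pi * (x - x0)) - c)%:C =
  (1 - c)%:C + (2^-1)%:C * expi2pi (-1) x0 * expi2pi 1 x
    + (2^-1)%:C * expi2pi 1 x0 * expi2pi (-1) x.
Proof.
rewrite !expi1E !expiN1E mulrBr cosB; by apply: complexP; rewrite /=; field.
Qed.

Lemma continuous_cos2pi (x0 : R) : continuous (fun x => cos (2 * pi * (x - x0))).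
Proof.
move=> x; apply: continuous_comp; last exact: continuous_cos.
apply: cvgM; first exact: cvg_cst.
by apply: cvgB; [exact: cvg_id|exact: cvg_cst].
Qed.

(** Reduced modulo 1 to [-1/2, 1/2], where the cosine is even and decreasing away from 0, u
    is compared with d through their cosines. *)
Lemma cos_near (d u : R) : 0 < d -> d <= 2^-1 -> cos (2 * pi * d) < cos (2 * pi * u) ->
  exists k : int, `|u + k%:~R| < d.
Proof.
move=> d0 d2 h.
pose k := - Num.floor (u + 2^-1); exists k.
set v := u + k%:~R.
have p0 := pi_gt0 R.
have v2 : `|v| <= 2^-1.
  rewrite /v /k mulrNz; have := floor_le (u + 2^-1); have := floorD1_gt (u + 2^-1).
  rewrite intrD; move: (Num.floor _)%:~R => z h1 h2.
  by rewrite ler_norml; apply/andP; split; move: h1; rewrite ?intr1; lra.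
have cv : cos (2 * pi * u) = cos (2 * pi * `|v|).
  have <- : cos (2 * pi * v) = cos (2 * pi * `|v|).
    by rewrite -[RHS]cos_norm normrM normr_id -normrM cos_norm.
  have := congr1 (@complex.Re R) (periodic_int (@expi_periodic R 1) k u).
  rewrite /= mulr1 => <-.
  by [].
move: h; rewrite cv ltr_cos //; first by move=> h; rewrite -(ltr_pM2l (_ : 0 < 2 * pi)) // mulr_gt0.
- have := ler_wpM2l (ltW p0) v2; have := mulr_ge0 (ltW p0) (normr_ge0 v).
  by rewrite in_itv /=; lra.
- have := ler_wpM2l (ltW p0) d2; have := mulr_ge0 (ltW p0) (ltW d0).
  by rewrite in_itv /=; lra.
Qed.

(** If f did not vanish at x0, rotate it so that its real part g is positive near x0. The
    trigonometric polynomials T^n, with T = 1 + cos (2 pi (x - x0)) - cos (2 pi d), grow at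
    least linearly in n near x0 and are bounded by 1 where g may be negative, so the
    integral of g T^n cannot vanish for all n. *)
Lemma fourier_inj0 f : periodic1 f -> ccontinuous f ->
  (forall k, fourier f k = 0) -> f = fun=> 0.
Proof.
move=> pf cf f0; apply/funext => x1; apply/eqP/negP => /negP fx1.
pose x0 := x1 - (Num.floor x1)%:~R.
have fx0 : f x0 != 0 by rewrite /x0 -mulrNz periodic_int.
have x001 : 0 <= x0 <= 1.
  rewrite /x0; have := floor_le x1; have := floorD1_gt x1; rewrite intrD.
  by move: (Num.floor _)%:~R => z; lra.
have [th th1 thE] := cmod_phase (f x0).
set m := cmod (f x0) in thE; have m0 : 0 < m by rewrite lt_def cmod_eq0 fx0 cmod_ge0.
have [M fM] := periodic_bounded pf cf.
pose g x := Re (th * f x).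
have cg : continuous g by case: (ccontZ th cf).
have pg : periodic1 g by move=> x; rewrite /g pf.
have gM x : `|g x| <= M.
  by apply: le_trans (cRe_le _) _; rewrite cmodM th1 mul1r.
have M0 : 0 <= M by apply: le_trans (gM 0).
have [d [d0 d4 gd]] : exists d : R, [/\ 0 < d, d <= 4^-1 &
    forall x, `|x - x0| < d -> m / 2 <= g x].
  have /cvgrPdist_lt/(_ (m / 2) ltac:(lra)) := cg x0.
  move=> /nbhs_ballP[r /= r0 hr]; exists (Num.min r 4^-1); split.
  - by rewrite lt_min r0 invr_gt0 ltr0n.
  - by rewrite ge_min lexx orbT.
  move=> x; rewrite lt_min => /andP[xr _].
  have := hr x; rewrite /ball /= distrC => /(_ xr).
  have -> : g x0 = m by rewrite /g thE.
  by rewrite ltr_norml; lra.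
have p0 := pi_gt0 R.
pose c := cos (2 * pi * d).
pose T x := 1 + cos (2 * pi * (x - x0)) - c.
have cT : continuous T.
  move=> x; apply: cvgB; last exact: cvg_cst.
  by apply: cvgD; [exact: cvg_cst|exact: continuous_cos2pi].
have T1 x : 1 < T x -> m / 2 <= g x.
  rewrite /T => Tx; have [k hk] : exists k : int, `|(x - x0) + k%:~R| < d.
    by apply: cos_near => //; rewrite -/c; lra.
  by rewrite -(periodic_int pg k); apply: gd; rewrite addrAC.
have TN x : -1 <= T x by have := cos_geN1 (2 * pi * (x - x0)); have := cos_le1 (2 * pi * d); rewrite /T -/c; lra.
pose eta := cos (2 * pi * (d / 2)) - c.
have eta0 : 0 < eta.
  rewrite subr_gt0 ltr_cos; first by rewrite ltr_pM2l ?mulr_gt0 //; lra.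
  - have := ler_wpM2l (ltW p0) d4; have := mulr_ge0 (ltW p0) (ltW d0).
    by rewrite in_itv /=; lra.
  - have := ler_wpM2l (ltW p0) d4; have := mulr_ge0 (ltW p0) (ltW d0).
    by rewrite in_itv /=; lra.
have Tnear x : `|x - x0| <= d / 2 -> 1 + eta <= T x.
  move=> xd; rewrite /T /eta -addrA lerD2l lerD2r -(cos_norm (2 * pi * (x - x0))).
  have -> : `|2 * pi * (x - x0)| = 2 * pi * `|x - x0|.
    by rewrite normrM ger0_norm // mulr_ge0 // ltW.
  have h1 := ler_wpM2l (ltW p0) d4; have h2 := mulr_ge0 (ltW p0) (ltW d0).
  have h3 := ler_wpM2l (ltW p0) xd; have h4 := mulr_ge0 (ltW p0) (normr_ge0 (x - x0)).
  rewrite leNgt ltr_cos ?in_itv /= -?leNgt; last 2 first.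
  - lra.
  - lra.
  by rewrite ler_pM2l ?mulr_gt0.
(* Half of the neighbourhood of x0 on which g is controlled, on its left or on its right,
   lies in [0, 1]. *)
pose a := if x0 <= 2^-1 then x0 else x0 - d / 2.
have [a0 a1 ax] : [/\ 0 <= a, a + d / 2 <= 1 & forall x, a <= x <= a + d / 2 -> `|x - x0| <= d / 2].
  rewrite /a; case: (leP x0 2^-1) => hx; split; try lra.
    by move=> x hx'; rewrite ler_norml; lra.
  by move=> x hx'; rewrite ler_norml; lra.
have int0 n : \int[leb]_(x in `[0, 1]) (g x * T x ^+ n) = 0.
  pose P x := (1 - c)%:C + (2^-1)%:C * expi2pi (-1) x0 * expi2pi 1 x
    + (2^-1)%:C * expi2pi 1 x0 * expi2pi (-1) x.
  have cP : ccontinuous P.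
    apply: ccontD; first apply: ccontD; first exact: ccont_cst;
      by apply: ccontZ; exact: expi_cont.
  have := fourier0_mul (1 - c)%:C ((2^-1)%:C * expi2pi (-1) x0) ((2^-1)%:C * expi2pi 1 x0)
    n cf f0 0.
  rewrite fourier0 -/(P _) => /(congr1 (fun z => Re (th * z))).
  rewrite mulr0 -muZ; last by apply: ccontM => //; exact: ccontX.
  move=> /= h; rewrite -[RHS]h; apply: eq_Rintegral => x _.
  rewrite -/(P x) (_ : P x = (T x)%:C); last by rewrite /P -kernelE.
  by rewrite -rmorphXn /= mulrCA cReM /= mul0r subr0 mulrC.
have bound n : m / 2 * (n%:R * eta) * (d / 2) <= M.
  (* The constant M makes the integrand nonnegative where T is at most 1. *)
  pose h x := g x * T x ^+ n + M.
  have cgT : continuous (fun x => g x * T x ^+ n).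
    by move=> x; apply: cvgM; [exact: cg|apply: (@continuous_comp _ _ _ T (fun y => y ^+ n)); [exact: cT|exact: exprn_continuous]].
  have ch : continuous h by move=> x; apply: cvgD; [exact: cgT|exact: cvg_cst].
  have <- : \int[leb]_(x in `[0, 1]) h x = M.
    by rewrite Rint01D ?int0 ?Rint01_cst ?add0r // => x; exact: cvg_cst.
  have -> : d / 2 = (a + d / 2) - a by ring.
  apply: Rint01_ge => //; first by rewrite lerDl; lra.
    move=> x; rewrite /h; have [Tx|Tx] := ltP 1 (T x).
      have gx := T1 x Tx.
      have Tp : 0 <= T x ^+ n.
        by rewrite exprn_ge0 //; lra.
      by rewrite addr_ge0 // mulr_ge0 //; lra.
    have : `|g x * T x ^+ n| <= M.
      rewrite normrM normrX -[leRHS]mulr1 ler_pM ?exprn_ge0 ?exprn_ile1 //.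
      by rewrite ler_norml TN Tx.
    by rewrite ler_norml; lra.
  move=> x /ax/Tnear Tx; rewrite /h.
  have gx : m / 2 <= g x by apply: T1; lra.
  have Tn : n%:R * eta <= T x ^+ n.
    apply: le_trans (_ : (1 + eta) ^+ n <= _); last first.
      by rewrite lerXn2r // nnegrE; lra.
    by have := bernoulli_ge n (ltW eta0); lra.
  by rewrite ler_wpDr // ler_pM ?mulr_ge0 // ?ltW //; lra.
have K0 : 0 < m / 2 * eta * (d / 2) by rewrite !mulr_gt0 //; lra.
have := bound (Num.truncn (M / (m / 2 * eta * (d / 2)))).+1.
have := truncnS_gt (M / (m / 2 * eta * (d / 2))).
rewrite ltr_pdivrMr //; move: _.+1%:R => N; lra.
Qed.

Lemma fser_fourier f B : periodic1 f -> ccontinuous f -> nle (fun=> 1) (fourier f) B ->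
  fser (fourier f) = f.
Proof.
move=> pf cf h; have cF := fser_cont h.
have : (fun x => fser (fourier f) x - f x) = fun=> 0.
  apply: fourier_inj0.
  - by move=> x; rewrite fser_periodic pf.
  - exact: ccontB.
  - by move=> k; rewrite fourierB // (fourier_fser h) subrr.
by move=> e; apply/funext => x; apply/eqP; rewrite -subr_eq0; apply/eqP; apply: (congr1 (@^~ x) e).
Qed.

End Inversion.

#[local] Arguments ComplexField.Normc.normc : simpl never.
#[local] Arguments mu : simpl never.
#[local] Arguments fourier : simpl never.
#[local] Arguments expi2pi : simpl never.

(** * Weighted Wiener algebras *)

Section WienerSpaces.
Context {R : realType}.
Implicit Types (f g : R -> R[i]) (k : int) (x d : R) (c : int -> R[i]) (p : nat).

(** Exponential weights of rate 2 pi d describe functions holomorphic on the strip of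
    half-width d around the real line; p counts derivatives. *)
Definition wt p d k : R := (1 + `|k%:~R|) ^+ p * expR (2 * pi * d * `|k%:~R|).

Lemma pi2_ge0 : 0 <= 2 * pi :> R.
Proof. by rewrite mulr_ge0 // pi_ge0. Qed.

Lemma wt_gt0 p d k : 0 < wt p d k.
Proof. by rewrite mulr_gt0 ?expR_gt0 // exprn_gt0 // ltr_pwDl. Qed.

Lemma wt_ge0 p d k : 0 <= wt p d k.
Proof. exact/ltW/wt_gt0. Qed.

Lemma wt0 p d : wt p d 0 = 1.
Proof. by rewrite /wt normr0 addr0 mulr0 expR0 expr1n mulr1. Qed.

Lemma wt_mono p q d e k : (p <= q)%N -> d <= e -> wt p d k <= wt q e k.
Proof.
move=> pq de; rewrite ler_pM ?expR_ge0 ?exprn_ge0 ?addr_ge0 //.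
  by rewrite ler_weXn2l // lerDl.
by rewrite ler_expR ler_wpM2r // ler_wpM2l // pi2_ge0.
Qed.

Lemma wt_ge1 p d k : 0 <= d -> 1 <= wt p d k.
Proof.
move=> d0; apply: le_trans (wt_mono k (leq0n p) d0).
by rewrite /wt expr0 mul1r mulr0 mul0r expR0.
Qed.

(** The reason why the spaces [W p d] are algebras. *)
Lemma wt_submul p d j k : 0 <= d -> wt p d (j + k) <= wt p d j * wt p d k.
Proof.
move=> d0; rewrite /wt mulrACA -exprMn -expRD -mulrDr.
have jk : `|(j + k)%:~R| <= `|j%:~R| + `|k%:~R| :> R by rewrite intrD ler_normD.
rewrite ler_pM ?expR_ge0 ?exprn_ge0 ?addr_ge0 //.
  rewrite lerXn2r ?nnegrE ?mulr_ge0 ?addr_ge0 //.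
  rewrite mulrDl mul1r mulrDr mulr1; have : 0 <= `|j%:~R| * `|k%:~R| :> R by rewrite mulr_ge0.
  move: jk; lra.
by rewrite ler_expR ler_wpM2l // mulr_ge0 // pi2_ge0.
Qed.

(** Membership is stated for the continuous representative, with an explicit bound B on the
    norm, so that one deals with functions and never with classes. *)
Definition W p d f B := [/\ periodic1 f, ccontinuous f & nle (wt p d) (fourier f) B].

Lemma W_per p d f B : W p d f B -> periodic1 f. Proof. by case. Qed.
Lemma W_cont p d f B : W p d f B -> ccontinuous f. Proof. by case. Qed.
Lemma W_ge0 p d f B : W p d f B -> 0 <= B. Proof. by case=> _ _ /nle_ge0. Qed.

Lemma W_mono p q d e f B C : (q <= p)%N -> e <= d -> B <= C -> W p d f B -> W q e f C.
Proof.
move=> qp ed BC [pf cf h]; split => //; apply: nle_mono BC h => k.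
exact: wt_mono.
Qed.

Lemma W_le p d f B C : B <= C -> W p d f B -> W p d f C.
Proof. exact: W_mono. Qed.

Lemma W_nle1 p d f B : 0 <= d -> W p d f B -> nle (fun=> 1) (fourier f) B.
Proof. by move=> d0 [_ _]; apply: nle_mono => // k; exact: wt_ge1. Qed.

Lemma W_fser p d f B : 0 <= d -> W p d f B -> fser (fourier f) = f.
Proof.
by move=> d0 Wf; have h := W_nle1 d0 Wf; case: Wf => pf cf _; exact: fser_fourier h.
Qed.

Lemma W_sup p d f B x : 0 <= d -> W p d f B -> cmod (f x) <= B.
Proof. by move=> d0 Wf; rewrite -(W_fser d0 Wf); exact: fser_le (W_nle1 d0 Wf). Qed.

(** Equality of functions is reduced to that of Fourier coefficients, where the linear
    operators of the equation are diagonal. *)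
Lemma W_inj f g p d A q e B : 0 <= d -> 0 <= e -> W p d f A -> W q e g B ->
  fourier f =1 fourier g -> f = g.
Proof.
by move=> d0 e0 Wf Wg /funext fg; rewrite -(W_fser d0 Wf) fg (W_fser e0 Wg).
Qed.

Lemma nle_W p d c B : 0 <= d -> nle (wt p d) c B -> W p d (fser c) B.
Proof.
move=> d0 h; have h1 : nle (fun=> 1) c B by apply: nle_mono h => // k; exact: wt_ge1.
by split; [exact: fser_periodic|exact: fser_cont h1|rewrite (fourier_fser h1)].
Qed.

Lemma W_mu p d f B : 0 <= d -> W p d f B -> cmod (mu f) <= B.
Proof. by move=> d0 Wf; apply: mu_le (W_cont Wf) _ => x; exact: W_sup Wf. Qed.

Lemma W_D p d f g A B : W p d f A -> W p d g B -> W p d (fun x => f x + g x) (A + B).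
Proof.
move=> [pf cf hf] [pg cg hg]; split; first by move=> x; rewrite pf pg.
  exact: ccontD.
move=> s us; apply: le_trans (lerD (hf s us) (hg s us)).
rewrite -big_split; apply: ler_sum => k _ /=.
by rewrite fourierD // -mulrDr ler_wpM2l ?cmodD ?wt_ge0.
Qed.

Lemma W_Z p d f a B : W p d f B -> W p d (fun x => a * f x) (cmod a * B).
Proof.
move=> [pf cf hf]; split; first by move=> x; rewrite pf.
  exact: ccontZ.
move=> s us; apply: le_trans (ler_wpM2l (cmod_ge0 a) (hf s us)).
rewrite mulr_sumr; apply: ler_sum => k _.
by rewrite fourierZ // cmodM mulrCA.
Qed.

Lemma W_N p d f B : W p d f B -> W p d (fun x => - f x) B.
Proof.
move=> /(W_Z (-1)); rewrite cmodN cmod1 mul1r.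
by under eq_fun do rewrite mulN1r.
Qed.

Lemma W_B p d f g A B : W p d f A -> W p d g B -> W p d (fun x => f x - g x) (A + B).
Proof. by move=> Wf Wg; apply: W_D => //; exact: W_N. Qed.

Lemma W_cst p d a : W p d (fun=> a) (cmod a).
Proof.
split => //; first exact: ccont_cst.
have fE k : fourier (fun=> a) k = a * (k == 0)%:R.
  rewrite -fourier_expi -fourierZ; last exact: expi_cont.
  by congr (fourier _ k); apply/funext => x; rewrite expi0 mulr1.
move=> s us; have [s0|s0] := boolP (0 \in s); last first.
  rewrite big_seq big1 ?cmod_ge0 // => k ks; rewrite fE.
  have /negbTE -> : k != 0 by apply: contraNneq s0 => <-.
  by rewrite mulr0 cmod0 mulr0.
rewrite (bigD1_seq 0) //= fE wt0 mul1r mulr1 big1 ?addr0 // => k k0.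
by rewrite fE (negbTE k0) mulr0 cmod0 mulr0.
Qed.

Lemma W_zero p d B : 0 <= B -> W p d (fun=> 0) B.
Proof. by move=> B0; apply: W_le (W_cst p d 0); rewrite cmod0. Qed.

Lemma W_sum (I : Type) (s : seq I) (P : pred I) p d (F : I -> R -> R[i]) (B : I -> R) :
  (forall i, P i -> W p d (F i) (B i)) ->
  W p d (fun x => \sum_(i <- s | P i) F i x) (\sum_(i <- s | P i) B i).
Proof.
move=> WF; elim: s => [|i s IH].
  by rewrite big_nil; under eq_fun do rewrite big_nil; exact: W_zero.
rewrite big_cons; under eq_fun do rewrite big_cons.
by case: ifP => // Pi; apply: W_D; [exact: WF|].
Qed.

(** Each finite sum of weighted coefficients is continuous for uniform convergence, hence
    the norm is lower semicontinuous. *)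
Lemma W_lim p d f B : (forall e, 0 < e -> exists2 g, W p d g (B + e) &
  forall x, cmod (f x - g x) <= e) -> W p d f B.
Proof.
move=> h.
have cf : ccontinuous f.
  by apply: ccont_unif_lim => e /h[g [_ cg _] fg]; exists g.
split => //.
  move=> x; apply/eqP; rewrite -subr_eq0; apply/eqP; apply: cmod_lt_eq0 => e e0.
  have [g [pg _ _] fg] := h (e / 2) ltac:(lra).
  have -> : f (x + 1) - f x = (f (x + 1) - g (x + 1)) - (f x - g x).
    by rewrite pg; ring.
  by apply: le_trans (cmodD _ _) _; rewrite cmodN (splitr e) lerD.
move=> s us; apply/ler_addgt0Pr => e e0.
set S := \sum_(k <- s) wt p d k.
have S0 : 0 <= S by apply: sumr_ge0 => k _; exact: wt_ge0.
have e'0 : 0 < e / (1 + S) by rewrite divr_gt0 // ltr_pwDl.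
have [g [pg cg hg] fg] := h _ e'0.
apply: le_trans (_ : \sum_(k <- s) wt p d k * cmod (fourier g k) + S * (e / (1 + S)) <= _).
  rewrite mulr_suml -big_split; apply: ler_sum => k _ /=.
  rewrite -mulrDr ler_wpM2l ?wt_ge0 //.
  have -> : fourier f k = fourier g k + fourier (fun x => f x - g x) k.
    by rewrite fourierB //; ring.
  apply: le_trans (cmodD _ _) _; rewrite lerD2l.
  by apply: fourier_le => //; exact: ccontB.
apply: le_trans (lerD (hg s us) (lexx _)) _.
rewrite -addrA lerD2l -{1}[e / (1 + S)]mul1r -mulrDl mulrC divfK //.
by rewrite gt_eqF // ltr_pwDl.
Qed.

Lemma W_expiM p d f B j : 0 <= d -> W p d f B ->
  W p d (fun x => expi2pi j x * f x) (wt p d j * B).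
Proof.
move=> d0 [pf cf hf]; split; first by move=> x; rewrite expi_periodic pf.
  by apply: ccontM => //; exact: expi_cont.
move=> s us; have us' : uniq [seq k - j | k <- s] by rewrite map_inj_uniq // => a b /addIr.
apply: le_trans (ler_wpM2l (ltW (wt_gt0 p d j)) (hf _ us')).
rewrite big_map mulr_sumr; apply: ler_sum => k _.
rewrite fourier_expiM mulrA ler_wpM2r ?cmod_ge0 //.
by rewrite -{1}(subrK j k) addrC; exact: wt_submul.
Qed.

(** Approximating f by its partial Fourier sums reduces the product to translations of the
    Fourier coefficients of g. *)
Lemma W_M p d f g A B : 0 <= d -> W p d f A -> W p d g B ->
  W p d (fun x => f x * g x) (A * B).
Proof.
move=> d0 Wf Wg; apply: W_lim => e e0.
have B0 := W_ge0 Wg; have B1 : 0 < B + 1 by lra.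
have [N hN] := fser_trig (W_nle1 d0 Wf) (divr_gt0 e0 B1).
exists (fun x => trig (fourier f) N x * g x); last first.
  move=> x; rewrite -mulrBl cmodM -(W_fser d0 Wf) (fourier_fser (W_nle1 d0 Wf)).
  apply: le_trans (ler_pM _ _ (hN N (leqnn _) x) (_ : _ <= B + 1)) _; rewrite ?cmod_ge0 //.
    by apply: le_trans (W_sup x d0 Wg) _; rewrite lerDl.
  by rewrite divfK // gt_eqF.
have -> : (fun x => trig (fourier f) N x * g x) =
  (fun x => \sum_(k <- zseg N) fourier f k * (expi2pi k x * g x)).
  by apply/funext => x; rewrite mulr_suml; apply: eq_bigr => k _; rewrite mulrA.
apply: W_le (W_sum (zseg N) (P := xpredT)
  (fun k _ => W_Z (fourier f k) (W_expiM k d0 Wg))).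
apply: le_trans (_ : A * B <= _); last by rewrite lerDl ltW.
case: Wf => _ _ hf; apply: le_trans (ler_wpM2r B0 (hf _ (uniq_zseg N))).
rewrite mulr_suml; apply: ler_sum => k _.
by rewrite mulrA (mulrC (cmod _)).
Qed.

Lemma W_csum p d (F : nat -> R -> R[i]) (b : nat -> R) S : 0 <= d ->
  (forall n, W p d (F n) (b n)) -> (forall N, \sum_(i < N) b i <= S) ->
  W p d (fun x => csum (F^~ x)) S.
Proof.
move=> d0 WF bS; apply: W_lim => e e0.
have b0 n : 0 <= b n by exact: W_ge0 (WF n).
have [N hN] := bounded_sum_tail b0 bS e0.
exists (fun x => \sum_(i < N) F i x).
  apply: W_le (W_sum (index_enum _) (P := xpredT) (fun (i : 'I_N) _ => WF i)).
  by apply: le_trans (bS N) _; rewrite lerDl ltW.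
move=> x; apply: csum_tail => m.
  by apply: le_trans (bS m); apply: ler_sum => i _; exact: W_sup (WF i).
by apply: le_trans (hN N m (leqnn _)); apply: ler_sum => i _; exact: W_sup (WF i).
Qed.

Lemma W_csum_cvg p d (F : nat -> R -> R[i]) (b : nat -> R) S x : 0 <= d ->
  (forall n, W p d (F n) (b n)) -> (forall N, \sum_(i < N) b i <= S) ->
  ccvg (fun n => \sum_(i < n) F i x) (csum (F^~ x)).
Proof.
move=> d0 WF bS; apply: csum_cvg (_ : forall n, _ <= S) => n.
by apply: le_trans (bS n); apply: ler_sum => i _; exact: W_sup (WF i).
Qed.

Lemma W_csum_tail p d (F : nat -> R -> R[i]) (b : nat -> R) S n e : 0 <= d ->
  (forall n, W p d (F n) (b n)) -> (forall N, \sum_(i < N) b i <= S) ->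
  (forall m, \sum_(i < m) b (n + i)%N <= e) ->
  W p d (fun x => csum (F^~ x) - \sum_(i < n) F i x) e.
Proof.
move=> d0 WF bS be.
have -> : (fun x => csum (F^~ x) - \sum_(i < n) F i x) =
   (fun x => csum (fun i => F (n + i)%N x)).
  apply/funext => x; symmetry; apply: csum_eq.
  have := ccvgD (ccvg_shift n (W_csum_cvg x d0 WF bS)) (ccvg_cst (- \sum_(i < n) F i x)).
  congr (ccvg _ _); apply/funext => m.
  by rewrite big_split_ord /= addrAC subrr add0r.
exact: (W_csum (F := fun i => F (n + i)%N) d0 (fun i => WF (n + i)%N) be).
Qed.

(** One power of 1 + |k| is bounded by the exponential gained when the strip widens from d
    to e. The factor 1 / (e - d) is the only price of the derivative in the equation, for
    existence as for uniqueness. *)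
Lemma W_loss d e D f B : 0 <= D -> d < e -> e - d <= D -> W 0 e f B ->
  W 1 d f ((D + 1) / (e - d) * B).
Proof.
move=> D0 de eD [pf cf hf]; split => // s us.
have ed : 0 < e - d by rewrite subr_gt0.
have K0 : 0 <= (D + 1) / (e - d) by rewrite divr_ge0 ?ltW //; lra.
apply: le_trans (ler_wpM2l K0 (hf s us)).
rewrite mulr_sumr; apply: ler_sum => k _; rewrite mulrA ler_wpM2r ?cmod_ge0 //.
rewrite /wt expr1 expr0 mul1r; set n := `|_|; have n0 : 0 <= n by exact: normr_ge0.
have -> : 2 * pi * e * n = 2 * pi * (e - d) * n + 2 * pi * d * n by ring.
rewrite expRD mulrA ler_wpM2r ?expR_ge0 //.
apply: le_trans (ler_wpM2l K0 (expR_ge1Dx _)).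
have -> : (D + 1) / (e - d) * (1 + 2 * pi * (e - d) * n) =
  (D + 1) / (e - d) + (D + 1) * (2 * pi) * n by field; rewrite gt_eqF.
rewrite lerD //; first by rewrite ler_pdivlMr //; lra.
rewrite ler_peMl // -[leLHS]mulr1 ler_pM //; first by lra.
by have := pi_ge2 R; lra.
Qed.

End WienerSpaces.

(** * Derivatives and Fourier multipliers *)

Section Derivatives.
Context {R : realType}.
Implicit Types (f g : R -> R[i]) (k : int) (x d : R) (c : int -> R[i]) (p : nat).

Lemma mvt_between (F dF : R -> R) (a b : R) : (forall x, is_derive x 1 F (dF x)) ->
  exists2 c, F b - F a = dF c * (b - a) & `|c - a| <= `|b - a|.
Proof.
move=> dd; have cF : continuous F.
  by move=> x; apply/differentiable_continuous/derivable1_diffP; exact: ex_derive.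
have [ab|ba] := leP a b.
  have [c cab e] := MVT_segment ab (fun x _ => dd x) (continuous_subspaceT cF).
  by exists c => //; move: cab; rewrite in_itv /= => /andP[? ?]; rewrite !ger0_norm; lra.
have [c cab e] := MVT_segment (ltW ba) (fun x _ => dd x) (continuous_subspaceT cF).
exists c; first by rewrite -[LHS]opprB e; ring.
by move: cab; rewrite in_itv /= => /andP[? ?]; rewrite !ler0_norm; lra.
Qed.

Lemma taylor1_le (F dF ddF : R -> R) (L x h : R) :
  (forall x, is_derive x 1 F (dF x)) -> (forall x, is_derive x 1 dF (ddF x)) ->
  (forall x, `|ddF x| <= L) -> `|F (x + h) - F x - h * dF x| <= L * h ^+ 2.
Proof.
move=> d1 d2 hL.
have [c -> hc] := mvt_between x (x + h) d1.
have e : x + h - x = h by ring.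
move: hc; rewrite e => hc.
have -> : dF c * h - h * dF x = (dF c - dF x) * h by ring.
have [z -> hz] := mvt_between x c d2.
have -> : h ^+ 2 = `|h| * `|h| by rewrite -expr2 real_normK ?num_real.
by rewrite !normrM -mulrA ler_pM ?mulr_ge0 // ler_wpM2r.
Qed.

(** A quadratic bound on the remainder passes to the limit of partial sums; this is how
    Fourier series are differentiated. *)
Lemma is_derive_quad (F : R -> R) (x G C : R) :
  (forall h, `|F (x + h) - F x - h * G| <= C * h ^+ 2) -> is_derive x 1 F G.
Proof.
move=> hF; have C0 : 0 <= C.
  by have := hF 1; rewrite expr1n mulr1; apply: le_trans.
have cv : (fun h => h^-1 *: (F (h *: 1 + x) - F x)) @ 0^' --> G.
  apply/cvgrPdist_le => e e0.
  exists (e / (C + 1)); first by rewrite /= divr_gt0 //; lra.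
  move=> h /=; rewrite sub0r normrN => he h0.
  rewrite /GRing.scale /= mulr1 (addrC h).
  have -> : G - h^-1 * (F (x + h) - F x) = - (h^-1 * (F (x + h) - F x - h * G)).
    by field.
  rewrite normrN normrM normfV ler_pdivrMl ?normr_gt0 //.
  apply: le_trans (hF h) _; rewrite -(ger0_norm (sqr_ge0 h)) normrX expr2 mulrCA.
  rewrite ler_wpM2l //; apply: le_trans (_ : (C + 1) * `|h| <= _).
    by rewrite ler_wpM2r //; lra.
  by move: he; rewrite ltr_pdivlMr; [move/ltW; rewrite mulrC|lra].
apply: DeriveDef; first by apply: cvgP cv.
exact: cvg_lim cv.
Qed.

Definition cderiv f g := forall x,
  is_derive x 1 (fun y => Re (f y)) (Re (g x)) /\ is_derive x 1 (fun y => Im (f y)) (Im (g x)).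

Lemma cderiv_dx f g : cderiv f g -> dx f = g.
Proof.
move=> h; apply/funext => x; have [hr hi] := h x.
by rewrite [RHS]ReIm /dx !derive1E; congr (_ +i* _); apply: derive_val.
Qed.

Definition freq k : R[i] := 0 +i* (2 * pi * k%:~R).

Lemma cmod_freq k : cmod (freq k) = 2 * pi * `|k%:~R|.
Proof.
rewrite /freq /ComplexField.Normc.normc expr0n add0r sqrtr_sqr normrM ger0_norm //.
exact: pi2_ge0.
Qed.

Lemma expi_taylor k x (h : R) :
  cmod (expi2pi k (x + h) - expi2pi k x - h%:C * (freq k * expi2pi k x))
   <= 2 * (2 * pi * k%:~R) ^+ 2 * h ^+ 2.
Proof.
set a : R := 2 * k%:~R * pi.
have aE : 2 * pi * k%:~R = a by rewrite /a; ring.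
have sq (y : R) : `|- (a * (a * y))| = a ^+ 2 * `|y|.
  by rewrite normrN mulrA normrM -expr2 normrX real_normK ?num_real.
have d1 y := is_derive_cosZ a y.
have d2 y := is_derive_sinZ a y.
have d3 (y : R) : is_derive y 1 (fun y => - a * sin (a * y)) (- (a * (a * cos (a * y)))).
  by have := is_deriveZ (- a) (d2 y); rewrite /GRing.scale /= mulNr.
have d4 (y : R) : is_derive y 1 (fun y => a * cos (a * y)) (- (a * (a * sin (a * y)))).
  by have := is_deriveZ a (d1 y); rewrite /GRing.scale /= mulNr mulrN.
apply: le_trans (cmod_le_ReIm _) _.
rewrite !(cReD, cImD, cReN, cImN, cReM, cImM) /freq /= aE !(mul0r, subr0, add0r, sub0r, addr0).
have -> : 2 * a ^+ 2 * h ^+ 2 = a ^+ 2 * h ^+ 2 + a ^+ 2 * h ^+ 2 by ring.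
rewrite lerD //.
  have := @taylor1_le _ _ _ (a ^+ 2) x h d1 d3; rewrite /expi2pi /= -/a mulNr; apply => y.
  by rewrite sq ler_piMr ?sqr_ge0 // cos_max.
have := @taylor1_le _ _ _ (a ^+ 2) x h d2 d4; rewrite /expi2pi /= -/a; apply => y.
by rewrite sq ler_piMr ?sqr_ge0 // sin_max.
Qed.

Lemma trig_ccvg c B x : nle (fun=> 1) c B -> ccvg (fun n => trig c n x) (fser c x).
Proof.
move=> h e /(fser_trig h)[N hN]; exists N => n nN.
by rewrite cmodB; exact: hN.
Qed.

(** The second-order remainder of the k-th exponential is O(k^2 t^2) uniformly in x, so the
    remainders sum up to one that is quadratic in t. *)
Lemma cderiv_fser c B : nle (fun k => 1 + `|k%:~R| ^+ 2) c B ->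
  cderiv (fser c) (fser (fun k => freq k * c k)).
Proof.
move=> h.
have p0 := @pi2_ge0 R.
have h1 : nle (fun=> 1) c B.
  by apply: nle_mono h => // k; rewrite lerDl exprn_ge0.
have h2 : nle (fun=> 1) (fun k => freq k * c k) (2 * pi * B).
  move=> s us; apply: le_trans (ler_wpM2l p0 (h s us)).
  rewrite mulr_sumr; apply: ler_sum => k _.
  rewrite mul1r cmodM cmod_freq -[leLHS]mulrA ler_wpM2l // ler_wpM2r ?cmod_ge0 //.
  have := sqr_ge0 (`|k%:~R| - 2^-1 : R); rewrite !expr2; lra.
set C := 2 * (2 * pi) ^+ 2 * B.
have key x (t : R) : cmod (fser c (x + t) - fser c x - t%:C * fser (fun k => freq k * c k) x)
    <= C * t ^+ 2.
  have cv : ccvg (fun n => trig c n (x + t) - trig c n x - t%:C * trig (fun k => freq k * c k) n x)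
    (fser c (x + t) - fser c x - t%:C * fser (fun k => freq k * c k) x).
    have := ccvgD (ccvgD (trig_ccvg (x + t) h1) (ccvgZ (-1) (trig_ccvg x h1)))
      (ccvgZ (- t%:C) (trig_ccvg x h2)).
    rewrite !mulN1r !mulNr; congr (ccvg _ _); apply/funext => n.
    by rewrite mulN1r mulNr.
  apply: (ccvg_le cv) => n.
  rewrite /trig mulr_sumr -!sumrB; apply: le_trans (cmod_sum _ _ _) _.
  apply: le_trans (_ : \sum_(k <- zseg n) (2 * (2 * pi) ^+ 2 * t ^+ 2) *
     ((1 + `|k%:~R| ^+ 2) * cmod (c k)) <= _); last first.
    rewrite -mulr_sumr /C [leRHS]mulrAC ler_wpM2l //.
      by rewrite mulr_ge0 ?sqr_ge0 // mulr_ge0 // sqr_ge0.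
    exact: h (uniq_zseg n).
  apply: ler_sum => k _.
  have -> : c k * expi2pi k (x + t) - c k * expi2pi k x - t%:C * (freq k * c k * expi2pi k x)
    = c k * (expi2pi k (x + t) - expi2pi k x - t%:C * (freq k * expi2pi k x)) by ring.
  rewrite cmodM [leLHS]mulrC [leRHS]mulrA ler_wpM2r ?cmod_ge0 //.
  apply: le_trans (expi_taylor k x t) _.
  rewrite exprMn real_normK ?num_real //.
  have : 0 <= (2 * pi) ^+ 2 * t ^+ 2 :> R by rewrite mulr_ge0 ?sqr_ge0.
  set Q := (2 * pi) ^+ 2; set T := t ^+ 2; set K := k%:~R ^+ 2.
  have -> : 2 * (Q * K) * T = 2 * K * (Q * T) by ring.
  have -> : 2 * Q * T * (1 + K) = 2 * (Q * T) + 2 * K * (Q * T) by ring.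
  lra.
move=> x; split; apply: (@is_derive_quad _ _ _ C) => t.
  have := le_trans (cRe_le _) (key x t).
  by rewrite !(cReD, cReN, cReM) /= !(mul0r, subr0).
have := le_trans (cIm_le _) (key x t).
by rewrite !(cImD, cImN, cImM) /= !(mul0r, addr0).
Qed.

(** From (1 + y)^2 <= e^(2 y) at y = pi d |k|. *)
Lemma sq_le_wt d k : 0 < d -> 1 + `|k%:~R| ^+ 2 <= (1 + (pi * d) ^- 2) * wt 0 d k.
Proof.
move=> d0; rewrite /wt expr0 mul1r; set n := `|_|.
have n0 : 0 <= n by exact: normr_ge0.
have p0 : 0 < pi * d by rewrite mulr_gt0 // pi_gt0.
have E : 2 * pi * d * n = pi * d * n + pi * d * n by ring.
have e1 := expR_ge1Dx (pi * d * n).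
have y0 : 0 <= pi * d * n by rewrite mulr_ge0 // ltW.
rewrite E expRD -expr2.
have h1 : (1 + pi * d * n) ^+ 2 <= expR (pi * d * n) ^+ 2.
  by rewrite lerXn2r // nnegrE; [lra|exact: expR_ge0].
apply: le_trans (ler_wpM2l _ h1); last by rewrite addr_ge0 // invr_ge0 exprn_ge0 // ltW.
have -> : (1 + (pi * d) ^- 2) * (1 + pi * d * n) ^+ 2 =
  1 + n ^+ 2 + (2 * (pi * d * n) + (pi * d * n) ^+ 2 + (pi * d) ^- 2 + 2 * (n / (pi * d))).
  by clear -p0; move: (pi * d) n p0 => y n y0; field; rewrite gt_eqF.
have q0 := ltW p0.
rewrite lerDl; apply: addr_ge0; last by rewrite mulr_ge0 // divr_ge0.
apply: addr_ge0; last by rewrite invr_ge0 exprn_ge0.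
by rewrite addr_ge0 ?sqr_ge0 // mulr_ge0.
Qed.

Lemma cderiv_W p d f B : 0 < d -> W p d f B ->
  cderiv f (fser (fun k => freq k * fourier f k)).
Proof.
move=> d0 Wf; rewrite -{1}(W_fser (ltW d0) Wf).
apply: (@cderiv_fser _ ((1 + (pi * d) ^- 2) * B)).
have [_ _ h] := Wf.
have K0 : 0 <= 1 + (pi * d) ^- 2.
  by rewrite addr_ge0 // invr_ge0 exprn_ge0 // mulr_ge0 ?pi_ge0 // ltW.
move=> s us; apply: le_trans (ler_wpM2l K0 (h s us)).
rewrite mulr_sumr; apply: ler_sum => k _; rewrite mulrA ler_wpM2r ?cmod_ge0 //.
apply: le_trans (sq_le_wt k d0) _; rewrite ler_wpM2l //; exact: wt_mono.
Qed.

Lemma dx_W p d f B : 0 < d -> W p d f B -> dx f = fser (fun k => freq k * fourier f k).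
Proof. by move=> d0 Wf; apply: cderiv_dx; exact: cderiv_W Wf. Qed.

Lemma mulr_norm_wt p d k : wt p d k * `|k%:~R| <= wt p.+1 d k.
Proof.
by rewrite /wt exprS -[leRHS]mulrA [leLHS]mulrC ler_wpM2r ?lerDr //; exact: wt_ge0.
Qed.

Lemma W_dx p d f B : 0 < d -> W p.+1 d f B -> W p d (dx f) (2 * pi * B).
Proof.
move=> d0 Wf; rewrite (dx_W d0 Wf); apply: nle_W; first exact: ltW.
have [_ _ h] := Wf.
move=> s us; apply: le_trans (ler_wpM2l (@pi2_ge0 R) (h s us)).
rewrite mulr_sumr; apply: ler_sum => k _.
rewrite cmodM cmod_freq mulrA [leRHS]mulrA ler_wpM2r ?cmod_ge0 //.
by rewrite mulrCA ler_wpM2l ?pi2_ge0 // mulr_norm_wt.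
Qed.

Lemma fourier_dx p d f B k : 0 < d -> W p.+1 d f B -> fourier (dx f) k = freq k * fourier f k.
Proof.
move=> d0 Wf; have [_ _ h] := W_dx d0 Wf.
rewrite (dx_W d0 Wf) (@fourier_fser _ _ (2 * pi * B)) //.
have p0 := @pi2_ge0 R; have [_ _ h'] := Wf.
move=> s us; apply: le_trans (ler_wpM2l p0 (h' s us)).
rewrite mulr_sumr; apply: ler_sum => j _.
rewrite mul1r cmodM cmod_freq -[leLHS]mulrA ler_wpM2l // ler_wpM2r ?cmod_ge0 //.
apply: le_trans (_ : wt 1 d j <= _); last exact: wt_mono.
rewrite /wt expr1 -[leLHS]mulr1 ler_pM // ?lerDr //.
have q : 0 <= 2 * pi * d * `|j%:~R| by rewrite mulr_ge0 // mulr_ge0 // ltW.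
by apply: le_trans (expR_ge1Dx _); rewrite lerDl.
Qed.

(** Treated as one operator since it is bounded on every [W p d]: A^-1 gains two derivatives
    and d/dx loses one. *)
Definition dxAinv f := dx (Ainv f).

(** Brings the operator of the equation under the name dxAinv where the latter is opaque. *)
Lemma dxAinv_def f : dxAinv f = dx (Ainv f). Proof. by []. Qed.

Definition Ainv_coef f k : R[i] :=
  if k == 0 then fourier f 0 else fourier f k / ((2 * pi * k%:~R) ^+ 2)%:C.

(** The Fourier multiplier of dxAinv; it vanishes at 0 since A^-1 preserves the mean and
    d/dx kills it. *)
Definition smoothing k : R[i] := if k == 0 then 0 else freq k / ((2 * pi * k%:~R) ^+ 2)%:C.

Lemma cmod_smoothing k : cmod (smoothing k) <= 1.
Proof.
rewrite /smoothing; case: eqP => [_|/eqP k0]; first by rewrite cmod0.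
have kR : 1 <= `|k%:~R| :> R by rewrite -intr_norm ler1z -gtz0_ge1 normr_gt0.
have p2 : 1 <= 2 * pi :> R by have := pi_ge2 R; lra.
have q : 1 <= 2 * pi * `|k%:~R| :> R by rewrite -[leLHS]mulr1 ler_pM.
rewrite cmodM cmodV cmod_freq cmod_real normrX normrM (ger0_norm (@pi2_ge0 R)).
rewrite ler_pdivrMr ?exprn_gt0 // ?mul1r ?expr2 ?ler_peMl //; lra.
Qed.

Lemma nle_scale w c c' B (K : R) : (forall k, 0 <= w k) -> 0 <= K ->
  (forall k, cmod (c' k) <= K * cmod (c k)) -> nle w c B -> nle w c' (K * B).
Proof.
move=> w0 K0 cc h s us; apply: le_trans (ler_wpM2l K0 (h s us)).
by rewrite mulr_sumr; apply: ler_sum => k _; rewrite mulrCA ler_wpM2l.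
Qed.

Lemma dxAinvE p d f B : 0 < d -> W p d f B ->
  W p d (dxAinv f) B /\ fourier (dxAinv f) =1 (fun k => smoothing k * fourier f k).
Proof.
move=> d0 Wf; have d0' := ltW d0.
have AE : Ainv f = fser (Ainv_coef f).
  by apply/funext => x; rewrite /Ainv /fser /Ainv_coef eqxx.
have [_ _ h] := Wf.
have le1 k : cmod (Ainv_coef f k) <= 1 * cmod (fourier f k).
  rewrite /Ainv_coef mul1r; case: eqP => [->//|/eqP k0].
  rewrite cmodM ler_piMr ?cmod_ge0 // cmodV cmod_real normrX normrM (ger0_norm (@pi2_ge0 R)).
  have kR : 1 <= `|k%:~R| :> R by rewrite -intr_norm ler1z -gtz0_ge1 normr_gt0.
  have p2 : 1 <= 2 * pi :> R by have := pi_ge2 R; lra.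
  have q : 1 <= 2 * pi * `|k%:~R| :> R by rewrite -[leLHS]mulr1 ler_pM.
  by rewrite invf_le1 ?exprn_gt0 ?exprn_ege1 //; lra.
have hA : nle (wt p d) (Ainv_coef f) (1 * B).
  by apply: nle_scale le1 h => // k; exact: wt_ge0.
have WA := nle_W d0' hA.
have hc : nle (wt p d) (fun k => smoothing k * fourier f k) B.
  rewrite -[B]mul1r; apply: nle_scale h => // k; first exact: wt_ge0.
  by rewrite cmodM ler_wpM2r ?cmod_ge0 // cmod_smoothing.
have E : dxAinv f = fser (fun k => smoothing k * fourier f k).
  rewrite /dxAinv AE (dx_W d0 WA); congr fser; apply/funext => k.
  rewrite (@fourier_fser _ _ (1 * B)); last by apply: nle_mono hA => // j; exact: wt_ge1.
  rewrite /Ainv_coef /smoothing; case: eqP => [->|_]; last by ring.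
  by rewrite mul0r /freq mulr0 mul0r.
rewrite E; split; first exact: nle_W.
move=> k; rewrite (@fourier_fser _ _ B) //.
by apply: nle_mono hc => // j; exact: wt_ge1.
Qed.

Lemma W_dxAinv p d f B : 0 < d -> W p d f B -> W p d (dxAinv f) B.
Proof. by move=> d0 /(dxAinvE d0)[]. Qed.

End Derivatives.

(* From here on these are used only through their lemmas; unfolding them would make
   unification explore integrals and limits. *)
#[local] Opaque fourier mu dx dxAinv ComplexField.Normc.normc.

(** * The cubic vector field *)

Section NonlinearMap.
Context {R : realType}.
Implicit Types (f g a b c u v w : R -> R[i]) (x d : R) (k : R[i]) (p : nat).

(** Algebraic identities between the operators do not depend on the width of the strip, so
    they are stated for functions holomorphic on some strip. *)
Definition An f := exists d, exists2 B, 0 < d & W 0 d f B.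

Lemma W_An p d f B : 0 < d -> W p d f B -> An f.
Proof. by move=> d0 Wf; exists d, B => //; apply: W_mono Wf. Qed.

Lemma An_W1 f : An f -> exists d, exists2 B, 0 < d & W 1 d f B.
Proof.
move=> [d [B d0 Wf]]; exists (d / 2), ((d + 1) / (d - d / 2) * B); first lra.
by apply: W_loss Wf; lra.
Qed.

Lemma An_cont f : An f -> ccontinuous f. Proof. by case=> d [B _ []]. Qed.

Lemma An2 f g : An f -> An g -> exists d A B, [/\ 0 < d, W 0 d f A & W 0 d g B].
Proof.
move=> [d [A d0 Wf]] [e [B e0 Wg]]; exists (Num.min d e), A, B; split.
- by rewrite lt_min d0 e0.
- by apply: W_mono Wf; rewrite // ge_min lexx.
- by apply: W_mono Wg; rewrite // ge_min lexx orbT.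
Qed.

Lemma An_inj f g : An f -> An g -> fourier f =1 fourier g -> f = g.
Proof.
move=> /An2/[apply] -[d [A [B [d0 Wf Wg]]]].
exact: W_inj (ltW d0) (ltW d0) Wf Wg.
Qed.

Lemma An_cst k : An (fun=> k).
Proof. by exists 1, (cmod k) => //; exact: W_cst. Qed.

Lemma An_D f g : An f -> An g -> An (fun x => f x + g x).
Proof.
move=> /An2/[apply] -[d [A [B [d0 Wf Wg]]]].
by exists d, (A + B) => //; exact: W_D.
Qed.

Lemma An_Z k f : An f -> An (fun x => k * f x).
Proof. by move=> [d [A d0 Wf]]; exists d, (cmod k * A) => //; exact: W_Z. Qed.

Lemma An_M f g : An f -> An g -> An (fun x => f x * g x).
Proof.
move=> /An2/[apply] -[d [A [B [d0 Wf Wg]]]].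
by exists d, (A * B) => //; apply: W_M => //; exact: ltW.
Qed.

Lemma An_B f g : An f -> An g -> An (fun x => f x - g x).
Proof.
move=> /An2/[apply] -[d [A [B [d0 Wf Wg]]]].
by exists d, (A + B) => //; exact: W_B.
Qed.

Lemma An_dx f : An f -> An (dx f).
Proof. by move=> /An_W1[d [B d0 Wf]]; exists d, (2 * pi * B) => //; exact: W_dx. Qed.

Lemma An_dxAinv f : An f -> An (dxAinv f).
Proof. by move=> [d [A d0 Wf]]; exact: W_An d0 (W_dxAinv d0 Wf). Qed.

Lemma An_sum (I : Type) (s : seq I) (P : pred I) (F : I -> R -> R[i]) :
  (forall i, An (F i)) -> An (fun x => \sum_(i <- s | P i) F i x).
Proof.
move=> AF; elim: s => [|i s IH].
  by under eq_fun do rewrite big_nil; exact: An_cst.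
by under eq_fun do rewrite big_cons; case: (P i) => //; exact: An_D.
Qed.

Definition lc k f g : R -> R[i] := fun x => k * f x + g x.

Lemma An_lc k f g : An f -> An g -> An (lc k f g).
Proof. by move=> Af Ag; apply: An_D => //; exact: An_Z. Qed.

(** The derivative and dxAinv are linear only where Fourier series represent functions,
    hence the restriction to An. *)
Definition linOn (Op : (R -> R[i]) -> R -> R[i]) :=
  forall k f g, An f -> An g -> Op (lc k f g) = lc k (Op f) (Op g).

Lemma linOnB Op f g : linOn Op -> An f -> An g ->
  Op (fun x => f x - g x) = (fun x => Op f x - Op g x).
Proof.
move=> lO Af Ag; have -> : (fun x => f x - g x) = lc (-1) g f.
  by apply/funext => x; rewrite /lc mulN1r addrC.
by rewrite lO //; apply/funext => x; rewrite /lc mulN1r addrC.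
Qed.

Lemma linOn0 Op : linOn Op -> Op (fun=> 0) = fun=> 0.
Proof.
move=> lO; have A0 := An_cst 0.
have := linOnB lO A0 A0; have -> : (fun=> 0 - 0) = (fun=> 0) :> (R -> R[i]).
  by apply/funext => x; rewrite subr0.
by move=> ->; apply/funext => x; rewrite subrr.
Qed.

Lemma linOn_sum Op (I : Type) (s : seq I) (z : I -> R[i]) (F : I -> R -> R[i]) :
  linOn Op -> (forall i, An (F i)) ->
  Op (fun x => \sum_(i <- s) z i * F i x) = (fun x => \sum_(i <- s) z i * Op (F i) x).
Proof.
move=> lO AF; elim: s => [|i s IH].
  have -> : (fun x => \sum_(i <- [::]) z i * F i x) = fun=> 0.
    by apply/funext => x; rewrite big_nil.
  by rewrite linOn0 //; apply/funext => x; rewrite big_nil.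
have -> : (fun x => \sum_(j <- i :: s) z j * F j x) =
   lc (z i) (F i) (fun x => \sum_(j <- s) z j * F j x).
  by apply/funext => x; rewrite big_cons.
rewrite lO //; last by apply: An_sum => j; exact: An_Z.
by rewrite IH; apply/funext => x; rewrite /lc big_cons.
Qed.

Lemma fourier_lc k f g j : An f -> An g ->
  fourier (lc k f g) j = k * fourier f j + fourier g j.
Proof.
move=> /An_cont cf /An_cont cg; rewrite fourierD //; last exact: ccontZ.
by rewrite fourierZ.
Qed.

Lemma mu_lc k f g : An f -> An g -> mu (lc k f g) = k * mu f + mu g.
Proof. by move=> Af Ag; rewrite -!fourier0 fourier_lc. Qed.

Lemma An_fourier_dx f j : An f -> fourier (dx f) j = freq j * fourier f j.
Proof. by move=> /An_W1[d [B d0 Wf]]; exact: fourier_dx Wf. Qed.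

Lemma An_fourier_dxAinv f j : An f -> fourier (dxAinv f) j = smoothing j * fourier f j.
Proof. by move=> [d [B d0 /(dxAinvE d0)[_]]]. Qed.

(** Fourier coefficients determine the elements of An, and a multiplier acts on them
    diagonally. *)
Lemma multiplier_lin Op (m : int -> R[i]) : (forall f, An f -> An (Op f)) ->
  (forall f j, An f -> fourier (Op f) j = m j * fourier f j) -> linOn Op.
Proof.
move=> AO fO k f g Af Ag; apply: An_inj => [||j].
- exact/AO/An_lc.
- by apply: An_lc; exact: AO.
- rewrite (fO _ j (An_lc k Af Ag)) (fourier_lc k j Af Ag).
  rewrite (fourier_lc k j (AO _ Af) (AO _ Ag)) (fO _ j Af) (fO _ j Ag).
  by rewrite mulrDr mulrCA.
Qed.

Lemma dx_lin : linOn dx.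
Proof. exact: multiplier_lin An_dx (fun f j => @An_fourier_dx f j). Qed.

Lemma dxAinv_lin : linOn dxAinv.
Proof. exact: multiplier_lin An_dxAinv (fun f j => @An_fourier_dxAinv f j). Qed.

(** On the diagonal this is the bracket under A^-1 without its linear term. *)
Definition nonlocal a b c y := 2 * mu a * mu b * c y + mu a * (dx b y * dx c y).

(** The polarised cubic part of u_t: every factor receives its own argument. Trilinearity
    turns differences, partial sums and Taylor expansions into finite algebra. *)
Definition cubic a b c x :=
  - (2 * mu a * (b x * dx c x)) + 3^-1 * (dx a x * dx b x * dx c x)
  - dxAinv (nonlocal a b c) x - 3^-1 * mu (fun y => dx a y * dx b y * dx c y).

Lemma An_M3 a b c : An a -> An b -> An c -> An (fun x => dx a x * dx b x * dx c x).
Proof. by move=> Aa Ab Ac; apply: An_M; [apply: An_M|]; exact: An_dx. Qed.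

Lemma An_nonlocal a b c : An b -> An c -> An (nonlocal a b c).
Proof.
move=> Ab Ac; apply: An_D; first by exact: An_Z.
by apply: An_Z; apply: An_M; exact: An_dx.
Qed.

(** One summand for each of the four terms of cubic, in this order, with 2 pi for each
    derivative. *)
Definition cubic_cst : R := 2 * (2 * pi) + 3^-1 * (2 * pi) ^+ 3 + (2 + (2 * pi) ^+ 2)
  + 3^-1 * (2 * pi) ^+ 3.

Lemma cubic_cst_ge1 : 1 <= cubic_cst.
Proof.
have p := @pi2_ge0 R; have := exprn_ge0 2 p; have := exprn_ge0 3 p.
by rewrite /cubic_cst; move: (_ ^+ 3) (_ ^+ 2) => y z; lra.
Qed.

(** Products, means and dxAinv cost nothing; the derivatives are all of first order and
    taken in different factors, so one power of the weight pays for them. *)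
Lemma W_cubic d a b c A B C : 0 < d -> W 1 d a A -> W 1 d b B -> W 1 d c C ->
  W 0 d (cubic a b c) (cubic_cst * (A * B * C)).
Proof.
move=> d0 Wa Wb Wc; have d0' := ltW d0.
have W0 f F : W 1 d f F -> W 0 d f F by apply: W_mono.
have Da := W_dx d0 Wa; have Db := W_dx d0 Wb; have Dc := W_dx d0 Wc.
have W3 := W_M d0' (W_M d0' Da Db) Dc.
have A0 := W_ge0 Wa; have B0 := W_ge0 Wb; have C0 := W_ge0 Wc.
have ma := W_mu d0' Wa; have mb := W_mu d0' Wb.
have c3 : cmod (3^-1 : R[i]) = 3^-1 by rewrite cmodV cmod_nat.
have c2 : cmod (2 : R[i]) = 2 by rewrite cmod_nat.
have p := @pi2_ge0 R.
have Bp := mulr_ge0 p B0; have Cp := mulr_ge0 p C0.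
have W1 : W 0 d (fun x => - (2 * mu a * (b x * dx c x))) (2 * A * (B * (2 * pi * C))).
  apply: W_N; apply: W_le (W_Z _ (W_M d0' (W0 _ _ Wb) Dc)).
  by rewrite cmodM c2 ler_wpM2r ?(mulr_ge0 B0 Cp) // ler_wpM2l.
have W2 : W 0 d (dxAinv (nonlocal a b c))
    (2 * A * B * C + A * (2 * pi * B * (2 * pi * C))).
  apply: W_dxAinv => //; apply: W_D.
    apply: W_le (W_Z _ (W0 _ _ Wc)); rewrite !cmodM c2 ler_wpM2r //.
    by rewrite ler_pM ?mulr_ge0 ?cmod_ge0 // ler_wpM2l.
  apply: W_le (W_Z _ (W_M d0' Db Dc)); exact: ler_wpM2r (mulr_ge0 Bp Cp) _ _ ma.
have Wm : W 0 d (fun=> 3^-1 * mu (fun y => dx a y * dx b y * dx c y))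
    (3^-1 * (2 * pi * A * (2 * pi * B) * (2 * pi * C))).
  apply: W_le (W_cst _ _ _); rewrite cmodM c3 ler_wpM2l ?invr_ge0 //.
  exact: W_mu W3.
apply: W_le (W_B (W_B (W_D W1 (W_Z (3^-1) W3)) W2) Wm).
by rewrite c3 /cubic_cst le_eqVlt; apply/orP; left; apply/eqP; ring.
Qed.

Lemma An_cubic a b c : An a -> An b -> An c -> An (cubic a b c).
Proof.
move=> Aa Ab Ac; apply: An_B; last exact: An_cst.
apply: An_B; last by apply: An_dxAinv; exact: An_nonlocal.
apply: An_D; last by apply: An_Z; exact: An_M3.
under eq_fun do rewrite -mulN1r; do 2 apply: An_Z.
by apply: An_M => //; exact: An_dx.
Qed.

Lemma cubic_lin1 b c : An b -> An c -> linOn (fun a => cubic a b c).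
Proof.
move=> Ab Ac k f g Af Ag; apply/funext => x.
have E1 : nonlocal (lc k f g) b c = lc k (nonlocal f b c) (nonlocal g b c).
  by apply/funext => y; rewrite /lc /nonlocal mu_lc //; ring.
have E2 : (fun y => dx (lc k f g) y * dx b y * dx c y) =
    lc k (fun y => dx f y * dx b y * dx c y) (fun y => dx g y * dx b y * dx c y).
  by apply/funext => y; rewrite dx_lin // /lc; ring.
rewrite /cubic E1 E2 (dxAinv_lin k (An_nonlocal f Ab Ac) (An_nonlocal g Ab Ac)).
rewrite (mu_lc k (An_M3 Af Ab Ac) (An_M3 Ag Ab Ac)) (mu_lc k Af Ag) (dx_lin k Af Ag) /lc.
set t := 3^-1; set p := dxAinv _ x; set q := dxAinv _ x.
set r := mu (fun y => _ * _); set s := mu (fun y => _ * _).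
move: (dx f x) (dx g x) (dx b x) (dx c x) (mu f) (mu g) t p q r s => df dg db dc mf mg t p q r s.
by ring.
Qed.

Lemma cubic_lin2 a c : An a -> An c -> linOn (fun b => cubic a b c).
Proof.
move=> Aa Ac k f g Af Ag; apply/funext => x.
have E1 : nonlocal a (lc k f g) c = lc k (nonlocal a f c) (nonlocal a g c).
  by apply/funext => y; rewrite /lc /nonlocal mu_lc // dx_lin // /lc; ring.
have E2 : (fun y => dx a y * dx (lc k f g) y * dx c y) =
    lc k (fun y => dx a y * dx f y * dx c y) (fun y => dx a y * dx g y * dx c y).
  by apply/funext => y; rewrite dx_lin // /lc; ring.
rewrite /cubic E1 E2 (dxAinv_lin k (An_nonlocal a Af Ac) (An_nonlocal a Ag Ac)).
rewrite (mu_lc k (An_M3 Aa Af Ac) (An_M3 Aa Ag Ac)) (dx_lin k Af Ag) /lc.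
set t := 3^-1; set p := dxAinv _ x; set q := dxAinv _ x.
set r := mu (fun y => _ * _); set s := mu (fun y => _ * _).
move: (dx f x) (dx g x) (dx a x) (dx c x) (mu a) t p q r s => df dg db dc mf t p q r s.
by ring.
Qed.

Lemma cubic_lin3 a b : An a -> An b -> linOn (fun c => cubic a b c).
Proof.
move=> Aa Ab k f g Af Ag; apply/funext => x.
have E1 : nonlocal a b (lc k f g) = lc k (nonlocal a b f) (nonlocal a b g).
  by apply/funext => y; rewrite /lc /nonlocal dx_lin // /lc; ring.
have E2 : (fun y => dx a y * dx b y * dx (lc k f g) y) =
    lc k (fun y => dx a y * dx b y * dx f y) (fun y => dx a y * dx b y * dx g y).
  by apply/funext => y; rewrite dx_lin // /lc; ring.
rewrite /cubic E1 E2 (dxAinv_lin k (An_nonlocal a Ab Af) (An_nonlocal a Ab Ag)).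
rewrite (mu_lc k (An_M3 Aa Ab Af) (An_M3 Aa Ab Ag)) (dx_lin k Af Ag) /lc.
set t := 3^-1; set p := dxAinv _ x; set q := dxAinv _ x.
set r := mu (fun y => _ * _); set s := mu (fun y => _ * _).
move: (dx f x) (dx g x) (dx a x) (dx b x) (mu a) t p q r s => df dg db dc mf t p q r s.
by ring.
Qed.

Definition field_of (gamma : R) u x := cubic u u u x - gamma%:C * dxAinv u x.

(** The term gamma u is pulled out of dxAinv by linearity, which leaves the nonlocal
    bracket. *)
Lemma lhsE gamma u ut x : An u -> lhs gamma u ut x = ut x - field_of gamma u x.
Proof.
move=> Au; have AN := @An_nonlocal u u u Au Au.
have E : (fun y => 2 * mu u ^+ 2 * u y + mu u * dx u y ^+ 2 + gamma%:C * u y) =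
    lc gamma%:C u (nonlocal u u u).
  by apply/funext => y; rewrite /lc /nonlocal; move: (dx u y) (mu u) => e f; ring.
have E3 : (fun y => dx u y ^+ 3) = (fun y => dx u y * dx u y * dx u y).
  by apply/funext => y; move: (dx u y) => e; ring.
rewrite /lhs; cbv zeta; rewrite E E3 -dxAinv_def (dxAinv_lin gamma%:C Au AN).
rewrite /lc /field_of /cubic.
set t := 3^-1; set p := dxAinv _ x; set q := dxAinv _ x; set r := mu (fun y => _ * _).
move: (dx u x) (u x) (ut x) (mu u) t p q r => e0 e1 e2 e3 t p q r.
by ring.
Qed.

Lemma An_field_of gamma u : An u -> An (field_of gamma u).
Proof.
by move=> Au; apply: An_B; [exact: An_cubic|apply: An_Z; exact: An_dxAinv].
Qed.

(** Telescoping: the three arguments of the trilinear form are changed one at a time. *)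
Lemma field_ofB gamma u v : An u -> An v ->
  (fun x => field_of gamma u x - field_of gamma v x) =
  (let w := fun x => u x - v x in
   fun x => cubic w u u x + cubic v w u x + cubic v v w x - gamma%:C * dxAinv w x).
Proof.
move=> Au Av; rewrite /= (linOnB (cubic_lin1 Au Au)) // (linOnB (cubic_lin2 Av Au)) //.
rewrite (linOnB (cubic_lin3 Av Av)) // (linOnB dxAinv_lin) //.
apply/funext => x; rewrite /field_of.
move: (cubic u u u x) (cubic v v v x) (cubic v u u x) (cubic v v u x).
by move: (dxAinv u x) (dxAinv v x) => p q r s t w; ring.
Qed.

Lemma W_field_ofB gamma d u v M m : 0 < d -> W 1 d u M -> W 1 d v M ->
  W 1 d (fun x => u x - v x) m ->
  W 0 d (fun x => field_of gamma u x - field_of gamma v x)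
    ((3 * cubic_cst * M ^+ 2 + `|gamma|) * m).
Proof.
move=> d0 Wu Wv Ww; rewrite (field_ofB gamma (W_An d0 Wu) (W_An d0 Wv)).
have Ww0 : W 0 d (fun x => u x - v x) m by apply: W_mono Ww.
apply: W_le (W_B (W_D (W_D (W_cubic d0 Ww Wu Wu) (W_cubic d0 Wv Ww Wu))
   (W_cubic d0 Wv Wv Ww)) (W_Z gamma%:C (W_dxAinv d0 Ww0))).
by rewrite cmod_real le_eqVlt; apply/orP; left; apply/eqP; ring.
Qed.

End NonlinearMap.

(** * Convolutions of inverse squares *)

Section Convolution.
Context {R : realType}.

(** The coefficient of order n of a product of three power series, with indices cut off at
    N; any N > n gives the same value ([conv3_widen]). *)
Definition conv3 (V : zmodType) (N n : nat) (F : nat -> nat -> nat -> V) : V :=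
  \sum_(i < N) \sum_(j < N) \sum_(l < N | (i + j + l == n)%N) F i j l.

Lemma conv3_widen (V : zmodType) N n (F : nat -> nat -> nat -> V) : (n < N)%N ->
  conv3 n.+1 n F = conv3 N n F.
Proof.
move=> nN.
have wid (G : nat -> V) : (forall i, (n < i)%N -> G i = 0) ->
    \sum_(i < n.+1) G i = \sum_(i < N) G i.
  move=> G0; rewrite (big_ord_widen N) // big_mkcond; apply: eq_bigr => i _.
  by case: ifP => // /negbT; rewrite -leqNgt => /G0.
rewrite /conv3 (wid (fun i => \sum_(j < n.+1) \sum_(l < n.+1 | (i + j + l == n)%N) F i j l));
  last by move=> i ni; rewrite big1 // => j _; rewrite big1 // => l /eqP e; lia.
apply: eq_bigr => i _.
rewrite (wid (fun j => \sum_(l < n.+1 | (i + j + l == n)%N) F i j l));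
  last by move=> j nj; rewrite big1 // => l /eqP e; lia.
apply: eq_bigr => j _; rewrite big_mkcond [RHS]big_mkcond.
rewrite (wid (fun l => if (i + j + l == n)%N then F i j l else 0)) // => l nl.
by case: eqP => // e; lia.
Qed.

Lemma conv3_partial (V : zmodType) m (F : nat -> nat -> nat -> V) :
  \sum_(n < m) conv3 n.+1 n F =
  \sum_(i < m.+1) \sum_(j < m.+1) \sum_(l < m.+1 | (i + j + l < m)%N) F i j l.
Proof.
rewrite (eq_bigr (fun n : 'I_m => conv3 m.+1 n F)); last first.
  by move=> n _; apply: conv3_widen; rewrite ltnS ltnW.
rewrite exchange_big; apply: eq_bigr => i _.
rewrite exchange_big; apply: eq_bigr => j _.
rewrite (exchange_big_dep xpredT) //= [RHS]big_mkcond; apply: eq_bigr => l _.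
case: ifP => h; last first.
  by rewrite big1 // => n /eqP e; move: h; rewrite e ltn_ord.
rewrite (bigD1 (Ordinal h)) //= big1 ?addr0 // => n /andP[/eqP e /eqP]; case.
by apply: val_inj.
Qed.

(** Unlike constants, the weights 1 / (n + 1)^2 are stable under convolution up to a factor. *)
Definition qn (n : nat) : R := (n.+1%:R ^+ 2)^-1.

Lemma qn_gt0 n : 0 < qn n.
Proof. by rewrite invr_gt0 exprn_gt0. Qed.

Lemma qn_le1 n : qn n <= 1.
Proof. by rewrite invf_le1 ?exprn_gt0 // exprn_ege1 // ler1n. Qed.

Lemma sum_qn N : \sum_(i < N) qn i <= 2.
Proof.
have h : forall N, \sum_(i < N.+1) qn i <= 2 - N.+1%:R^-1.
  elim=> [|n IH]; first by rewrite big_ord_recl big_ord0 /qn /= expr1n invr1; lra.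
  rewrite big_ord_recr /=; apply: le_trans (lerD IH (lexx _)) _.
  rewrite /qn -addrA lerD2l -subr_ge0.
  set y : R := n.+1%:R; have y0 : 0 < y by rewrite ltr0n.
  rewrite -natr1 -/y.
  have -> : - (y + 1)^-1 - (- y^-1 + ((y + 1) ^+ 2)^-1) = (y * (y + 1) ^+ 2)^-1.
    by field; rewrite !gt_eqF // ; lra.
  by rewrite invr_ge0 mulr_ge0 // ?sqr_ge0 // ltW.
case: N => [|n]; first by rewrite big_ord0.
by apply: le_trans (h n) _; rewrite gerBl.
Qed.

Lemma sum_eq_le (N j m : nat) (c : R) : 0 <= c ->
  \sum_(l < N | (j + l == m)%N) c <= c.
Proof.
move=> c0; have [/existsP[l /eqP lm]|/existsPn h] := boolP [exists l : 'I_N, (j + l == m)%N].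
  rewrite (bigD1 l) /=; last by rewrite lm.
  rewrite big1 ?addr0 // => k /andP[/eqP km /eqP]; case.
  by apply: val_inj => /=; lia.
by rewrite big1 // => l /eqP lm; case/negP: (h l); apply/eqP.
Qed.

(** Clearing denominators, this is (j + l + 1)^2 <= 2 (j + 1)^2 + 2 (l + 1)^2. *)
Lemma qn_mul (j l m : nat) : (j + l = m)%N -> qn j * qn l <= 2 * qn m * (qn j + qn l).
Proof.
move=> <-; rewrite /qn -[(j + l).+1%:R]natr1 natrD.
have a0 : 0 < j.+1%:R :> R by []; have b0 : 0 < l.+1%:R :> R by [].
have -> : j%:R = j.+1%:R - 1 :> R by rewrite -natr1; ring.
have -> : l%:R = l.+1%:R - 1 :> R by rewrite -natr1; ring.
have a1 : 1 <= j.+1%:R :> R by rewrite ler1n.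
have b1 : 1 <= l.+1%:R :> R by rewrite ler1n.
move: (j.+1%:R : R) (l.+1%:R : R) a0 b0 a1 b1 => a b a0 b0 a1 b1.
have s0 : 0 < a - 1 + (b - 1) + 1 by lra.
rewrite -subr_ge0.
have -> : 2 * ((a - 1 + (b - 1) + 1) ^+ 2)^-1 * ((a ^+ 2)^-1 + (b ^+ 2)^-1)
   - (a ^+ 2)^-1 * (b ^+ 2)^-1 =
   ((a - b) ^+ 2 + 2 * (a + b) - 1) / ((a - 1 + (b - 1) + 1) ^+ 2 * a ^+ 2 * b ^+ 2).
  by field; rewrite !gt_eqF.
rewrite divr_ge0 //; first by have := sqr_ge0 (a - b); lra.
by rewrite !mulr_ge0 ?exprn_ge0 // ltW.
Qed.

Lemma conv2_qn N m : \sum_(j < N) \sum_(l < N | (j + l == m)%N) qn j * qn l <= 8 * qn m.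
Proof.
apply: le_trans (_ : \sum_(j < N) \sum_(l < N | (j + l == m)%N)
   (2 * qn m * qn j + 2 * qn m * qn l) <= _).
  apply: ler_sum => j _; apply: ler_sum => l /eqP jl.
  by rewrite -mulrDr; exact: qn_mul.
under eq_bigr do rewrite big_split; rewrite big_split /=.
have q0 n : 0 <= qn n by exact/ltW/qn_gt0.
have h : \sum_(j < N) \sum_(l < N | (j + l == m)%N) 2 * qn m * qn j <= 4 * qn m.
  apply: le_trans (_ : \sum_(j < N) 2 * qn m * qn j <= _).
    by apply: ler_sum => j _; apply: sum_eq_le; rewrite !mulr_ge0.
  rewrite -mulr_sumr; have := ler_wpM2l (q0 m) (sum_qn N); lra.
have h' : \sum_(j < N) \sum_(l < N | (j + l == m)%N) 2 * qn m * qn l <= 4 * qn m.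
  apply: le_trans h; rewrite (exchange_big_dep xpredT) //=.
  by apply: ler_sum => j _; under eq_bigl do rewrite addnC.
lra.
Qed.

Lemma conv3_qn n : conv3 n.+1 n (fun i j l => qn i * qn j * qn l) <= 64 * qn n.
Proof.
have q0 k : 0 <= qn k by exact/ltW/qn_gt0.
apply: le_trans (_ : 8 * (8 * qn n) <= _); last by rewrite mulrA -natrM.
apply: le_trans (ler_wpM2l _ (conv2_qn n.+1 n)); last by [].
rewrite /conv3 mulr_sumr; apply: ler_sum => i _.
have ni : (n - i < n.+1)%N by rewrite ltnS leq_subr.
have i_n : (i <= n)%N by rewrite -ltnS.
rewrite [in leRHS](bigD1 (Ordinal ni)) /=; last by rewrite subnKC.
rewrite [in leRHS]big1 ?addr0; last first.
  by move=> k /andP[/eqP e /eqP]; case; apply: val_inj => /=; lia.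
apply: le_trans (_ : qn i * (8 * qn (n - i)%N) <= _); last first.
  by rewrite mulrCA.
apply: le_trans (ler_wpM2l (q0 i) (conv2_qn n.+1 (n - i)%N)).
rewrite mulr_sumr; apply: ler_sum => j _; rewrite mulr_sumr le_eqVlt; apply/orP; left.
apply/eqP; apply: eq_big => [l|l _]; last by rewrite mulrA.
by apply/eqP/eqP; lia.
Qed.

End Convolution.

#[local] Opaque cubic.

(** * Bounds on the Taylor coefficients in time *)

Section TaylorCoefficients.
Context {R : realType}.
Implicit Types (f g u v : R -> R[i]) (x d D : R) (gamma A B : R).

(** The recursion that a power series in t must satisfy to solve the equation. *)
Definition taylor_step gamma (a : nat -> R -> R[i]) n : R -> R[i] := fun x =>
  (n.+1%:R)^-1 * (conv3 n.+1 n (fun i j l => cubic (a i) (a j) (a l) x)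
                  - gamma%:C * dxAinv (a n) x).

Lemma taylor_step_ext gamma a b n : (forall i, (i <= n)%N -> a i = b i) ->
  taylor_step gamma a n = taylor_step gamma b n.
Proof.
move=> ab; apply/funext => x; rewrite /taylor_step (ab n (leqnn n)).
suff E : conv3 n.+1 n (fun i j l => cubic (a i) (a j) (a l) x) =
         conv3 n.+1 n (fun i j l => cubic (b i) (b j) (b l) x) by rewrite E.
have ab' (i : 'I_n.+1) : a i = b i by apply: ab; rewrite -ltnS.
apply: eq_bigr => i _; apply: eq_bigr => j _; apply: eq_bigr => l _.
by rewrite (ab' i) (ab' j) (ab' l).
Qed.

Lemma taylor_exists gamma u0 : exists a : nat -> R -> R[i],
  a 0%N = u0 /\ forall n, a n.+1 = taylor_step gamma a n.
Proof.
(* The recursion uses all previous coefficients, so the whole history is carried along. *)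
pose fix hist m : nat -> R -> R[i] :=
  if m is n.+1 then fun i => if (i <= n)%N then hist n i else taylor_step gamma (hist n) n
  else fun=> u0.
have hE m k i : (i <= m)%N -> hist (m + k)%N i = hist m i.
  move=> im; elim: k => [|k IH]; first by rewrite addn0.
  by rewrite addnS /= (leq_trans im) ?leq_addr // IH.
exists (fun n => hist n n); split=> // n.
rewrite /= ltnn; apply: taylor_step_ext => i ni.
by rewrite -(subnKC ni) hE.
Qed.

(** This accumulated loss of width in the inductive bound on Taylor coefficients would be
    unbounded if each step lost a fixed fraction. *)
Lemma exp_step n : (n.+2%:R / n.+1%:R) ^+ n <= expR 1 :> R.
Proof.
apply: le_trans (_ : expR (n.+1%:R^-1) ^+ n <= _).
  rewrite lerXn2r ?nnegrE ?expR_ge0 ?divr_ge0 //.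
  apply: le_trans (expR_ge1Dx _).
  by rewrite -[n.+2%:R]natr1 mulrDl mulfV // mul1r.
rewrite -expRM_natl ler_expR ler_pdivrMr ?mul1r //.
by rewrite ler_nat.
Qed.

(** Here 512 = 64 * 4 * 2 collects the constant of [conv3_qn], the ratio qn n / qn n.+1 <= 4
    and (n + 2) / (n + 1) <= 2; the factor D + 1 comes from [W_loss] and expR 1 from
    [exp_step]. *)
Definition kappa D : R := 512 * cubic_cst * (D + 1) * expR 1.

Lemma W_taylor_step d e D gamma (a : nat -> R -> R[i]) n A r : 0 < d -> d < e -> e - d <= D ->
  0 <= A -> 0 <= r ->
  (forall i, (i <= n)%N -> W 1 e (a i) (A * qn i * r ^+ i)) ->
  W 1 d (taylor_step gamma a n)
    ((n.+1%:R)^-1 * ((D + 1) / (e - d) * (64 * cubic_cst * A * (A ^+ 2 + `|gamma|) * qn n * r ^+ n))).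
Proof.
move=> d0 de eD A0 r0 Wa.
have e0 : 0 < e by apply: lt_trans de.
have n0 : 0 <= n.+1%:R^-1 :> R by rewrite invr_ge0.
suff main : W 0 e (fun x => conv3 n.+1 n (fun i j l => cubic (a i) (a j) (a l) x)
                  - gamma%:C * dxAinv (a n) x)
    (64 * cubic_cst * A * (A ^+ 2 + `|gamma|) * qn n * r ^+ n).
  have D0 : 0 <= D by lra.
  have := W_Z (n.+1%:R^-1) (W_loss D0 de eD main).
  by rewrite cmodV cmod_nat.
have q0 k : 0 <= @qn R k by exact/ltW/qn_gt0.
have K1 := @cubic_cst_ge1 R.
have Wc : W 0 e (fun x => conv3 n.+1 n (fun i j l => cubic (a i) (a j) (a l) x))
    (cubic_cst * A ^+ 3 * r ^+ n * (64 * qn n)).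
  apply: W_le (_ : cubic_cst * A ^+ 3 * r ^+ n * conv3 n.+1 n (fun i j l => qn i * qn j * qn l) <= _) _.
    by rewrite ler_wpM2l ?conv3_qn // !mulr_ge0 ?exprn_ge0 //; lra.
  rewrite /conv3 mulr_sumr; apply: W_sum => i _.
  rewrite mulr_sumr; apply: W_sum => j _.
  rewrite mulr_sumr; apply: W_sum => l /eqP ijl.
  have le (k : 'I_n.+1) : (k <= n)%N by rewrite -ltnS.
  apply: W_le (W_cubic e0 (Wa i (le i)) (Wa j (le j)) (Wa l (le l))).
  have -> : r ^+ n = r ^+ i * r ^+ j * r ^+ l by rewrite -!exprD ijl.
  by rewrite le_eqVlt; apply/orP; left; apply/eqP; ring.
have WH : W 0 e (fun x => gamma%:C * dxAinv (a n) x) (`|gamma| * (A * qn n * r ^+ n)).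
  rewrite -cmod_real; apply: W_Z; apply: W_dxAinv => //; apply: W_mono (Wa n (leqnn n)) => //.
apply: W_le (W_B Wc WH).
set Q := qn n * r ^+ n; have Q0 : 0 <= Q by rewrite mulr_ge0 ?exprn_ge0.
have -> : cubic_cst * A ^+ 3 * r ^+ n * (64 * qn n) + `|gamma| * (A * qn n * r ^+ n)
  = (64 * cubic_cst * A ^+ 3 + `|gamma| * A) * Q by rewrite /Q; ring.
rewrite -[leRHS]mulrA -/Q ler_wpM2r //.
have -> : 64 * cubic_cst * A * (A ^+ 2 + `|gamma|) =
  64 * cubic_cst * A ^+ 3 + (64 * cubic_cst) * (`|gamma| * A) by ring.
by rewrite lerD2l ler_peMl ?mulr_ge0 //; lra.
Qed.

(** The width between d and D is divided unevenly: the step from a n to a n.+1 takes its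
    fraction 1/(n+2). The factor n + 2 that this costs is compensated by the 1/(n+1) of the
    recursion, and the growth of the inductive bound under the change of width is
    ((n+2)/(n+1))^n, which stays below exp 1. *)
Lemma taylor_bound gamma D u0 A B (a : nat -> R -> R[i]) : 0 < D ->
  W 1 D u0 A -> a 0%N = u0 -> (forall n, a n.+1 = taylor_step gamma a n) ->
  0 <= B -> kappa D * (A ^+ 2 + `|gamma|) <= B ->
  forall n d, 0 < d -> d < D -> W 1 d (a n) (A * qn n * (B / (D - d)) ^+ n).
Proof.
move=> D0 Wu a0 aS B0 KB n; have A0 := W_ge0 Wu.
have [m] := ubnP n; elim: m n => // m IH [|n] nm d d0 dD.
  rewrite a0 expr0 /qn expr1n invr1 !mulr1; apply: W_mono Wu => //; exact: ltW.
rewrite aS.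
(* The half-width of the strip for the first n coefficients, larger than d. *)
pose e := d + (D - d) / n.+2%:R.
have n1 : 0 < n.+1%:R :> R by []; have n2 : 0 < n.+2%:R :> R by [].
have n2E : n.+2%:R = n.+1%:R + 1 :> R by rewrite natr1.
have Dd : 0 < D - d by lra.
have ed : e - d = (D - d) / n.+2%:R by rewrite /e; ring.
have De : D - e = (D - d) * (n.+1%:R / n.+2%:R).
  rewrite /e n2E; clear -n1; move: (n.+1%:R : R) n1 => y y0.
  by field; rewrite gt_eqF //; lra.
have ed0 : 0 < e - d by rewrite ed divr_gt0.
have De0 : 0 < D - e by rewrite De mulr_gt0 // divr_gt0.
set r := B / (D - e); have r0 : 0 <= r by rewrite divr_ge0 // ltW.
have de : d < e by rewrite -subr_gt0.
have Wa i : (i <= n)%N -> W 1 e (a i) (A * qn i * r ^+ i).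
  by move=> i_n; apply: IH; [exact: leq_ltn_trans i_n nm|exact: lt_trans de|rewrite -subr_gt0].
have eD : e - d <= D.
  rewrite ed; apply: le_trans (_ : D - d <= _); last by rewrite gerBl ltW.
  by rewrite ler_pdivrMr // ler_peMr ?ler1n // ltW.
apply: W_le (W_taylor_step gamma d0 de eD A0 r0 Wa).
have q0 k : 0 <= @qn R k by exact/ltW/qn_gt0.
have rE : r ^+ n = (B / (D - d)) ^+ n * (n.+2%:R / n.+1%:R) ^+ n.
  rewrite -exprMn; congr (_ ^+ n); rewrite /r De; clear -n1 n2 Dd.
  move: (n.+1%:R : R) (n.+2%:R : R) n1 n2 => y z y0 z0.
  by field; rewrite !gt_eqF.
have p1 : 0 <= (B / (D - d)) ^+ n by rewrite exprn_ge0 // divr_ge0 // ltW.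
have K1 := @cubic_cst_ge1 R.
have G0 : 0 <= A * (A ^+ 2 + `|gamma|) by rewrite mulr_ge0 // addr_ge0 // exprn_ge0.
have qq : qn n <= 4 * qn n.+1 :> R.
  rewrite /qn -[4]invrK -invfM lef_pV2 ?posrE ?mulr_gt0 ?invr_gt0 ?exprn_gt0 //.
  rewrite n2E; have : 1 <= n.+1%:R :> R by rewrite ler1n.
  move: (n.+1%:R : R) => y y1.
  rewrite ler_pdivrMl //; have : 0 <= (y - 1) * (3 * y + 1) by rewrite mulr_ge0 //; lra.
  by rewrite !expr2; lra.
have nn : n.+1%:R^-1 * n.+2%:R <= 2 :> R.
  rewrite ler_pdivrMl // n2E; have : 1 <= n.+1%:R :> R by rewrite ler1n.
  lra.
have -> : n.+1%:R^-1 * ((D + 1) / (e - d) * (64 * cubic_cst * A * (A ^+ 2 + `|gamma|) * qn n * r ^+ n))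
  = (64 * cubic_cst * (D + 1) * (A * (A ^+ 2 + `|gamma|)) / (D - d) * (B / (D - d)) ^+ n) *
    ((n.+1%:R^-1 * n.+2%:R) * (qn n * (n.+2%:R / n.+1%:R) ^+ n)).
  rewrite ed rE; clear -n1 n2 Dd.
  move: (qn n) ((B / _) ^+ n) ((n.+2%:R / n.+1%:R) ^+ n) => q y z.
  move: (n.+1%:R : R) (n.+2%:R : R) n1 n2 => y1 z1 y0 z0.
  by field; rewrite !gt_eqF.
have C0 : 0 <= 64 * cubic_cst * (D + 1) * (A * (A ^+ 2 + `|gamma|)) / (D - d) * (B / (D - d)) ^+ n.
  rewrite mulr_ge0 // divr_ge0 ?(ltW Dd) // mulr_ge0 // mulr_ge0; lra.
apply: le_trans (ler_wpM2l C0 (_ : _ <= 2 * (4 * qn n.+1 * expR 1))) _.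
  rewrite ler_pM ?mulr_ge0 ?invr_ge0 ?exprn_ge0 ?divr_ge0 //.
  by rewrite ler_pM ?exprn_ge0 ?divr_ge0 // exp_step.
have -> : 64 * cubic_cst * (D + 1) * (A * (A ^+ 2 + `|gamma|)) / (D - d) * (B / (D - d)) ^+ n *
   (2 * (4 * qn n.+1 * expR 1)) =
   A * qn n.+1 * (B / (D - d)) ^+ n / (D - d) * (kappa D * (A ^+ 2 + `|gamma|)).
  by rewrite /kappa; ring.
have -> : A * qn n.+1 * (B / (D - d)) ^+ n.+1 = A * qn n.+1 * (B / (D - d)) ^+ n / (D - d) * B.
  by rewrite exprSr; ring.
by rewrite ler_wpM2l // divr_ge0 ?(ltW Dd) // !mulr_ge0.
Qed.

End TaylorCoefficients.

(** * Power series in time *)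

Section PowerSeriesInTime.
Context {R : realType}.
Implicit Types (a : nat -> R -> R[i]) (c : nat -> R[i]) (x d : R) (t h : R[i]).

Lemma geom_sum_le (q : R) n N : 0 <= q -> q < 1 ->
  \sum_(i < N) q ^+ (n + i) <= q ^+ n / (1 - q).
Proof.
move=> q0 q1; have q1' : 0 < 1 - q by lra.
under eq_bigr do rewrite exprD; rewrite -mulr_sumr ler_wpM2l ?exprn_ge0 //.
rewrite -[leRHS]mul1r ler_pdivlMr // mulrC -opprB mulNr -subrX1 opprB.
by rewrite gerBl exprn_ge0.
Qed.

Definition ps c a x := csum (fun n => c n * a n x).

Lemma W_ps_term p d c a (A r C rho : R) n :
  (forall n, W p d (a n) (A * r ^+ n)) -> (forall n, cmod (c n) <= C * rho ^+ n) ->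
  W p d (fun x => c n * a n x) (C * A * (rho * r) ^+ n).
Proof.
move=> Wa cC; apply: W_le (W_Z (c n) (Wa n)).
have -> : C * A * (rho * r) ^+ n = C * rho ^+ n * (A * r ^+ n) by rewrite exprMn; ring.
by rewrite ler_wpM2r ?cC // (W_ge0 (Wa n)).
Qed.

Lemma W_ps_all p d c a (A r C rho : R) : 0 <= d -> 0 <= r -> 0 <= C -> 0 <= rho -> rho * r < 1 ->
  (forall n, W p d (a n) (A * r ^+ n)) -> (forall n, cmod (c n) <= C * rho ^+ n) ->
  [/\ W p d (ps c a) (C * A / (1 - rho * r)),
      forall n, W p d (fun x => ps c a x - \sum_(i < n) c i * a i x)
         (C * A / (1 - rho * r) * (rho * r) ^+ n) &
      forall x, ccvg (fun n => \sum_(i < n) c i * a i x) (ps c a x)].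
Proof.
move=> d0 r0 C0 rho0 q1 Wa cC.
have A0 : 0 <= A by have := W_ge0 (Wa 0%N); rewrite expr0 mulr1.
have q0 : 0 <= rho * r by rewrite mulr_ge0.
have Wt n := W_ps_term n Wa cC.
have CA : 0 <= C * A by rewrite mulr_ge0.
have S n N : \sum_(i < N) C * A * (rho * r) ^+ (n + i) <= C * A / (1 - rho * r) * (rho * r) ^+ n.
  by rewrite -mulr_sumr [leRHS]mulrAC -[leRHS]mulrA ler_wpM2l // geom_sum_le.
have S0 N : \sum_(i < N) C * A * (rho * r) ^+ i <= C * A / (1 - rho * r).
  by have := S 0%N N; rewrite expr0 mulr1.
split; first exact: W_csum d0 Wt S0.
  by move=> n; exact: W_csum_tail d0 Wt S0 (S n).
by move=> x; exact: W_csum_cvg d0 Wt S0.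
Qed.

Lemma natr_expr_pred (V : comNzRingType) (y : V) n : n%:R * y ^+ n.-1 * y = n%:R * y ^+ n.
Proof. by case: n => [|n] /=; rewrite ?mul0r // -mulrA -exprSr. Qed.

Lemma expr_first_order (r h0 : R) n : 0 <= r -> 0 <= h0 ->
  r ^+ n + n%:R * r ^+ n.-1 * h0 <= (r + h0) ^+ n.
Proof.
move=> r0 h00; elim: n => [|n IH]; first by rewrite !mul0r addr0.
rewrite [leRHS]exprS; apply: le_trans (ler_wpM2l (addr_ge0 r0 h00) IH).
have : 0 <= n%:R * r ^+ n.-1 * h0 * h0 by rewrite !mulr_ge0 ?exprn_ge0.
have -> : (r + h0) * (r ^+ n + n%:R * r ^+ n.-1 * h0) =
  r ^+ n.+1 + h0 * r ^+ n + (n%:R * r ^+ n.-1 * r) * h0 + n%:R * r ^+ n.-1 * h0 * h0.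
  by rewrite exprS; ring.
rewrite natr_expr_pred /= -natr1.
have -> : (n%:R + 1) * r ^+ n * h0 = n%:R * r ^+ n * h0 + h0 * r ^+ n by ring.
by lra.
Qed.

(** The remainder has only terms of degree at least 2 in h, so that passing from increments
    of size h0 to h gains the square of the ratio; the moduli dominate by positivity of all
    coefficients. *)
Lemma pow_taylor t h (h0 : R) n : 0 < h0 -> cmod h <= h0 ->
  cmod ((t + h) ^+ n - t ^+ n - n%:R * t ^+ n.-1 * h) <= (cmod h / h0) ^+ 2 * (cmod t + h0) ^+ n.
Proof.
move=> h00 hh; have t0 := cmod_ge0 t; have hp := cmod_ge0 h.
apply: le_trans (_ : (cmod h / h0) ^+ 2 *
   ((cmod t + h0) ^+ n - cmod t ^+ n - n%:R * cmod t ^+ n.-1 * h0) <= _); last first.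
  rewrite ler_wpM2l ?sqr_ge0 //.
  have : 0 <= n%:R * cmod t ^+ n.-1 * h0 by rewrite !mulr_ge0 ?exprn_ge0 // ltW.
  by have := exprn_ge0 n t0; lra.
elim: n => [|n IH].
  by rewrite !expr0 !mul0r !subrr cmod0 mulr_ge0 ?sqr_ge0.
set D := (t + h) ^+ n - t ^+ n - n%:R * t ^+ n.-1 * h in IH *.
set E := (cmod t + h0) ^+ n - cmod t ^+ n - n%:R * cmod t ^+ n.-1 * h0 in IH *.
have -> : (t + h) ^+ n.+1 - t ^+ n.+1 - n.+1%:R * t ^+ n.+1.-1 * h =
   (t + h) * D + n%:R * t ^+ n.-1 * h ^+ 2.
  have e := natr_expr_pred t n.
  have -> : (t + h) * D + n%:R * t ^+ n.-1 * h ^+ 2 =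
     (t + h) * (t + h) ^+ n - (t + h) * t ^+ n - (n%:R * t ^+ n.-1 * t) * h by rewrite /D; ring.
  rewrite e !exprS /= -natr1; ring.
have -> : (cmod t + h0) ^+ n.+1 - cmod t ^+ n.+1 - n.+1%:R * cmod t ^+ n.+1.-1 * h0 =
   (cmod t + h0) * E + n%:R * cmod t ^+ n.-1 * h0 ^+ 2.
  have e := natr_expr_pred (cmod t) n.
  have -> : (cmod t + h0) * E + n%:R * cmod t ^+ n.-1 * h0 ^+ 2 =
     (cmod t + h0) * (cmod t + h0) ^+ n - (cmod t + h0) * cmod t ^+ n
       - (n%:R * cmod t ^+ n.-1 * cmod t) * h0 by rewrite /E; ring.
  rewrite e !exprS /= -natr1; ring.
rewrite [leRHS]mulrDr; apply: le_trans (cmodD _ _) _; apply: lerD.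
  rewrite cmodM mulrCA ler_pM ?cmod_ge0 //.
  by apply: le_trans (cmodD _ _) _; rewrite lerD2l.
rewrite !cmodM cmod_nat !cmodX.
have -> : (cmod h / h0) ^+ 2 * (n%:R * cmod t ^+ n.-1 * h0 ^+ 2) =
  n%:R * cmod t ^+ n.-1 * cmod h ^+ 2 by field; rewrite gt_eqF.
by [].
Qed.

Lemma pow_deriv_le t (h0 : R) n : 0 < h0 ->
  cmod (n%:R * t ^+ n.-1) <= h0^-1 * (cmod t + h0) ^+ n.
Proof.
move=> h00; rewrite cmodM cmod_nat cmodX ler_pdivlMl // mulrC.
apply: le_trans (expr_first_order n (cmod_ge0 t) (ltW h00)).
by rewrite lerDr exprn_ge0 // cmod_ge0.
Qed.

(** Bounds what a truncated Taylor series leaves over in a trilinear expression, the terms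
    of order at least m in t: half of the exponent of eta ^ 2 gives eta ^ m, the other half
    is left for three geometric series. *)
Lemma high_order_sum_le (eta : R) m : 0 <= eta -> eta < 1 ->
  \sum_(i < m.+1) \sum_(j < m.+1) \sum_(l < m.+1 | ~~ (i + j + l < m)%N)
    (eta ^+ 2) ^+ (i + j + l) <= eta ^+ m * (1 - eta)^-1 ^+ 3.
Proof.
move=> e0 e1; have g N : \sum_(i < N) eta ^+ i <= (1 - eta)^-1.
  by have := geom_sum_le 0 N e0 e1; rewrite expr0 mul1r.
have i0 : 0 <= (1 - eta)^-1 by rewrite invr_ge0; lra.
have s0 N : 0 <= \sum_(i < N) eta ^+ i by apply: sumr_ge0 => i _; rewrite exprn_ge0.
apply: le_trans (_ : eta ^+ m * (\sum_(i < m.+1) eta ^+ i) ^+ 3 <= _); last first.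
  by rewrite ler_wpM2l ?exprn_ge0 // lerXn2r ?nnegrE.
have E3 : (\sum_(i < m.+1) eta ^+ i) ^+ 3 = (\sum_(i < m.+1) eta ^+ i) *
    ((\sum_(i < m.+1) eta ^+ i) * (\sum_(i < m.+1) eta ^+ i)) by rewrite !exprS expr0 mulr1.
rewrite E3 mulr_suml mulr_sumr; apply: ler_sum => i _.
rewrite mulr_suml !mulr_sumr; apply: ler_sum => j _.
rewrite !mulr_sumr big_mkcond; apply: ler_sum => l _.
have p n : 0 <= eta ^+ n by rewrite exprn_ge0.
case: ifP => [|_]; last by rewrite !mulr_ge0.
rewrite -leqNgt => h; rewrite -exprM mul2n -addnn exprD ler_pM //.
  by rewrite ler_wiXn2l // ltW.
by rewrite !exprD mulrA.
Qed.

(** A partial sum lies in An, so that trilinearity applies without any limit. *)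
Lemma field_of_partial gamma a t m x : (forall n, An (a n)) ->
  field_of gamma (fun y => \sum_(n < m) t ^+ n * a n y) x =
  \sum_(i < m) \sum_(j < m) \sum_(l < m) t ^+ (i + j + l) * cubic (a i) (a j) (a l) x
  - gamma%:C * \sum_(n < m) t ^+ n * dxAinv (a n) x.
Proof.
move=> Aa; set U := fun y => \sum_(n < m) t ^+ n * a n y.
have Ao (i : 'I_m) : An (a i) by [].
have AU : An U by apply: An_sum => n; exact: An_Z.
rewrite /field_of [in X in _ - X](linOn_sum (index_enum _) (fun i : 'I_m => t ^+ i) dxAinv_lin Ao).
congr (_ - _).
rewrite [in LHS](linOn_sum (index_enum _) (fun i : 'I_m => t ^+ i) (cubic_lin1 AU AU) Ao).
apply: eq_bigr => i _.
rewrite [in LHS](linOn_sum (index_enum _) (fun i : 'I_m => t ^+ i) (cubic_lin2 (Aa i) AU) Ao).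
rewrite mulr_sumr; apply: eq_bigr => j _.
rewrite [in LHS](linOn_sum (index_enum _) (fun i : 'I_m => t ^+ i) (cubic_lin3 (Aa i) (Aa j)) Ao).
rewrite !mulr_sumr; apply: eq_bigr => l _.
by rewrite !mulrA -!exprD.
Qed.

End PowerSeriesInTime.

(** * The Taylor series solves the equation *)

Section TaylorSolution.
Context {R : realType}.
Implicit Types (a : nat -> R -> R[i]) (c : nat -> R[i]) (x d : R) (t h : R[i]).

Definition sol a t : R -> R[i] := ps (fun n => t ^+ n) a.
Definition sol_t a t : R -> R[i] := ps (fun n => n%:R * t ^+ n.-1) a.

(** The recursion cancels all orders below m in t; only orders that tend to zero with m
    remain. *)
Lemma taylor_truncation gamma a t m x : (forall n, a n.+1 = taylor_step gamma a n) ->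
  (forall n, An (a n)) ->
  field_of gamma (fun y => \sum_(n < m.+1) t ^+ n * a n y) x
    - \sum_(n < m.+1) (n%:R * t ^+ n.-1) * a n x =
  \sum_(i < m.+1) \sum_(j < m.+1) \sum_(l < m.+1 | ~~ (i + j + l < m)%N)
     t ^+ (i + j + l) * cubic (a i) (a j) (a l) x - gamma%:C * (t ^+ m * dxAinv (a m) x).
Proof.
move=> aS Aa; rewrite field_of_partial //.
have alg (S1 S2 S3 y z : R[i]) : S1 + S2 - z * (S3 + y) - (S1 - z * S3) = S2 - z * y by ring.
set F := fun i j l : nat => t ^+ (i + j + l) * cubic (a i) (a j) (a l) x.
have -> : \sum_(n < m.+1) (n%:R * t ^+ n.-1) * a n x =
    \sum_(i < m.+1) \sum_(j < m.+1) \sum_(l < m.+1 | (i + j + l < m)%N) F i j l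
    - gamma%:C * \sum_(n < m) t ^+ n * dxAinv (a n) x.
  rewrite big_ord_recl /= !mul0r add0r -(conv3_partial m F) mulr_sumr -sumrB.
  apply: eq_bigr => n _; rewrite /bump /= add1n add0n aS /taylor_step.
  rewrite -[(_ * _) * _]mulrA mulrCA [n.+1%:R * _]mulrA mulfV ?pnatr_eq0 // mul1r.
  rewrite mulrBr [in RHS]mulrCA; congr (_ - _).
  rewrite /conv3 mulr_sumr; apply: eq_bigr => i _.
  rewrite mulr_sumr; apply: eq_bigr => j _; rewrite mulr_sumr.
  by apply: eq_bigr => l /eqP e; rewrite /F e.
have -> : \sum_(i < m.+1) \sum_(j < m.+1) \sum_(l < m.+1) F i j l =
    \sum_(i < m.+1) \sum_(j < m.+1) \sum_(l < m.+1 | (i + j + l < m)%N) F i j l +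
    \sum_(i < m.+1) \sum_(j < m.+1) \sum_(l < m.+1 | ~~ (i + j + l < m)%N) F i j l.
  rewrite -big_split; apply: eq_bigr => i _.
  rewrite -big_split; apply: eq_bigr => j _.
  by rewrite (bigID (fun l : 'I_m.+1 => (i + j + l < m)%N)).
rewrite [\sum_(n < m.+1) t ^+ n * _]big_ord_recr.
exact: alg.
Qed.

(** The margin D - d - |t| B is divided by three: one part widens the strip from d to e, one
    allows increments of t up to h0, and the last keeps the ratio of the majorant geometric
    series below 1. The equation is passed to the limit of the truncated Taylor series, on
    which it holds up to terms of high order, because the vector field is Lipschitz from
    [W 1 e] to [W 0 e] on bounded sets. *)
Lemma taylor_solution gamma D (u0 : R -> R[i]) A B a : 0 < D ->
  W 1 D u0 A -> a 0%N = u0 -> (forall n, a n.+1 = taylor_step gamma a n) ->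
  0 < B -> kappa D * (A ^+ 2 + `|gamma|) <= B ->
  forall d t, 0 < d -> d < D -> cmod t * B < D - d ->
  exists e M h0 : R, [/\ d < e, 0 < h0, W 1 e (sol a t) M & W 1 e (sol_t a t) M]
   /\ (forall h, h != 0 -> cmod h <= h0 ->
        W 1 e (fun x => h^-1 * (sol a (t + h) x - sol a t x) - sol_t a t x) (cmod h * M))
   /\ sol_t a t = field_of gamma (sol a t).
Proof.
move=> D0 Wu a0 aS B0 KB d t d0 dD tB; have A0 := W_ge0 Wu.
have t0 := cmod_ge0 t.
pose g := (D - d - cmod t * B) / 3; have g0 : 0 < g by rewrite /g; lra.
have g3 : D - d = cmod t * B + 3 * g by rewrite /g; field.
pose e := d + g; pose h0 := g / B.
have e0 : 0 < e by rewrite /e addr_gt0.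
have h00 : 0 < h0 by rewrite divr_gt0.
have tB0 : 0 <= cmod t * B by rewrite mulr_ge0 // ltW.
have De : D - e = cmod t * B + 2 * g by rewrite /e opprD addrA g3; ring.
have eD : 0 < D - e by rewrite De; lra.
pose r := B / (D - e); have r0 : 0 <= r by rewrite divr_ge0 // ltW.
pose rho := cmod t + h0; have rho0 : 0 <= rho by rewrite addr_ge0 // ltW.
have Wa n : W 1 e (a n) (A * r ^+ n).
  apply: W_le (taylor_bound D0 Wu a0 aS (ltW B0) KB n e0 _); last by rewrite -subr_gt0.
  by rewrite ler_wpM2r ?exprn_ge0 // ler_piMr ?qn_le1.
have q1 : rho * r < 1.
  rewrite /rho /r mulrA ltr_pdivrMr // mul1r De mulrDl /h0 divfK ?gt_eqF //.
  by rewrite ltrD2l; lra.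
have q0 : 0 <= rho * r by rewrite mulr_ge0.
have tr : cmod t <= rho by rewrite /rho lerDl ltW.
have Aan n : An (a n) := W_An e0 (Wa n).
have e0' := ltW e0.
have cu h : cmod h <= h0 -> forall n, cmod ((t + h) ^+ n) <= 1 * rho ^+ n.
  move=> hh n; rewrite mul1r cmodX lerXn2r ?nnegrE ?cmod_ge0 //.
  by apply: le_trans (cmodD _ _) _; rewrite lerD2l.
have cu0 n : cmod (t ^+ n) <= 1 * rho ^+ n.
  by rewrite mul1r cmodX lerXn2r ?nnegrE.
have ct n : cmod (n%:R * t ^+ n.-1) <= h0^-1 * rho ^+ n by exact: pow_deriv_le.
have ih0 : 0 <= h0^-1 by rewrite invr_ge0 ltW.
have [Wsol Wtail csol] := W_ps_all e0' r0 ler01 rho0 q1 Wa cu0.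
have [Wsolt _ csolt] := W_ps_all e0' r0 ih0 rho0 q1 Wa ct.
rewrite mul1r in Wsol Wtail.
set M1 := A / (1 - rho * r) in Wsol Wtail.
have M10 : 0 <= M1 := W_ge0 Wsol.
pose M := (1 + h0^-1 + h0^-1 ^+ 2) * M1.
exists e, M, h0; split; [split|split] => //.
- by rewrite /e ltrDl.
- apply: W_le Wsol; rewrite /M ler_peMl //.
  by rewrite -addrA lerDl addr_ge0 // sqr_ge0.
- apply: W_le Wsolt; rewrite -mulrA -/M1 /M ler_wpM2r //.
  by rewrite addrAC lerDr addr_ge0 // sqr_ge0.
- move=> h hn0 hh.
  have hp : 0 < cmod h by rewrite lt_def cmod_eq0 hn0 cmod_ge0.
  have [_ _ csolh] := W_ps_all e0' r0 ler01 rho0 q1 Wa (cu h hh).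
  pose c n := h^-1 * ((t + h) ^+ n - t ^+ n) - n%:R * t ^+ n.-1.
  have cq n : cmod (c n) <= cmod h * h0^-1 ^+ 2 * rho ^+ n.
    have -> : c n = h^-1 * ((t + h) ^+ n - t ^+ n - n%:R * t ^+ n.-1 * h).
      by rewrite /c; field.
    rewrite cmodM cmodV ler_pdivrMl //; apply: le_trans (pow_taylor t n h00 hh) _.
    by rewrite exprMn le_eqVlt; apply/orP; left; apply/eqP; rewrite /rho; ring.
  have C0 : 0 <= cmod h * h0^-1 ^+ 2 by rewrite mulr_ge0 ?sqr_ge0 // ltW.
  have [Wq _ cvq] := W_ps_all e0' r0 C0 rho0 q1 Wa cq.
  have -> : (fun x => h^-1 * (sol a (t + h) x - sol a t x) - sol_t a t x) = ps c a.
    apply/funext => x; apply: (ccvg_unique _ (cvq x)).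
    have := ccvgD (ccvgZ h^-1 (ccvgD (csolh x) (ccvgZ (-1) (csol x)))) (ccvgZ (-1) (csolt x)).
    rewrite !mulN1r; congr (ccvg _ _); apply/funext => n.
    rewrite !mulN1r -!sumrB mulr_sumr -sumrB; apply: eq_bigr => i _.
    by rewrite /c; ring.
  apply: W_le Wq.
  have -> : cmod h * h0^-1 ^+ 2 * A / (1 - rho * r) = cmod h * (h0^-1 ^+ 2 * M1).
    by rewrite -[LHS]mulrA -/M1 -[LHS]mulrA.
  rewrite ler_wpM2l ?cmod_ge0 //.
  by rewrite ler_wpM2r // lerDr addr_ge0.
apply/funext => x.
(* A square root of the ratio leaves a geometric decay after the summation over the orders
   at least m. *)
pose eta := Num.sqrt (rho * r).
have eta2 : eta ^+ 2 = rho * r by rewrite sqr_sqrtr.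
have eta0 : 0 <= eta by exact: sqrtr_ge0.
have eta1 : eta < 1 by rewrite -sqrtr1 ltr_sqrt.
have qeta n : (rho * r) ^+ n <= eta ^+ n.
  rewrite lerXn2r ?nnegrE // -eta2 expr2 ler_piMr // ltW //.
pose V m := \sum_(n < m.+1) (n%:R * t ^+ n.-1) * a n x.
have cV : ccvg V (sol_t a t x).
  have := ccvg_shift 1 (csolt x); congr (ccvg _ _).
apply: (ccvg_unique cV).
have K1 := @cubic_cst_ge1 R; have K0 : 0 <= @cubic_cst R by lra.
pose Q := (3 * cubic_cst * (2 * M1) ^+ 2 + `|gamma|) * M1.
pose Q' := cubic_cst * A ^+ 3 * (1 - eta)^-1 ^+ 3 + `|gamma| * A.
apply: (@ccvg_squeeze _ _ _ (fun m => (Q + Q') * eta ^+ m)); last first.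
  rewrite -[X in _ --> X](mulr0 (Q + Q')); apply: cvgMr.
  by apply: cvg_expr; rewrite ger0_norm.
move=> m; pose U y := \sum_(n < m.+1) t ^+ n * a n y.
have Ww := Wtail m.+1.
have q1m : (rho * r) ^+ m.+1 <= 1 by rewrite exprn_ile1 // ltW.
have Ww1 : W 1 e (fun y => sol a t y - U y) (M1 * eta ^+ m).
  apply: W_le Ww; rewrite ler_wpM2l //; apply: le_trans (qeta _) _.
  by rewrite exprS ler_piMl ?exprn_ge0 // ltW.
have WU : W 1 e U (2 * M1).
  have -> : U = (fun y => sol a t y - (sol a t y - U y)) by apply/funext => y; ring.
  apply: W_le (W_B Wsol Ww); rewrite -[M1 * _]mulr1 -[X in X + _]mulr1 -mulrA -mulrDr mulrC.
  by rewrite ler_wpM2r // mulr1; lra.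
have Ws2 : W 1 e (sol a t) (2 * M1) by apply: W_le Wsol; lra.
have WF := W_field_ofB gamma e0 Ws2 WU Ww1.
(* The difference from F at the limit splits into the error of the argument, controlled by
   the Lipschitz bound, and the truncation error. *)
have -> : V m - field_of gamma (sol a t) x =
   - (field_of gamma (sol a t) x - field_of gamma U x) - (field_of gamma U x - V m).
  by move: (V m) (field_of _ U x) (field_of _ (sol a t) x) => y1 y2 y3; ring.
rewrite mulrDl; apply: le_trans (cmodD _ _) _; rewrite !cmodN; apply: lerD.
  by apply: le_trans (W_sup x e0' WF) _; rewrite /Q mulrA.
rewrite /V /U taylor_truncation //; apply: le_trans (cmodD _ _) _.
rewrite cmodN /Q' mulrDl; apply: lerD; last first.
  rewrite !cmodM cmod_real cmodX -[leRHS]mulrA ler_wpM2l //.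
  have W0m : W 0 e (a m) (A * r ^+ m) by apply: W_mono (Wa m).
  apply: le_trans (_ : rho ^+ m * (A * r ^+ m) <= _).
    rewrite ler_pM ?exprn_ge0 ?cmod_ge0 ?lerXn2r ?nnegrE //.
    exact: W_sup e0' (W_dxAinv e0 W0m).
  have -> : rho ^+ m * (A * r ^+ m) = A * (rho * r) ^+ m by rewrite [(rho * r) ^+ m]exprMn mulrCA.
  exact: ler_wpM2l A0 _ _ (qeta m).
apply: le_trans (cmod_sum _ _ _) _.
apply: le_trans (_ : cubic_cst * A ^+ 3 * (eta ^+ m * (1 - eta)^-1 ^+ 3) <= _); last first.
  by rewrite [eta ^+ m * _]mulrC mulrA.
have KA : 0 <= cubic_cst * A ^+ 3 by rewrite mulr_ge0 // exprn_ge0.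
apply: le_trans (ler_wpM2l KA (high_order_sum_le m eta0 eta1)).
rewrite mulr_sumr; apply: ler_sum => i _; apply: le_trans (cmod_sum _ _ _) _.
rewrite mulr_sumr; apply: ler_sum => j _; apply: le_trans (cmod_sum _ _ _) _.
rewrite mulr_sumr; apply: ler_sum => l _.
rewrite eta2 cmodM cmodX exprMn mulrCA ler_pM ?exprn_ge0 ?cmod_ge0 ?lerXn2r ?nnegrE //.
apply: le_trans (W_sup x e0' (W_cubic e0 (Wa i) (Wa j) (Wa l))) _.
by rewrite !exprD le_eqVlt; apply/orP; left; apply/eqP; ring.
Qed.

End TaylorSolution.

(** * Uniqueness along rays *)

Section Uniqueness.
Context {R : realType}.
Implicit Types (f g : R -> R[i]) (u v ut vt : R[i] -> R -> R[i]) (t h : R[i]) (d x s : R).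

Definition quotient u ut t h : R -> R[i] := fun x => h^-1 * (u (t + h) x - u t x) - ut t x.

(** Weaker than holomorphy for the norm of G^(d,s+2) when s >= 0, which dominates that of
    [W 1 d]; uniqueness is proved in this larger class. *)
Definition wholo d (rho : R) u ut := forall t, cmod t < rho ->
  (exists B, W 1 d (u t) B) /\ (exists B, W 1 d (ut t) B) /\
  (forall e : R, 0 < e -> exists2 eta : R, 0 < eta &
     forall h, h != 0 -> cmod h < eta -> W 1 d (quotient u ut t h) e).

(** Differentiability bounds u locally, and the ray is compact. *)
Lemma wholo_ray_bounded d rho u ut t1 : 0 < d -> wholo d rho u ut -> cmod t1 < rho ->
  exists M, forall s, 0 <= s <= 1 -> W 1 d (u (s%:C * t1)) M.
Proof.
move=> d0 hu t1r.
have inr s : 0 <= s <= 1 -> cmod (s%:C * t1) < rho.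
  move=> /andP[s0 s1]; apply: le_lt_trans t1r.
  by rewrite cmodM cmod_real ger0_norm // ler_piMl // cmod_ge0.
have cK := @segment_compact R 0 1; move/compact_near_coveringP : cK => cK.
have loc s : `[0, 1]%classic s -> \forall s' \near s & M \near +oo,
    0 <= s' <= 1 -> W 1 d (u (s'%:C * t1)) M.
  rewrite /= in_itv /= => s01.
  have [[B WB] [[B' WB'] hq]] := hu _ (inr s s01).
  have [eta eta0 he] := hq 1 ltr01.
  have B0 := W_ge0 WB; have B0' := W_ge0 WB'.
  exists (ball s (eta / (cmod t1 + 1)), [set M | B + (1 + B') * eta <= M]).
    split; first by apply: nbhsx_ballx; rewrite divr_gt0 // ltr_wpDl // cmod_ge0.
    by exists (B + (1 + B') * eta); split; [exact: num_real|move=> M /ltW].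
  move=> [s' M] [/= ss hM] s'01; apply: W_le hM _.
  have k0 : 0 < cmod t1 + 1 by rewrite ltr_wpDl // cmod_ge0.
  pose h : R[i] := (s' - s)%:C * t1.
  have he' : cmod h <= eta.
    rewrite cmodM cmod_real distrC; move: ss; rewrite /ball /= ltr_pdivlMr // => ss.
    by apply: le_trans (ltW ss); rewrite ler_wpM2l // lerDl.
  have hlt : cmod h < eta.
    rewrite cmodM cmod_real distrC; move: ss; rewrite /ball /= ltr_pdivlMr // => ss.
    by apply: le_lt_trans ss; rewrite ler_wpM2l // lerDl.
  have shE : s'%:C * t1 = s%:C * t1 + h by rewrite /h rmorphB /= -mulrDl addrC subrK.
  have [h0|h0] := eqVneq h 0.
    rewrite shE h0 addr0; apply: W_le WB; rewrite lerDl mulr_ge0 // ?ltW //; lra.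
  have -> : u (s'%:C * t1) = (fun x => u (s%:C * t1) x +
      h * (quotient u ut (s%:C * t1) h x + ut (s%:C * t1) x)).
    by apply/funext => x; rewrite shE /quotient; field.
  apply: W_le (W_D WB (W_Z h (W_D (he h h0 hlt) WB'))).
  by rewrite lerD2l [leRHS]mulrC ler_wpM2r //; lra.
have [M [_ hM]] := cK _ _ _ _ loc.
exists (M + 1) => s s01; apply: (hM (M + 1)) => //; first by rewrite ltrDl.
Qed.

(** Pairing with finitely many Fourier coefficients reduces functions of t with values in W
    to real functions; coefficients z of modulus wt 1 d k and suitable phases recover the
    norm. *)
Definition functional (z : int -> R[i]) (l : seq int) f : R[i] := \sum_(k <- l) z k * fourier f k.

Lemma functional_le z l d f B : uniq l -> (forall k, cmod (z k) <= wt 1 d k) ->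
  W 1 d f B -> cmod (functional z l f) <= B.
Proof.
move=> ul zw [_ _ hf]; apply: le_trans (cmod_sum _ _ _) _; apply: le_trans (hf l ul).
by apply: ler_sum => k _; rewrite cmodM ler_wpM2r ?cmod_ge0.
Qed.

Lemma functionalB z l f g : ccontinuous f -> ccontinuous g ->
  functional z l (fun x => f x - g x) = functional z l f - functional z l g.
Proof.
move=> cf cg; rewrite /functional -sumrB; apply: eq_bigr => k _.
by rewrite fourierB // mulrBr.
Qed.

Lemma functionalZ z l a f : ccontinuous f ->
  functional z l (fun x => a * f x) = a * functional z l f.
Proof.
move=> cf; rewrite /functional mulr_sumr; apply: eq_bigr => k _.
by rewrite fourierZ // mulrCA.
Qed.

Lemma ray_derive d rho u ut t1 z l s : wholo d rho u ut -> t1 != 0 ->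
  cmod (s%:C * t1) < rho -> uniq l -> (forall k, cmod (z k) <= wt 1 d k) ->
  is_derive s 1 (fun r : R => Re (functional z l (u (r%:C * t1))))
    (Re (t1 * functional z l (ut (s%:C * t1)))).
Proof.
move=> hu t10 sr ul zw; set t := s%:C * t1 in sr *.
have [[B WB] [[B' WB'] hq]] := hu t sr.
have cu : ccontinuous (u t) := W_cont WB; have cut : ccontinuous (ut t) := W_cont WB'.
have ct1 : 0 < cmod t1 by rewrite lt_def cmod_eq0 t10 cmod_ge0.
set F := fun r : R => _; set G := Re _.
have key e : 0 < e -> exists2 eta : R, 0 < eta & forall h : R, h != 0 -> `|h| < eta ->
   `|h^-1 * (F (h + s) - F s) - G| <= e.
  move=> e0; have [eta eta0 he] := hq (e / cmod t1) (divr_gt0 e0 ct1).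
  exists (eta / cmod t1); first by rewrite divr_gt0.
  move=> h h0 heta.
  pose H : R[i] := h%:C * t1.
  have H0 : H != 0 by rewrite mulf_neq0 // -cmod_eq0 cmod_real normr_eq0.
  have Heta : cmod H < eta by rewrite cmodM cmod_real -ltr_pdivlMr.
  have Wq := he H H0 Heta.
  have e1 : (h + s)%:C * t1 = t + H by rewrite /t /H rmorphD /= mulrDl addrC.
  have WuH : W 1 d (u (t + H)) (B + cmod H * (e / cmod t1 + B')).
    have -> : u (t + H) = (fun x => u t x + H * (quotient u ut t H x + ut t x)).
      by apply/funext => x; rewrite /quotient; field.
    by apply: W_D WB (W_Z _ (W_D Wq WB')).
  have cuH := W_cont WuH.
  have E : functional z l (quotient u ut t H) =
     H^-1 * (functional z l (u (t + H)) - functional z l (u t)) - functional z l (ut t).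
    rewrite /quotient functionalB ?functionalZ ?functionalB //; first exact: ccontB.
    by apply: ccontZ; exact: ccontB.
  have -> : h^-1 * (F (h + s) - F s) - G = Re (t1 * functional z l (quotient u ut t H)).
    rewrite E /F /G e1 -/t.
    have hC : h%:C != 0 by rewrite -cmod_eq0 cmod_real normr_eq0.
    set X := functional z l (u (t + H)); set Y := functional z l (u t).
    set Z := functional z l (ut t).
    have -> : t1 * (H^-1 * (X - Y) - Z) = (h^-1)%:C * (X - Y) - t1 * Z.
      by rewrite /H fmorphV; field; rewrite hC t10.
    have Rr (c : R) (w : R[i]) : Re (c%:C * w) = c * Re w by rewrite cReM /= mul0r subr0.
    by rewrite cReD cReN Rr cReD cReN.
  apply: le_trans (cRe_le _) _; rewrite cmodM -ler_pdivlMl // mulrC.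
  exact: functional_le Wq.
have cv : (fun h : R => h^-1 *: (F (h *: 1 + s) - F s)) @ 0^' --> G.
  apply/cvgrPdist_le => e /key[eta eta0 he].
  exists eta => // h /=; rewrite sub0r normrN => hh h0.
  by rewrite /GRing.scale /= mulr1 distrC; exact: he.
apply: DeriveDef; first by apply: cvgP cv.
exact: cvg_lim cv.
Qed.

(** Compare F with the primitive of s |-> b (s - s0) ^ j that vanishes at s0. *)
Lemma mean_value_le (F dF : R -> R) (s0 s1 b : R) j : s0 <= s1 -> F s0 = 0 ->
  (forall s, s0 <= s <= s1 -> is_derive s 1 F (dF s)) ->
  (forall s, s0 <= s <= s1 -> dF s <= b * (s - s0) ^+ j) ->
  F s1 <= b * (s1 - s0) ^+ j.+1 / j.+1%:R.
Proof.
move=> s01 F0 hF hb.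
pose P (s : R) := b / j.+1%:R * (s - s0) ^+ j.+1.
have dP (s : R) : is_derive s 1 P (b * (s - s0) ^+ j).
  have h1 : is_derive s 1 (fun r : R => r - s0) 1.
    by have := is_deriveB (is_derive_id s (1 : R)) (is_derive_cst s0 s 1); rewrite subr0.
  have h2 := is_deriveZ (b / j.+1%:R) (is_deriveX j.+1 h1).
  have -> : b * (s - s0) ^+ j = (b / j.+1%:R) *: ((j.+1%:R * (s - s0) ^+ j) *: 1).
    by rewrite /GRing.scale /= mulr1 mulrA divfK // pnatr_eq0.
  have PE : P = (b / j.+1%:R) \*: ((fun r => r - s0) ^+ j.+1).
    by apply/funext => r; rewrite /P /= exprfctE.
  by rewrite PE.
have dG s : s0 <= s <= s1 -> is_derive s 1 (fun r => F r - P r) (dF s - b * (s - s0) ^+ j).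
  by move=> hs; have := hF s hs => hF'; apply: is_deriveB.
have oo s : s \in `]s0, s1[ -> s0 <= s <= s1.
  by rewrite in_itv /= => /andP[/ltW -> /ltW ->].
have : F s1 - P s1 <= F s0 - P s0.
  apply: (@ler0_derive1_nincr _ (fun r => F r - P r) s0 s1) => //.
  - by move=> s /oo hs; have := dG s hs => -[].
  - move=> s /oo hs; have := dG s hs => h; rewrite derive1E derive_val.
    by rewrite subr_le0; exact: hb.
  - apply: derivable_within_continuous => s; rewrite in_itv /= => hs.
    by have := dG s hs => -[].
rewrite F0 /P subrr expr0n mulr0 subrr subr_le0 => /le_trans; apply.
by rewrite mulrAC.
Qed.

(** The losses of width in an n-fold integration produce n ^ n, which the n! of the iterated
    integral compensates up to a geometric factor. *)
Lemma expn_le_fact n : n%:R ^+ n <= expR 1 ^+ n * n`!%:R :> R.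
Proof.
elim: n => [|n IH]; first by rewrite !expr0 mul1r.
have h : n.+1%:R ^+ n <= expR 1 * n%:R ^+ n :> R.
  case: n {IH} => [|n]; first by rewrite !expr0 mulr1; apply: le_trans (expR_ge1Dx _); rewrite lerDl.
  have e : n.+2%:R <= n.+1%:R * expR (n.+1%:R^-1) :> R.
    apply: le_trans (ler_wpM2l _ (expR_ge1Dx _)); last by [].
    by rewrite mulrDr mulr1 mulfV // natr1.
  apply: le_trans (_ : (n.+1%:R * expR (n.+1%:R^-1)) ^+ n.+1 <= _).
    by rewrite lerXn2r ?nnegrE // mulr_ge0 // expR_ge0.
  rewrite exprMn -expRM_natl mulfV //.
  by rewrite mulrC.
rewrite exprS factS natrM; apply: le_trans (ler_wpM2l _ h) _ => //.
apply: le_trans (_ : n.+1%:R * (expR 1 * (expR 1 ^+ n * n`!%:R)) <= _).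
  by rewrite ler_wpM2l // ler_wpM2l ?expR_ge0.
by rewrite exprS le_eqVlt; apply/orP; left; apply/eqP; ring.
Qed.

(** On a finite set of frequencies the norm is attained by the functional whose phases are
    those of the coefficients at the end point; its real part is then integrated. *)
Lemma ray_integrate d d' rho u ut v vt t1 s0 s1 b j :
  wholo d rho u ut -> wholo d rho v vt -> t1 != 0 -> cmod t1 < rho -> d' <= d ->
  0 <= s0 -> s0 <= s1 -> s1 <= 1 -> u (s0%:C * t1) = v (s0%:C * t1) ->
  (forall s, s0 <= s <= s1 ->
     W 1 d' (fun x => ut (s%:C * t1) x - vt (s%:C * t1) x) (b * (s - s0) ^+ j)) ->
  W 1 d' (fun x => u (s1%:C * t1) x - v (s1%:C * t1) x)
    (cmod t1 * b * (s1 - s0) ^+ j.+1 / j.+1%:R).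
Proof.
move=> hu hv t10 t1r dd s00 s01 s11 uv0 hb.
have inr s : s0 <= s <= s1 -> cmod (s%:C * t1) < rho.
  move=> /andP[ss0 ss1]; apply: le_lt_trans t1r.
  rewrite cmodM cmod_real ger0_norm ?(le_trans s00) // ler_piMl ?cmod_ge0 //.
  exact: le_trans s11.
have s11' : s0 <= s1 <= s1 by rewrite s01 lexx.
have s00' : s0 <= s0 <= s1 by rewrite s01 lexx.
have [[Bu Wu] _] := hu _ (inr s1 s11'); have [[Bv Wv] _] := hv _ (inr s1 s11').
split.
- by move=> x; rewrite (W_per Wu) (W_per Wv).
- by apply: ccontB; [exact: W_cont Wu|exact: W_cont Wv].
move=> l ul; set w := fun x => _.
have phase k : exists y : R[i], cmod y = 1 /\ y * fourier w k = (cmod (fourier w k))%:C.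
  by have [y y1 y2] := cmod_phase (fourier w k); exists y.
have [th thP] := boolp.choice phase.
have th1 k := (thP k).1; have thE k := (thP k).2.
pose z k := (wt 1 d' k)%:C * th k.
have zw' k : cmod (z k) <= wt 1 d' k.
  by rewrite cmodM th1 mulr1 cmod_real ger0_norm // wt_ge0.
have zw k : cmod (z k) <= wt 1 d k by apply: le_trans (zw' k) (wt_mono _ _ _).
have -> : \sum_(k <- l) wt 1 d' k * cmod (fourier w k) = Re (functional z l w).
  rewrite /functional cRe_sum; apply: eq_bigr => k _.
  by rewrite /z -mulrA thE -rmorphM.
rewrite /w functionalB; [|exact: W_cont Wu|exact: W_cont Wv].
rewrite cReD cReN.
pose dF s := Re (t1 * functional z l (ut (s%:C * t1))) - Re (t1 * functional z l (vt (s%:C * t1))).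
apply: (@mean_value_le (fun s : R => Re (functional z l (u (s%:C * t1))) -
   Re (functional z l (v (s%:C * t1)))) dF s0 s1 (cmod t1 * b) j s01).
- by rewrite uv0 subrr.
- move=> s hs.
  have du := ray_derive hu t10 (inr s hs) ul zw.
  have dv := ray_derive hv t10 (inr s hs) ul zw.
  exact: is_deriveB.
- move=> s hs.
  have [[B1 W1] [[B2 W2] _]] := hu _ (inr s hs); have [[B3 W3] [[B4 W4] _]] := hv _ (inr s hs).
  have -> : dF s = Re (t1 * functional z l (fun x => ut (s%:C * t1) x - vt (s%:C * t1) x)).
    rewrite functionalB; [|exact: W_cont W2|exact: W_cont W4].
    by rewrite mulrBr cReD cReN.
  apply: le_trans (ler_norm _) _; apply: le_trans (cRe_le _) _.
  rewrite cmodM -mulrA ler_wpM2l ?cmod_ge0 //.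
  exact: functional_le (hb s hs).
Qed.

(** The equation is integrated n + 1 times along the ray, each time at the cost of a width
    d/(2(n+1)), so that half of the strip is left. The factors (n+1)^(n+1) and 1/(n+1)! only
    amount to a geometric growth in n, so w = u - v vanishes on an interval whose length
    does not depend on its left end. *)
Lemma unique_step gamma d rho u ut v vt t1 M s0 s1 :
  0 < d -> wholo d rho u ut -> wholo d rho v vt ->
  (forall t, cmod t < rho -> ut t = field_of gamma (u t)) ->
  (forall t, cmod t < rho -> vt t = field_of gamma (v t)) ->
  t1 != 0 -> cmod t1 < rho ->
  (forall s, 0 <= s <= 1 -> W 1 d (u (s%:C * t1)) M) ->
  (forall s, 0 <= s <= 1 -> W 1 d (v (s%:C * t1)) M) ->
  0 <= s0 -> s0 <= s1 -> s1 <= 1 -> u (s0%:C * t1) = v (s0%:C * t1) ->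
  4 * expR 1 * (cmod t1 * (3 * cubic_cst * M ^+ 2 + `|gamma|) * (d + 1)) * (s1 - s0) <= d ->
  u (s1%:C * t1) = v (s1%:C * t1).
Proof.
move=> d0 hu hv eu ev t10 t1r WuM WvM s00 s01 s11 uv0 small.
have M0 : 0 <= M by apply: W_ge0 (WuM 0 _); rewrite lexx ler01.
have K0 : 0 <= @cubic_cst R by have := @cubic_cst_ge1 R; lra.
set C := 3 * cubic_cst * M ^+ 2 + `|gamma| in small.
have C0 : 0 <= C by rewrite addr_ge0 // !mulr_ge0 // exprn_ge0.
set Q := cmod t1 * C * (d + 1) in small.
have ct := cmod_ge0 t1.
have Q0 : 0 <= Q by rewrite !mulr_ge0 //; lra.
have inr s : s0 <= s <= s1 -> 0 <= s <= 1.
  by move=> /andP[a b]; rewrite (le_trans s00 a) (le_trans b s11).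
have inr' s : s0 <= s <= s1 -> cmod (s%:C * t1) < rho.
  move=> /inr/andP[a b]; apply: le_lt_trans t1r.
  by rewrite cmodM cmod_real ger0_norm // ler_piMl.
have iter n j : (j <= n.+1)%N -> forall s, s0 <= s <= s1 ->
    W 1 (d - j%:R * (d / (2 * n.+1%:R))) (fun x => u (s%:C * t1) x - v (s%:C * t1) x)
      (2 * M * (Q / (d / (2 * n.+1%:R))) ^+ j / j`!%:R * (s - s0) ^+ j).
  set ep := d / (2 * n.+1%:R).
  have ep0 : 0 < ep by rewrite divr_gt0 // mulr_gt0.
  elim: j => [|j IH] jn s hs.
    rewrite mul0r subr0 !expr0 fact0 invr1 !mulr1.
    have -> : 2 * M = M + M by ring.
    by apply: W_B; [exact: WuM (inr s hs)|exact: WvM (inr s hs)].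
  have -> : 2 * M * (Q / ep) ^+ j.+1 / j.+1`!%:R * (s - s0) ^+ j.+1 =
     cmod t1 * ((d + 1) / ep * (C * (2 * M * (Q / ep) ^+ j / j`!%:R)))
       * (s - s0) ^+ j.+1 / j.+1%:R.
    rewrite factS natrM [(Q / ep) ^+ _]exprS /Q; move: (_ ^+ j) (_ ^+ j.+1) => y1 y2.
    have f0 : j`!%:R != 0 :> R by rewrite pnatr_eq0 -lt0n fact_gt0.
    have j0 : j.+1%:R != 0 :> R by rewrite pnatr_eq0.
    move: (j`!%:R : R) (j.+1%:R : R) f0 j0 => f k f0 j0.
    by field; rewrite f0 j0 gt_eqF.
  have [ss0 ss1] := andP hs.
  have d2 : d / 2 = n.+1%:R * ep.
    rewrite /ep; have n0 : n.+1%:R != 0 :> R by rewrite pnatr_eq0.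
    by clear -n0; move: (n.+1%:R : R) n0 => y y0; field.
  have jn2 : j%:R * ep + ep <= d / 2.
    by rewrite d2 -{2}[ep]mul1r -mulrDl natr1 ler_wpM2r ?ler_nat // ltW.
  have jnn : d - j.+1%:R * ep = d - j%:R * ep - ep by rewrite -natr1; ring.
  have j0 : 0 <= j%:R * ep by rewrite mulr_ge0 // ltW.
  apply: (ray_integrate hu hv t10 t1r) => //; [rewrite jnn; lra|exact: le_trans ss1 s11|].
  move=> r /andP[rs0 rs]; have hr : s0 <= r <= s1 by rewrite rs0 (le_trans rs).
  rewrite (eu _ (inr' r hr)) (ev _ (inr' r hr)).
  set e := d - j%:R * ep; have e0 : 0 < e by rewrite /e; lra.
  have ed : e <= d by rewrite /e; lra.
  have Wu : W 1 e (u (r%:C * t1)) M by apply: W_mono (WuM r (inr r hr)).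
  have Wv : W 1 e (v (r%:C * t1)) M by apply: W_mono (WvM r (inr r hr)).
  have WF := W_field_ofB gamma e0 Wu Wv (IH (ltnW jn) r hr).
  have e1 : d - j.+1%:R * ep < e by rewrite jnn /e; lra.
  have ee : e - (d - j.+1%:R * ep) = ep by rewrite jnn /e; ring.
  have e2 : e - (d - j.+1%:R * ep) <= d by rewrite ee; lra.
  have := W_loss (ltW d0) e1 e2 WF; rewrite ee -/C.
  by rewrite !mulrA.
have small_n n : forall x, cmod (u (s1%:C * t1) x - v (s1%:C * t1) x) <= 2 * M * 2^-1 ^+ n.+1.
  move=> x; have s1s : s0 <= s1 <= s1 by rewrite s01 lexx.
  have := iter n n.+1 (leqnn _) s1 s1s; set ep := d / (2 * n.+1%:R) => Ww.
  have n0 : n.+1%:R != 0 :> R by rewrite pnatr_eq0.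
  have de : d - n.+1%:R * ep = d / 2.
    by rewrite /ep; clear -n0; move: (n.+1%:R : R) n0 => y y0; field.
  rewrite de in Ww; have d20 : 0 <= d / 2 by lra.
  apply: le_trans (W_sup x d20 Ww) _.
  have f0 : 0 < n.+1`!%:R :> R by rewrite ltr0n fact_gt0.
  have alg (y1 y2 y3 : R) : 2 * M * y1 / y2 * y3 = 2 * M * (y2^-1 * (y1 * y3)) by ring.
  rewrite alg ler_wpM2l ?mulr_ge0 //.
  have -> : (Q / ep) ^+ n.+1 * (s1 - s0) ^+ n.+1 = (2 * Q * (s1 - s0) / d) ^+ n.+1 * n.+1%:R ^+ n.+1.
    rewrite -!exprMn; congr (_ ^+ _); rewrite /ep; clear -n0 d0.
    move: (n.+1%:R : R) n0 => y y0; field; by rewrite y0 gt_eqF.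
  set y := 2 * Q * (s1 - s0) / d.
  have y0 : 0 <= y.
    apply: divr_ge0; last exact: ltW.
    by apply: mulr_ge0; [exact: mulr_ge0|rewrite subr_ge0].
  have ye : y * expR 1 <= 2^-1.
    rewrite /y mulrAC ler_pdivrMr //; apply: le_trans (_ : 2^-1 * (4 * expR 1 * Q * (s1 - s0)) <= _).
      by rewrite le_eqVlt; apply/orP; left; apply/eqP; field.
    by rewrite ler_wpM2l.
  rewrite ler_pdivrMl //.
  apply: le_trans (ler_wpM2l (exprn_ge0 n.+1 y0) (expn_le_fact n.+1)) _.
  rewrite mulrA -exprMn mulrC ler_wpM2l ?(ltW f0) //.
  apply: lerXn2r ye; rewrite nnegrE ?invr_ge0 //.
  by apply: mulr_ge0 => //; exact: expR_ge0.
apply/funext => x; apply/eqP; rewrite -subr_eq0; apply/eqP.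
apply: (@ccvg_unique _ (fun=> u (s1%:C * t1) x - v (s1%:C * t1) x)); first exact: ccvg_cst.
apply: (@ccvg_squeeze _ _ _ (fun n => (2 * M) * 2^-1 ^+ n)); last first.
  rewrite -[X in _ --> X](mulr0 (2 * M)); apply: cvgMr.
  by apply: cvg_expr; rewrite ger0_norm; lra.
move=> n; rewrite subr0; apply: le_trans (small_n n x) _.
rewrite ler_wpM2l ?mulr_ge0 // exprS ler_piMl ?exprn_ge0 //; lra.
Qed.

(** The length of a step depends only on a bound M of both solutions on the ray, so finitely
    many equal steps reach t. *)
Lemma unique_in_disk gamma d rho u ut v vt :
  0 < d -> wholo d rho u ut -> wholo d rho v vt ->
  (forall t, cmod t < rho -> ut t = field_of gamma (u t)) ->
  (forall t, cmod t < rho -> vt t = field_of gamma (v t)) ->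
  u 0 = v 0 -> forall t, cmod t < rho -> u t = v t.
Proof.
move=> d0 hu hv eu ev uv0 t1 t1r; have [->//|t10] := eqVneq t1 0.
have [Mu hMu] := wholo_ray_bounded d0 hu t1r.
have [Mv hMv] := wholo_ray_bounded d0 hv t1r.
pose M := Num.max Mu Mv.
have WuM s : 0 <= s <= 1 -> W 1 d (u (s%:C * t1)) M.
  by move=> /hMu; apply: W_le; rewrite le_max lexx.
have WvM s : 0 <= s <= 1 -> W 1 d (v (s%:C * t1)) M.
  by move=> /hMv; apply: W_le; rewrite le_max lexx orbT.
pose L := 4 * expR 1 * (cmod t1 * (3 * cubic_cst * M ^+ 2 + `|gamma|) * (d + 1)).
pose N := (Num.truncn (L / d)).+1.
have N0 : 0 < N%:R :> R by rewrite ltr0n.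
have LN : L / N%:R <= d.
  by rewrite ler_pdivrMr // mulrC -ler_pdivrMr // ltW // truncnS_gt.
have step k : (k <= N)%N -> u ((k%:R / N%:R)%:C * t1) = v ((k%:R / N%:R)%:C * t1).
  elim: k => [|k IH] kN; first by rewrite mul0r mul0r.
  have kk : k.+1%:R / N%:R - k%:R / N%:R = N%:R^-1 :> R by rewrite -natr1 mulrDl mul1r; ring.
  apply: (@unique_step gamma d rho u ut v vt t1 M (k%:R / N%:R) (k.+1%:R / N%:R)) => //.
  - by rewrite ler_wpM2r ?invr_ge0 // ler_nat.
  - by rewrite ler_pdivrMr // mul1r ler_nat.
  - exact: IH (ltnW kN).
  - by rewrite kk.
have := step N (leqnn N); rewrite mulfV ?gt_eqF //.
by rewrite !mul1r.
Qed.

End Uniqueness.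

(** * Gevrey norms and Wiener norms *)

Section GevreyNorms.
Context {R : realType}.
Implicit Types (f g : R -> R[i]) (k : int) (x d s : R).

Definition Gterm d s f k : R :=
  jap k `^ (2 * s) * expR (4 * pi * d * `|k%:~R|) * cmod (fourier f k) ^+ 2.

Lemma Gnorm_leP d s f (G : R) : 0 <= G ->
  (Gnorm d s f <= G%:E)%E <->
  (forall l : seq int, uniq l -> \sum_(k <- l) Gterm d s f k <= G ^+ 2).
Proof.
move=> G0; have -> : G%:E = sqrte (G ^+ 2)%:E.
  by rewrite EFin_expe sqrte_sqr gee0_abs.
rewrite /Gnorm lee_sqrt ?lee_fin ?sqr_ge0 //; split.
  move=> h l ul; rewrite -lee_fin; apply: le_trans h; apply: esum_ge.
  exists [set` l]; first by split; [exact: finite_seq|].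
  by rewrite -fsbig_seq // sumEFin.
move=> h; apply: ge_ereal_sup => _ [A [fA _] <-].
rewrite fsbig_finite // sumEFin lee_fin; apply: h.
exact: finmap.fset_uniq.
Qed.

Lemma Gnorm_ge0 d s f : (0 <= Gnorm d s f)%E.
Proof. exact: sqrte_ge0. Qed.

Lemma jap_sq k : jap k ^+ 2 = 1 + `|k%:~R| ^+ 2 :> R.
Proof. by rewrite /jap sqr_sqrtr ?addr_ge0 ?sqr_ge0 // real_normK ?num_real. Qed.

Lemma jap_ge1 k : 1 <= jap k :> R.
Proof. by rewrite /jap -{1}sqrtr1 ler_sqrt ?addr_ge0 ?sqr_ge0 // lerDl sqr_ge0. Qed.

Lemma jap_le k : jap k <= 1 + `|k%:~R| :> R.
Proof.
have n0 : 0 <= `|k%:~R| :> R by [].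
rewrite -(@ler_pXn2r _ 2) ?nnegrE ?addr_ge0 ?sqrtr_ge0 // jap_sq sqrrD expr1n mul1r.
by move: n0; set n := `|_|; rewrite mulr2n; lra.
Qed.

Lemma jap_pow_le k (s r : R) : s <= r -> jap k `^ s <= jap k `^ r :> R.
Proof. by move=> sr; apply: ler_powR => //; exact: jap_ge1. Qed.

Lemma jap_pow_nat k n : jap k `^ n%:R = jap k ^+ n :> R.
Proof. by rewrite powR_mulrn // sqrtr_ge0. Qed.

(** Compared with [sum_qn], once for each sign, plus the term k = 0. *)
Lemma sum_jap_inv (l : seq int) : uniq l -> \sum_(k <- l) (1 + `|k%:~R| ^+ 2)^-1 <= 5 :> R.
Proof.
move=> ul; pose N := (\max_(k <- l) `|k|)%N.
have lN : {subset l <= zseg N}.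
  by move=> k kl; rewrite mem_zseg; exact: leq_bigmax_seq.
have F0 k : 0 <= (1 + `|k%:~R| ^+ 2)^-1 :> R by rewrite invr_ge0 addr_ge0 ?sqr_ge0.
apply: le_trans (_ : \sum_(k <- zseg N) (1 + `|k%:~R| ^+ 2)^-1 <= _).
  have -> : \sum_(k <- l) (1 + `|k%:~R| ^+ 2)^-1 =
      \sum_(k <- zseg N | k \in l) (1 + `|k%:~R| ^+ 2)^-1 :> R.
    rewrite -[RHS]big_filter; apply: perm_big; apply: uniq_perm => //.
      by rewrite filter_uniq // uniq_zseg.
    by move=> k; rewrite mem_filter andb_idr // => /lN.
  by rewrite big_mkcond; apply: ler_sum => k _; case: ifP.
rewrite sum_zseg normr0 expr0n addr0 invr1.
have := sum_qn (R := R) N.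
suff : \sum_(i < N) ((1 + `|i.+1%:~R| ^+ 2)^-1 + (1 + `|(- i.+1%:Z)%:~R| ^+ 2)^-1) <=
   \sum_(i < N) 2 * qn i :> R by rewrite -mulr_sumr; lra.
apply: ler_sum => i _; rewrite mulrNz normrN /qn.
have h : (1 + `|i.+1%:~R| ^+ 2)^-1 <= (i.+1%:R ^+ 2)^-1 :> R.
  rewrite lef_pV2 ?posrE ?exprn_gt0 // ?ltr_pwDl ?sqr_ge0 //.
  by rewrite -[i.+1%:~R]/(i.+1%:R) normr_nat lerDr.
by rewrite mulr_natl mulr2n lerD.
Qed.

(** The arithmetic-geometric inequality, in place of Cauchy-Schwarz, compares an l^1 sum
    with an l^2 sum: v must be dominated by the weight of the norm up to a square-summable
    factor. *)
Lemma Gnorm_nle d s f (v : int -> R) (c G : R) : 0 < G -> (forall k, 0 <= v k) -> 0 <= c ->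
  (forall k, v k ^+ 2 * (1 + `|k%:~R| ^+ 2) <= c * jap k `^ (2 * s)) ->
  (Gnorm d s f <= G%:E)%E ->
  nle (fun k => v k * expR (2 * pi * d * `|k%:~R|)) (fourier f) ((1 + 5 * c) / 2 * G).
Proof.
move=> G0 v0 c0 vc /(Gnorm_leP _ _ _ (ltW G0)) h l ul.
have pt k : v k * expR (2 * pi * d * `|k%:~R|) * cmod (fourier f k) <=
   2^-1 * (Gterm d s f k / G) + 2^-1 * (c * G) * (1 + `|k%:~R| ^+ 2)^-1.
  set E := expR _; set z := cmod _; set J := jap k `^ (2 * s) in vc *.
  have z0 : 0 <= z := cmod_ge0 _.
  have n1 : 0 < 1 + `|k%:~R| ^+ 2 :> R by rewrite ltr_pwDl ?sqr_ge0.
  have J0 : 0 < J by rewrite powR_gt0 // (lt_le_trans _ (jap_ge1 k)).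
  have -> : Gterm d s f k = J * (E * z) ^+ 2.
    rewrite /Gterm -/J -/z exprMn -/E [E ^+ 2]expr2 /E -expRD -mulrA; congr (_ * (expR _ * _)).
    ring.
  rewrite -mulrA; move: (E * z) (vc k); rewrite -/J => y; move: (v0 k) n1.
  move: (v k) (1 + _) => w n w0 n1 hw.
  have key : 0 <= J * y ^+ 2 / G + c * G / n - 2 * (w * y).
    have -> : J * y ^+ 2 / G + c * G / n - 2 * (w * y) =
      (J * y - w * G) ^+ 2 / (J * G) + G / (J * n) * (c * J - w ^+ 2 * n).
      by field; rewrite !gt_eqF.
    apply: addr_ge0; first by rewrite divr_ge0 ?sqr_ge0 // ltW // mulr_gt0.
    by rewrite mulr_ge0 ?subr_ge0 // divr_ge0 ?ltW // mulr_gt0.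
  lra.
apply: le_trans (ler_sum _ (fun k _ => pt k)) _.
rewrite big_split /= -!mulr_sumr -mulr_suml.
have h1 : 2^-1 * ((\sum_(i <- l) Gterm d s f i) / G) <= 2^-1 * G.
  by rewrite ler_wpM2l // ler_pdivrMr // -expr2; exact: h.
have h2 : 2^-1 * (c * G) * (\sum_(i <- l) (1 + `|i%:~R| ^+ 2)^-1) <= 2^-1 * (c * G) * 5.
  by rewrite ler_wpM2l ?sum_jap_inv // mulr_ge0 // mulr_ge0 // ltW.
by apply: le_trans (lerD h1 h2) _; rewrite le_eqVlt; apply/orP; left; apply/eqP; field.
Qed.

Lemma Gnorm_W1 d s f (G : R) : 0 < G -> 2 <= s -> periodic1 f -> ccontinuous f ->
  (Gnorm d s f <= G%:E)%E -> W 1 d f (11 * G).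
Proof.
move=> G0 s2 pf cf h; split => //.
have := @Gnorm_nle d s f (fun k => (1 + `|k%:~R|) ^+ 1) 4 G G0.
(* The constant (1 + 5 * 4) / 2 = 21 / 2 is rounded up to 11. *)
have -> : (1 + 5 * 4) / 2 * G = 21 / 2 * G by field.
move=> H; apply: nle_mono (H _ _ _ h) => //.
  by lra.
move=> k; rewrite expr1; apply: le_trans (_ : 4 * jap k `^ (4%:R) <= _); last first.
  by rewrite ler_wpM2l // jap_pow_le //; lra.
rewrite jap_pow_nat -[4%N]/((2 * 2)%N) exprM jap_sq [(1 + `|k%:~R| ^+ 2) ^+ 2]expr2.
rewrite [leRHS]mulrA ler_wpM2r ?addr_ge0 ?sqr_ge0 //.
have := sqr_ge0 (`|k%:~R| - 1 : R); have := sqr_ge0 (`|k%:~R| + 1 : R); rewrite !expr2; lra.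
Qed.

Lemma Gspace_W1 d s f : 2 <= s -> ccontinuous f -> Gspace d s f -> exists B, W 1 d f B.
Proof.
move=> s2 cf [[pf _ _ _] Gf].
have := Gnorm_ge0 d s f; case E : (Gnorm d s f) Gf => [r| |] // _; rewrite lee_fin => r0.
exists (11 * (r + 1)); apply: (Gnorm_W1 (s := s)) => //; first by lra.
by rewrite E lee_fin; lra.
Qed.

Lemma W_cL2 p d f B : W p d f B -> cL2 f.
Proof.
move=> [pf [fr fi] _]; split => //;
  [exact: measurable_realfun.continuous_measurable_fun..|].
have -> : (fun x => (cmod (f x) ^+ 2)%:E) = EFin \o (fun x => Re (f x) ^+ 2 + Im (f x) ^+ 2).
  by apply/funext => x; rewrite cmod_sqr.
apply: cont_integrable01 => x; apply: cvgD; rewrite expr2; apply: cvgM;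
  by [exact: fr|exact: fi].
Qed.

(** A power of 1 + |k| is below an exponential of any positive rate, by 1 + y <= e^y. *)
Lemma jap_exp_bounded s (ep : R) : 0 < ep -> exists2 C : R, 0 <= C &
  forall k, jap k `^ (2 * s) <= C ^+ 2 * expR (2 * ep * `|k%:~R|).
Proof.
move=> ep0; pose m := (Num.truncn (2 * s)).+1.
have sm : 2 * s <= m%:R by rewrite ltW // truncnS_gt.
have m0 : 0 < m%:R :> R by rewrite ltr0n.
pose K := 1 + m%:R / (2 * ep).
have K0 : 0 <= K by rewrite addr_ge0 // divr_ge0 // mulr_ge0 // ltW.
exists (Num.sqrt (K ^+ m)); first exact: sqrtr_ge0.
move=> k; rewrite sqr_sqrtr ?exprn_ge0 //.
apply: le_trans (jap_pow_le k sm) _; rewrite jap_pow_nat.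
set n : R := `|k%:~R|; have n0 : 0 <= n by exact: normr_ge0.
have -> : expR (2 * ep * n) = expR (2 * ep / m%:R * n) ^+ m.
  rewrite -expRM_natl; congr expR; field; by rewrite gt_eqF.
rewrite -exprMn lerXn2r ?nnegrE ?sqrtr_ge0 ?mulr_ge0 ?expR_ge0 //.
apply: le_trans (jap_le k) _; rewrite -/n.
apply: le_trans (ler_wpM2l K0 (expR_ge1Dx _)).
have -> : K * (1 + 2 * ep / m%:R * n) = 1 + n + (m%:R / (2 * ep) + 2 * ep / m%:R * n).
  by rewrite /K; field; rewrite !gt_eqF.
have e2 : 0 <= 2 * ep by rewrite mulr_ge0 // ltW.
rewrite lerDl; apply: addr_ge0; first exact: divr_ge0.
by apply: mulr_ge0 => //; exact: divr_ge0.
Qed.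

Lemma sum_sq_le (l : seq int) (F : int -> R) : (forall k, 0 <= F k) ->
  \sum_(k <- l) F k ^+ 2 <= (\sum_(k <- l) F k) ^+ 2.
Proof.
move=> F0; elim: l => [|k l IH]; first by rewrite !big_nil expr0n.
rewrite !big_cons; set S := \sum_(j <- l) F j in IH *.
have S0 : 0 <= S by apply: sumr_ge0.
have := mulr_ge0 (F0 k) S0; move: IH; rewrite !expr2; lra.
Qed.

(** The width e - d absorbs the Sobolev weight whatever s is, and an l^2 sum is at most the
    l^1 sum. *)
Lemma W_Gnorm d e s : d < e -> exists2 C : R, 0 <= C & forall p f B, W p e f B ->
  (Gnorm d s f <= (C * B)%:E)%E.
Proof.
move=> de; have ep0 : 0 < 2 * pi * (e - d) by rewrite mulr_gt0 ?subr_gt0 // mulr_gt0 // pi_gt0.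
have [C C0 hC] := jap_exp_bounded s ep0.
exists C => // p f B Wf; have B0 := W_ge0 Wf.
apply/Gnorm_leP; first exact: mulr_ge0.
move=> l ul; have W0 : W 0 e f B by apply: W_mono Wf.
case: W0 => _ _ /(_ l ul) h.
pose F k := wt 0 e k * cmod (fourier f k).
have F0 k : 0 <= F k by rewrite mulr_ge0 ?wt_ge0 ?cmod_ge0.
apply: le_trans (_ : C ^+ 2 * (\sum_(k <- l) F k) ^+ 2 <= _); last first.
  rewrite exprMn ler_wpM2l ?sqr_ge0 // lerXn2r ?nnegrE // sumr_ge0 //.
apply: le_trans (ler_wpM2l (sqr_ge0 C) (sum_sq_le l F0)).
rewrite mulr_sumr; apply: ler_sum => k _.
rewrite /Gterm /F [in leRHS]exprMn [leRHS]mulrA ler_wpM2r ?sqr_ge0 //.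
apply: le_trans (ler_wpM2r (expR_ge0 _) (hC k)) _.
rewrite -[leLHS]mulrA ler_wpM2l ?sqr_ge0 // /wt expr0 mul1r [leRHS]expr2 -!expRD.
by rewrite ler_expR le_eqVlt; apply/orP; left; apply/eqP; ring.
Qed.

Lemma W_Gspace p d e s f B : d < e -> W p e f B -> Gspace d s f.
Proof.
move=> de Wf; split; first exact: W_cL2 Wf.
have [C C0 h] := W_Gnorm s de.
by apply: le_lt_trans (h _ _ _ Wf) _; rewrite ltry.
Qed.

End GevreyNorms.

(** * Fourier coefficients of real-analytic functions *)

Section RealAnalytic.
Context {R : realType}.
Implicit Types (f g : R -> R) (a : nat -> R) (x y : R).
Local Notation leb := (@lebesgue_measure R).

Lemma series_geom_le (b : nat -> R) (A q : R) : 0 <= q -> q <= 2^-1 ->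
  (forall n, `|b n| <= A * q ^+ n) -> cvgn (series b) /\ `|limn (series b)| <= 2 * A.
Proof.
move=> q0 q1 hb.
have A0 : 0 <= A by have := hb 0%N; rewrite expr0 mulr1; apply: le_trans.
have bound N : \sum_(0 <= i < N) `|b i| <= 2 * A.
  rewrite big_mkord; apply: le_trans (_ : \sum_(i < N) A * q ^+ i <= _).
    by apply: ler_sum => i _.
  rewrite -mulr_sumr mulrC ler_wpM2r //.
  have := geom_sum_le 0 N q0 (_ : q < 1); rewrite expr0 mul1r => /(_ ltac:(lra)) /le_trans; apply.
  by rewrite -[leRHS]invrK lef_pV2 ?posrE ?invr_gt0 //; lra.
have cv : cvgn (series b).
  apply: normed_cvg; apply: nondecreasing_is_cvgn.
    apply/nondecreasing_seqP => n; rewrite /= /series /= big_nat_recr //=.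
    by rewrite lerDl.
  by exists (2 * A) => _ [n _ <-]; exact: bound.
split=> //; rewrite ler_norml; apply/andP; split.
  apply: limr_ge => //; apply: nearW => n; rewrite lerNl; apply: le_trans (bound n).
  rewrite /series /=; apply: le_trans (ler_norm _) _; rewrite normrN; exact: ler_norm_sum.
apply: limr_le => //; apply: nearW => n; apply: le_trans (bound n).
by rewrite /series /=; apply: le_trans (ler_norm _) _; exact: ler_norm_sum.
Qed.

Lemma bin_le_expn n k : ('C(n, k) <= 2 ^ n)%N.
Proof.
elim: n k => [|n IH] [|k]; rewrite ?bin0 ?expn_gt0 //.
by rewrite binS expnS mul2n -addnn leq_add.
Qed.

Lemma iter_diffs a m n :
  iter m (@pseries_diffs R) a n = (n + m)`!%:R / n`!%:R * a (n + m)%N.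
Proof.
have f0 k : k`!%:R != 0 :> R by rewrite pnatr_eq0 -lt0n fact_gt0.
elim: m n => [|m IH] n; first by rewrite /= addn0 mulfV // mul1r.
rewrite iterS {1}/pseries_diffs IH addSnnS factS natrM.
have n0 : n.+1%:R != 0 :> R by rewrite pnatr_eq0.
move: (f0 n) n0; move: (n`!%:R : R) (n.+1%:R : R) (_`!%:R : R) (a _) => p q r z p0 q0.
by field; rewrite p0 q0.
Qed.

Lemma iter_diffs_le a (A K : R) m n : 0 <= K -> (forall n, `|a n| <= A * K ^+ n) ->
  `|iter m (@pseries_diffs R) a n| <= A * m`!%:R * (2 * K) ^+ m * (2 * K) ^+ n.
Proof.
move=> K0 ha; rewrite iter_diffs normrM ger0_norm ?divr_ge0 //.
have A0 : 0 <= A by have := ha 0%N; rewrite expr0 mulr1; apply: le_trans.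
have h : (n + m)`!%:R / n`!%:R <= m`!%:R * 2 ^+ (n + m) :> R.
  rewrite ler_pdivrMr ?ltr0n ?fact_gt0 // -natrX -!natrM ler_nat.
  rewrite -(bin_fact (leq_addl n m)) addnK.
  by rewrite [X in (_ <= X)%N]mulnAC [X in (_ <= X)%N]mulnC leq_mul // bin_le_expn.
apply: le_trans (ler_pM _ _ h (ha (n + m)%N)) _ => //.
rewrite !exprMn !exprD le_eqVlt; apply/orP; left; apply/eqP; ring.
Qed.

(** The coefficients of the m-th derivative of a power series are (n + m)! / n! a_(n + m),
    and (n + m)! / n! is at most m! 2 ^ (n + m); therefore one radius serves for all m. *)
Lemma analytic_local f x0 : real_analytic f -> exists r C L : R, [/\ 0 < r, 0 <= C, 0 <= L &
  forall m x, `|x - x0| < r -> derivable (derive1n m f) x 1 /\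
     `|derive1n m f x| <= C * m`!%:R * L ^+ m].
Proof.
move=> /(_ x0)[r r0 [a ha]].
have r2 : 0 < r / 2 by lra.
have cv : cvgn (series (fun n => a n * (r / 2) ^+ n)).
  have := ha (x0 + r / 2); have -> : x0 + r / 2 - x0 = r / 2 by ring.
  by rewrite gtr0_norm // => /(_ ltac:(lra)); apply: cvgP.
have [A hA] : exists A, forall n, `|a n * (r / 2) ^+ n| <= A.
  have [A [_ hA]] := cvg_series_bounded cv; exists (A + 1) => n.
  by apply: hA; rewrite ?ltrDl.
pose K := (r / 2)^-1; have K0 : 0 < K by rewrite invr_gt0.
have aK n : `|a n| <= A * K ^+ n.
  have := hA n; rewrite normrM (ger0_norm (_ : 0 <= (r / 2) ^+ n)); last by rewrite exprn_ge0 // ltW.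
  by rewrite -ler_pdivlMr ?exprn_gt0 // -exprVn.
pose rho := (4 * K)^-1; have rho0 : 0 < rho by rewrite invr_gt0 mulr_gt0.
have rhor : rho < r.
  rewrite /rho /K invfM invrK; lra.
have Kr : 2 * K * rho = 2^-1 by rewrite /rho; field; rewrite gt_eqF.
have A0 : 0 <= A by apply: le_trans (hA 0%N).
pose b m := iter m (@pseries_diffs R) a.
have bb m n y : `|y| <= rho ->
    `|b m n * y ^+ n| <= A * m`!%:R * (2 * K) ^+ m * (2 * K * `|y|) ^+ n.
  move=> yr; rewrite normrM normrX [(2 * K * `|y|) ^+ n]exprMn [leRHS]mulrA ler_wpM2r ?exprn_ge0 //.
  exact: iter_diffs_le (ltW K0) aK.
have conv m y : `|y| <= rho -> cvgn (pseries (b m) y) /\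
    `|limn (pseries (b m) y)| <= 2 * (A * m`!%:R * (2 * K) ^+ m).
  move=> yr; apply: (@series_geom_le _ _ (2 * K * `|y|)).
  - by rewrite !mulr_ge0 // ltW.
  - by rewrite -Kr ler_wpM2l // mulr_ge0 // ltW.
  - by move=> n; exact: bb.
have dP m x : `|x - x0| < rho -> is_derive x 1 (fun z => limn (pseries (b m) (z - x0)))
    (limn (pseries (b m.+1) (x - x0))).
  move=> xr.
  have rr : `|rho| <= rho by rewrite ger0_norm // ltW.
  have d1 : is_derive (x - x0) 1 (fun y => limn (pseries (b m) y))
      (limn (pseries (b m.+1) (x - x0))).
    apply: (@pseries_snd_diffs _ _ rho); rewrite ?(ger0_norm (ltW rho0)) //.
    - by have [] := conv m rho rr.
    - by have [] := conv m.+1 rho rr.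
    - by have [] := conv m.+2 rho rr.
  have d2 : is_derive x 1 (fun z : R => z - x0) 1.
    by have := is_deriveB (is_derive_id x (1 : R)) (is_derive_cst x0 x 1); rewrite subr0.
  have := @is_derive1_comp _ (fun y => limn (pseries (b m) y)) (fun z : R => z - x0) x _ _ d1 d2.
  by rewrite mulr1.
have near_x x : `|x - x0| < rho -> \forall z \near x, `|z - x0| < rho.
  move=> xr; exists (rho - `|x - x0|); first by rewrite /= subr_gt0.
  move=> z /= xz; have -> : z - x0 = (z - x) + (x - x0) by ring.
  by apply: le_lt_trans (ler_normD _ _) _; rewrite -ltrBrDr distrC.
have fE m : forall x, `|x - x0| < rho -> derive1n m f x = limn (pseries (b m) (x - x0)).
  elim: m => [|m IH] x xr.
    rewrite derive1n0; have /(cvg_lim _) := ha x (lt_trans xr rhor).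
    by move=> h; rewrite -h.
  rewrite derive1nS derive1E.
  have -> : 'D_1 (derive1n m f) x = 'D_1 (fun z => limn (pseries (b m) (z - x0))) x.
    apply: near_eq_derive; near=> z; apply: IH; near: z; exact: near_x.
  by have := dP m x xr => h; rewrite derive_val.
have df m x : `|x - x0| < rho -> derivable (derive1n m f) x 1.
  move=> xr; have [h _] := dP m x xr; apply: near_eq_derivable h.
  by near=> z; rewrite fE //; near: z; exact: near_x.
exists rho, (2 * A), (2 * K); split; [exact: rho0|by rewrite mulr_ge0|by rewrite mulr_ge0 // ltW|].
move=> m x xr; split; first exact: df.
rewrite fE //; have [_] := conv m (x - x0) (ltW xr).
by rewrite !mulrA.
Unshelve. all: by end_near.
Qed.

Lemma analytic_derivable f m x : real_analytic f -> derivable (derive1n m f) x 1.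
Proof.
move=> /(analytic_local x)[r [C [L [r0 _ _ /(_ m x)]]]].
by rewrite subrr normr0 => /(_ r0)[].
Qed.

Lemma analytic_cont f m : real_analytic f -> continuous (derive1n m f).
Proof.
move=> af x; apply/differentiable_continuous/derivable1_diffP.
exact: analytic_derivable.
Qed.

(** Compactness of a period makes the local bounds uniform. *)
Lemma analytic_bound f : real_analytic f -> exists2 M : R, 0 < M &
  forall m x, 0 <= x <= 1 -> `|derive1n m f x| <= M * m`!%:R * M ^+ m.
Proof.
move=> af; have cK := @segment_compact R 0 1; move/compact_near_coveringP : cK => cK.
have loc x : `[0, 1]%classic x -> \forall x' \near x & M \near +oo,
    forall m, `|derive1n m f x'| <= M * m`!%:R * M ^+ m.
  move=> _; have [r [C [L [r0 C0 L0 h]]]] := analytic_local x af.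
  exists (ball x r, [set M | Num.max C L <= M]).
    split; first exact: nbhsx_ballx.
    by exists (Num.max C L); split; [exact: num_real|move=> M /ltW].
  move=> [x' M] [/= xx]; rewrite ge_max => /andP[CM LM] m.
  have [_] := h m x' ltac:(by move: xx; rewrite /ball /= distrC).
  move=> /le_trans; apply; rewrite ler_pM ?mulr_ge0 ?exprn_ge0 //.
    by rewrite ler_wpM2r.
  by rewrite lerXn2r // nnegrE // (le_trans L0).
have [M [_ hM]] := cK _ _ _ _ loc.
exists (`|M| + 1); first by rewrite ltr_wpDl.
move=> m x x01; apply: (hM (`|M| + 1)) => //.
by apply: le_lt_trans (ler_norm M) _; rewrite ltrDl.
Qed.

Lemma derive1n_periodic f m : periodic1 f -> periodic1 (derive1n m f).
Proof.
move=> pf; elim: m => [|m IH] //; rewrite derive1nS => x.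
set F := derive1n m f in IH *; rewrite !derive1E /derive.
have -> // : (fun h : R => h^-1 *: ((F \o shift (x + 1)) (h *: 1) - F (x + 1))) =
  (fun h : R => h^-1 *: ((F \o shift x) (h *: 1) - F x)).
by apply/funext => h /=; rewrite addrA !IH.
Qed.

(** Integration by parts, with boundary terms cancelling by periodicity. *)
Lemma fourier_derive1 f k : periodic1 f -> (forall x, derivable f x 1) ->
  continuous f -> continuous (derive1 f) ->
  fourier (toC (derive1 f)) k = freq k * fourier (toC f) k.
Proof.
move=> pf df cf cdf; set a : R := 2 * (- k)%:~R * pi.
have p1 : f 1 = f 0 by have := pf 0; rewrite add0r.
have ec : cos (a * 1) = cos (a * 0) :> R.
  by have := congr1 (@complex.Re R) (@expi_periodic R (- k) 0); rewrite add0r.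
have es : sin (a * 1) = sin (a * 0) :> R.
  by have := congr1 (@complex.Im R) (@expi_periodic R (- k) 0); rewrite add0r.
have dfx x : is_derive x 1 f (derive1 f x) by rewrite derive1E; exact: derivableP.
have ca := @continuous_cosZ R a; have sa := @continuous_sinZ R a.
have cM (u v : R -> R) : continuous u -> continuous v -> continuous (fun x => u x * v x).
  by move=> cu cv x; apply: cvgM; [exact: cu|exact: cv].
have byparts (u v : R -> R) : continuous v -> (forall x, is_derive x 1 u (v x)) -> continuous u ->
   u 1 = u 0 -> \int[leb]_(x in `[0, 1]) (derive1 f x * u x) =
   - \int[leb]_(x in `[0, 1]) (f x * v x).
  move=> cv du cu u10.
  have : \int[leb]_(x in `[0, 1]) (derive1 f x * u x + f x * v x) = 0.
    have cF : continuous (fun x => derive1 f x * u x + f x * v x).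
      by move=> x; apply: cvgD; apply: cM.
    have dF (x : R) : is_derive x 1 (fun x => f x * u x) (derive1 f x * u x + f x * v x).
      have := is_deriveM (dfx x) (du x).
      by rewrite /GRing.scale /= [u x * _]mulrC addrC.
    by rewrite (FTC01 cF dF) p1 u10 subrr.
  rewrite Rint01D; [|exact: cM|exact: cM].
  by move/eqP; rewrite addr_eq0 => /eqP.
have fE g : fourier (toC g) k = (\int[leb]_(x in `[0, 1]) (g x * cos (a * x))) +i*
    (\int[leb]_(x in `[0, 1]) (g x * sin (a * x))).
  apply: complexP; apply: eq_Rintegral => x _; rewrite ?cReM ?cImM /expi2pi /=.
    by rewrite mul0r subr0.
  by rewrite mul0r addr0.
have bc := byparts _ _ (continuousZ (r := - a) sa) (is_derive_cosZ a) ca ec.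
have bs := byparts _ _ (continuousZ (r := a) ca) (is_derive_sinZ a) sa es.
rewrite !fE bc bs.
have -> : \int[leb]_(x in `[0, 1]) (f x * (- a * sin (a * x))) =
    - a * \int[leb]_(x in `[0, 1]) (f x * sin (a * x)).
  by rewrite -Rint01Z; [apply: eq_Rintegral => x _; rewrite mulrCA|exact: cM].
have -> : \int[leb]_(x in `[0, 1]) (f x * (a * cos (a * x))) =
    a * \int[leb]_(x in `[0, 1]) (f x * cos (a * x)).
  by rewrite -Rint01Z; [apply: eq_Rintegral => x _; rewrite mulrCA|exact: cM].
have aE : 2 * pi * k%:~R = - a :> R by rewrite /a mulrNz; ring.
rewrite /freq aE; apply: complexP; rewrite /=.
  by rewrite mul0r sub0r; ring.
by rewrite mul0r add0r; ring.
Qed.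

Lemma fourier_derive1n f m k : periodic1 f -> real_analytic f ->
  fourier (toC (derive1n m f)) k = freq k ^+ m * fourier (toC f) k.
Proof.
move=> pf af; elim: m => [|m IH]; first by rewrite derive1n0 expr0 mul1r.
rewrite derive1nS fourier_derive1 ?IH ?exprS ?mulrA //.
- exact: derive1n_periodic.
- by move=> x; exact: analytic_derivable.
- exact: analytic_cont.
- by rewrite -derive1nS; exact: analytic_cont.
Qed.

Lemma toC_cont f : continuous f -> ccontinuous (toC f).
Proof. by move=> cf; split => //= x; exact: cvg_cst. Qed.

(** Summing the bounds on the m-th derivatives against d ^ m / m! bounds the exponential
    weight without choosing m in terms of k. *)
Lemma analytic_fourier_decay f : periodic1 f -> real_analytic f ->
  exists d C : R, [/\ 0 < d, 0 <= C &
    forall k, expR (2 * pi * d * `|k%:~R|) * cmod (fourier (toC f) k) <= C].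
Proof.
move=> pf af; have [M M0 hM] := analytic_bound af.
pose d := (2 * M)^-1; have d0 : 0 < d by rewrite invr_gt0 mulr_gt0.
exists d, (2 * M); split => //; first by rewrite mulr_ge0 // ltW.
move=> k; set z := cmod _; have z0 : 0 <= z := cmod_ge0 _.
set y : R := 2 * pi * `|k%:~R|; have y0 : 0 <= y by rewrite mulr_ge0 ?pi2_ge0.
have hz m : y ^+ m * z <= M * m`!%:R * M ^+ m.
  have -> : y ^+ m * z = cmod (fourier (toC (derive1n m f)) k).
    by rewrite fourier_derive1n // cmodM cmodX cmod_freq.
  have cm : ccontinuous (toC (derive1n m f)) by apply: toC_cont; exact: analytic_cont.
  apply: fourier_le => // x; rewrite cmod_real.
  rewrite -(periodic_int (derive1n_periodic m pf) (- Num.floor x)).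
  apply: hM; rewrite mulrNz subr_ge0 floor_le lerBlDr addrC.
  by rewrite ltW // -[1]/(1%:~R) -intrD floorD1_gt.
have -> : 2 * pi * d * `|k%:~R| = y * d by rewrite /y; ring.
have [zp|] := ltP 0 z; last first.
  by move=> zn; have -> : z = 0 by [apply/eqP; rewrite eq_le zn z0]; rewrite mulr0 mulr_ge0 // ltW.
rewrite -ler_pdivlMr //; apply: (limr_le (@is_cvg_series_exp_coeff _ (y * d))).
apply: nearW => N; rewrite ler_pdivlMr // /series /= big_mkord mulr_suml.
apply: le_trans (_ : \sum_(i < N) M * 2^-1 ^+ i <= _).
  apply: ler_sum => i _; rewrite /exp_coeff /=.
  have -> : (y * d) ^+ i / i`!%:R * z = (y ^+ i * z) * (d ^+ i / i`!%:R) by rewrite exprMn; ring.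
  have di : 0 <= d ^+ i / i`!%:R by rewrite divr_ge0 // exprn_ge0 // ltW.
  apply: le_trans (ler_wpM2r di (hz i)) _.
  have f0 : i`!%:R != 0 :> R by rewrite pnatr_eq0 -lt0n fact_gt0.
  have -> : M * i`!%:R * M ^+ i * (d ^+ i / i`!%:R) = M * (M * d) ^+ i.
    by rewrite exprMn; field.
  by rewrite /d invfM mulrCA mulfV ?gt_eqF // mulr1.
have h12 : 2^-1 < 1 :> R by lra.
rewrite -mulr_sumr mulrC ler_wpM2r ?(ltW M0) //.
have h02 : 0 <= 2^-1 :> R by lra.
have := geom_sum_le 0 N h02 h12; rewrite expr0 mul1r => /le_trans; apply.
by rewrite -[leRHS]invrK lef_pV2 ?posrE ?invr_gt0 //; lra.
Qed.

(** Half of the exponential decay is spent on making the coefficients summable. *)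
Lemma analytic_W f : periodic1 f -> real_analytic f ->
  exists d B : R, 0 < d /\ W 0 d (toC f) B.
Proof.
move=> pf af; have [d [C [d0 C0 hC]]] := analytic_fourier_decay pf af.
have d2 : 0 < d / 2 by lra.
exists (d / 2), (C * (1 + (pi * (d / 2)) ^- 2) * 5); split => //.
split; first by move=> x; rewrite /toC pf.
  by apply: toC_cont; exact: (@analytic_cont f 0%N af).
set K := 1 + _; have K0 : 0 <= K.
  by rewrite /K addr_ge0 // invr_ge0 exprn_ge0 // mulr_ge0 ?pi_ge0 // ltW.
move=> l ul; apply: le_trans (ler_wpM2l (mulr_ge0 C0 K0) (sum_jap_inv ul)).
rewrite mulr_sumr; apply: ler_sum => k _.
have n1 : 0 < 1 + `|k%:~R| ^+ 2 :> R by rewrite ltr_pwDl ?sqr_ge0.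
rewrite ler_pdivlMr //.
have w0 := wt_gt0 0 (d / 2) k; have z0 := cmod_ge0 (fourier (toC f) k).
apply: le_trans (ler_wpM2l (mulr_ge0 (ltW w0) z0) (sq_le_wt k d2)) _.
have e : wt 0 (d / 2) k * wt 0 (d / 2) k = expR (2 * pi * d * `|k%:~R|).
  by rewrite /wt !expr0 !mul1r -expRD; congr expR; field.
have := ler_wpM2l K0 (hC k); rewrite -e -/K => h.
by apply: le_trans (le_trans h _); rewrite le_eqVlt; apply/orP; left; apply/eqP; ring.
Qed.

End RealAnalytic.

(** * The Cauchy problem and its lifespan *)

Section CauchyProblem.
Context {R : realType}.
Implicit Types (u v : R[i] -> R -> R[i]) (gamma D s d rho : R).

(** Passes from the Gevrey class to the larger Wiener class, in which the equation reads u_t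
    = F u and uniqueness is proved. *)
Lemma is_solution_wholo gamma (u0 : R -> R) d s rho u : 0 < d -> 0 <= s ->
  is_solution gamma u0 d s rho u -> exists ut, [/\ wholo d rho u ut,
    forall t, cmod t < rho -> ut t = field_of gamma (u t) & u 0 = toC u0].
Proof.
move=> d0 s0 [ut [hol cu eq u00]]; exists ut.
have s2 : 2 <= s + 2 by lra.
have Wu t : cmod t < rho -> exists B, W 1 d (u t) B.
  move=> tr; have [Gu _ _] := hol t tr; exact: Gspace_W1 s2 (cu t tr) Gu.
have utE t : cmod t < rho -> ut t = field_of gamma (u t).
  move=> tr; have [B WB] := Wu t tr; apply/funext => x; apply/eqP.
  by rewrite -subr_eq0 -(lhsE gamma (ut t) x (W_An d0 WB)) eq.
split => // t tr; have [Gu Gut hq] := hol t tr.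
have [B WB] := Wu t tr; split; first by exists B.
have cut : ccontinuous (ut t).
  by rewrite utE //; apply/An_cont/An_field_of; exact: W_An d0 WB.
split; first exact: Gspace_W1 s2 cut Gut.
move=> e e0; have e11 : 0 < e / 11 by rewrite divr_gt0.
have [eta eta0 he] := hq (e / 11) e11.
(* The increment is cut down so that t + h stays in the disk, where u is continuous. *)
exists (Num.min eta (rho - cmod t)); first by rewrite lt_min eta0 subr_gt0.
move=> h h0; rewrite lt_min => /andP[h1 h2].
have thr : cmod (t + h) < rho.
  by apply: le_lt_trans (cmodD _ _) _; rewrite -ltrBrDl.
have [B' WB'] := Wu (t + h) thr.
have -> : e = 11 * (e / 11) by field.
apply: (Gnorm_W1 e11 s2).
- by move=> x; rewrite /quotient (W_per WB') (W_per WB); case: Gut => -[-> _ _ _] _.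
- apply: ccontB => //; apply: ccontZ; apply: ccontB; [exact: W_cont WB'|exact: W_cont WB].
- exact: he.
Qed.

(** The radius D / B (1 - d) is where |t| B < D - D d, the condition under which the Taylor
    series solves the equation in a strip strictly wider than D d. *)
Lemma unique_solution_exists gamma D (A B : R) (u0 : R -> R) s d : 0 < D -> 0 <= s -> W 1 D (toC u0) A ->
  0 < B -> kappa D * (A ^+ 2 + `|gamma|) <= B -> 0 < d -> d < 1 ->
  unique_solution gamma u0 (D * d) s (D / B * (1 - d)).
Proof.
move=> D0 s0 Wu0 B0 KB d0 d1; set rho := D / B * (1 - d).
have [a [a0 aS]] := taylor_exists gamma (toC u0).
have Dd0 : 0 < D * d by rewrite mulr_gt0.
have DdD : D * d < D by rewrite gtr_pMr.
have in_disk t : cmod t < rho -> cmod t * B < D - D * d.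
  by rewrite -ltr_pdivlMr // => /lt_le_trans; apply; rewrite /rho mulrBr mulr1 mulrBl mulrAC.
have hsol t := fun tr => taylor_solution D0 Wu0 a0 aS B0 KB Dd0 DdD (in_disk t tr).
have solP : is_solution gamma u0 (D * d) s rho (sol a).
  exists (sol_t a); split.
  - move=> t /hsol[e [M [h0 [[de h00 Wu Wut] [hq _]]]]]; split; [exact: W_Gspace Wu|exact: W_Gspace Wut|].
    move=> eps eps0; have [C C0 hC] := W_Gnorm (s + 2) de.
    have M0 := W_ge0 Wu.
    have CM : 0 < C * M + 1 by rewrite ltr_wpDl // mulr_ge0.
    exists (Num.min h0 (eps / (C * M + 1))); first by rewrite lt_min h00 divr_gt0.
    move=> h hn0; rewrite lt_min => /andP[hh he].
    apply: le_trans (hC _ _ _ (hq h hn0 (ltW hh))) _; rewrite lee_fin mulrCA.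
    apply: le_trans (_ : cmod h * (C * M + 1) <= _).
      by rewrite ler_wpM2l ?cmod_ge0 // lerDl.
    by rewrite -ler_pdivlMr // ltW.
  - by move=> t /hsol[e [M [h0 [[_ _ Wu _] _]]]]; exact: W_cont Wu.
  - move=> t /hsol[e [M [h0 [[de _ Wu _] [_ eq]]]]] x.
    have e0 : 0 < e by apply: lt_trans de.
    by rewrite (lhsE gamma _ x (W_An e0 Wu)) eq subrr.
  - apply/funext => x; apply: csum_eq => e e0; exists 1%N => -[//|n] _.
    rewrite big_ord_recl expr0 mul1r a0 big1 ?addr0 ?subrr ?cmod0 ?(ltW e0) // => i _.
    by rewrite /= exprS !mul0r.
exists (sol a) => // v vP t tr.
have [ut [hu eu u00]] := is_solution_wholo Dd0 s0 solP.
have [vt [hv ev v00]] := is_solution_wholo Dd0 s0 vP.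
apply: (unique_in_disk Dd0 hv hu ev eu) tr.
by rewrite u00 v00.
Qed.

(** The derivative of the datum supplies the factor |k| of the weight of [W 1 D]; 3 =
    (1+5)/2 is the constant of [Gnorm_nle] for a weight of order 0. *)
Lemma datum_pair_norm D s (u0 : R -> R) : 0 < D -> 0 <= s -> datum D u0 ->
  let N := pair_norm D (s + 1) u0 in
  [/\ 0 <= N, W 1 D (toC u0) (3 * N) & N = 0 -> u0 = fun=> 0].
Proof.
move=> D0 s0 [pu au /(_ s s0)[_ Gu]] N.
have cu := @analytic_cont _ u0 0%N au.
have ccu := toC_cont cu.
have fd k : fourier (toC (derive1 u0)) k = freq k * fourier (toC u0) k.
  by have := @fourier_derive1n _ u0 1%N k pu au; rewrite expr1 derive1n1.
have [r r0 Gr] : exists2 r : R, 0 <= r & Gnorm D (s + 2) (toC u0) = r%:E.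
  have := Gnorm_ge0 D (s + 2) (toC u0); case: (Gnorm _ _ _) Gu => [r| |] // _.
  by rewrite lee_fin => r0; exists r.
have hr : forall l : seq int, uniq l -> \sum_(k <- l) Gterm D (s + 2) (toC u0) k <= r ^+ 2.
  by apply/Gnorm_leP => //; rewrite Gr.
have J2 k : jap k `^ (2 * (s + 2)) = jap k `^ (2 * (s + 1)) * (1 + `|k%:~R| ^+ 2) :> R.
  have -> : 2 * (s + 2) = 2 * (s + 1) + 2 by ring.
  rewrite powRD; last by apply/implyP => _; rewrite gt_eqF // (lt_le_trans _ (jap_ge1 k)).
  by rewrite jap_pow_nat jap_sq.
have p0 := @pi2_ge0 R.
have G1 : (Gnorm D (s + 1) (toC u0) <= r%:E)%E.
  apply/Gnorm_leP => // l ul; apply: le_trans (hr l ul); apply: ler_sum => k _.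
  rewrite /Gterm ler_wpM2r ?sqr_ge0 // ler_wpM2r ?expR_ge0 //.
  by apply: jap_pow_le; lra.
have G2 : (Gnorm D (s + 1) (toC (derive1 u0)) <= (2 * pi * r)%:E)%E.
  apply/Gnorm_leP; first exact: mulr_ge0.
  move=> l ul; rewrite exprMn; apply: le_trans (ler_wpM2l (sqr_ge0 _) (hr l ul)).
  rewrite mulr_sumr; apply: ler_sum => k _.
  rewrite /Gterm J2 fd cmodM cmod_freq.
  have Q0 : 0 <= jap k `^ (2 * (s + 1)) * expR (4 * pi * D * `|k%:~R|) * cmod (fourier (toC u0) k) ^+ 2.
    by rewrite mulr_ge0 ?sqr_ge0 // mulr_ge0 ?powR_ge0 ?expR_ge0.
  move: Q0; move: (jap k `^ _) (expR _) (cmod _) => J E z Q0.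
  have := mulr_ge0 (sqr_ge0 (2 * pi)) Q0; set n := `|k%:~R|.
  have -> : (2 * pi) ^+ 2 * (J * (1 + n ^+ 2) * E * z ^+ 2) =
    J * E * (2 * pi * n * z) ^+ 2 + (2 * pi) ^+ 2 * (J * E * z ^+ 2) by ring.
  by rewrite lerDl.
have fin g (b : R) : (Gnorm D (s + 1) g <= b%:E)%E ->
    exists2 q : R, 0 <= q & Gnorm D (s + 1) g = q%:E.
  have := Gnorm_ge0 D (s + 1) g; case: (Gnorm _ _ _) => [q| |] //.
  by rewrite lee_fin => q0 _; exists q.
have [r1 r10 E1] := fin _ _ G1; have [r2 r20 E2] := fin _ _ G2.
have NE : N = r1 + r2 by rewrite /N /pair_norm E1 E2.
have WN : W 1 D (toC u0) (3 * N).
  split => //; first by move=> x; rewrite /toC pu.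
  move=> l ul; apply/ler_addgt0Pr => e e0.
  have e6 : 0 < e / 6 by lra.
  (* The norms are enlarged by e / 6 because Gnorm_nle divides by its bound, and
     3(e/6+e/6)=e. *)
  have bnd g (q : R) : 0 <= q -> Gnorm D (s + 1) g = q%:E ->
      \sum_(k <- l) expR (2 * pi * D * `|k%:~R|) * cmod (fourier g k) <= 3 * (q + e / 6).
    move=> q0 E.
    have h0 : 0 < q + e / 6 by lra.
    have h1 : (Gnorm D (s + 1) g <= (q + e / 6)%:E)%E by rewrite E lee_fin; lra.
    have h2 k : 1 ^+ 2 * (1 + `|k%:~R| ^+ 2) <= 1 * jap k `^ (2 * (s + 1)) :> R.
      rewrite expr1n !mul1r -jap_sq -jap_pow_nat; apply: jap_pow_le; lra.
    have := @Gnorm_nle R D (s + 1) g (fun=> 1) 1 _ h0 (fun=> ler01) ler01 h2 h1 l ul.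
    have -> : (1 + 5 * 1) / 2 * (q + e / 6) = 3 * (q + e / 6) by field.
    by under eq_bigr do rewrite mul1r.
  have b1 := bnd _ _ r10 E1; have b2 := bnd _ _ r20 E2.
  apply: le_trans (_ : 3 * (r1 + e / 6) + 3 * (r2 + e / 6) <= _); last by rewrite NE; lra.
  apply: le_trans (lerD b1 b2); rewrite -big_split; apply: ler_sum => k _ /=.
  rewrite fd cmodM cmod_freq /wt expr1; set E := expR _; set z := cmod _; set n := `|k%:~R|.
  have n0 : 0 <= n by exact: normr_ge0.
  have Ez : 0 <= n * (E * z) by rewrite mulr_ge0 // mulr_ge0 ?expR_ge0 ?cmod_ge0.
  have p1 : 1 <= 2 * pi :> R by have := pi_ge2 R; lra.
  have := ler_wpM2r Ez p1.
  have -> : (1 + n) * E * z = E * z + 1 * (n * (E * z)) by ring.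
  have -> : E * (2 * pi * n * z) = 2 * pi * (n * (E * z)) by ring.
  by rewrite lerD2l.
split => //; first by rewrite NE addr_ge0.
move=> N0; apply/funext => x; apply/eqP.
have := W_sup x (ltW D0) WN; rewrite N0 mulr0 cmod_real normr_le0.
by [].
Qed.

Lemma kappa_gt0 D : 0 < D -> 0 < kappa D.
Proof.
move=> D0; have K0 : 0 < @cubic_cst R by apply: lt_le_trans cubic_cst_ge1.
rewrite /kappa; move: (@cubic_cst R) (expR 1) K0 (@expR_gt0 R 1) => y z y0 z0.
by rewrite !mulr_gt0 // addr_gt0.
Qed.

(** The squared norm of the datum and gamma enter through the growth rate B of the Taylor
    coefficients, with A = 3 N. When both vanish any positive B is admissible, and B = D
    gives 1. *)
Definition lifespan gamma D s (u0 : R -> R) : R :=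
  let N := pair_norm D (s + 1) u0 in
  if (N == 0) && (gamma == 0) then 1 else D / (kappa D * ((3 * N) ^+ 2 + `|gamma|)).

Lemma lifespanP gamma D s (u0 : R -> R) : 0 < D -> 0 <= s -> datum D u0 ->
  0 < lifespan gamma D s u0 /\ forall d, 0 < d -> d < 1 ->
    unique_solution gamma u0 (D * d) s (lifespan gamma D s u0 * (1 - d)).
Proof.
move=> D0 s0 du; have [N0 WN _] := datum_pair_norm D0 s0 du.
rewrite /lifespan; cbv zeta; set N := pair_norm _ _ _ in N0 WN *.
have k0 := kappa_gt0 D0.
case: ifP => [/andP[/eqP Nz /eqP gz]|ng].
  have small : kappa D * ((3 * N) ^+ 2 + `|gamma|) <= D.
    by rewrite Nz gz mulr0 expr0n normr0 addr0 mulr0 ltW.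
  split=> // d d0 d1; have := unique_solution_exists D0 s0 WN D0 small d0 d1.
  by rewrite mulfV ?lt0r_neq0.
have B0 : 0 < kappa D * ((3 * N) ^+ 2 + `|gamma|).
  rewrite mulr_gt0 // lt_def addr_ge0 ?sqr_ge0 // andbT.
  rewrite paddr_eq0 ?sqr_ge0 // normr_eq0 sqrf_eq0 mulf_eq0.
  by rewrite pnatr_eq0 /= ng.
split; first by rewrite divr_gt0.
by move=> d d0 d1; exact: (unique_solution_exists D0 s0 WN B0).
Qed.

End CauchyProblem.

Theorem theorem41 (R : realType) (gamma : R) :
  (forall u0 : R -> R, periodic1 u0 -> real_analytic u0 ->
     exists2 Delta : R, 0 < Delta &
       forall s : R, 0 <= s -> Gspace Delta (s + 2) (toC u0))
  /\
  (forall Delta s : R, 0 < Delta -> 2^-1 < s ->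
     exists T : (R -> R) -> R,
       [/\ forall u0 : R -> R, datum Delta u0 ->
             0 < T u0 /\
             forall d : R, 0 < d -> d < 1 ->
               unique_solution gamma u0 (Delta * d) s (T u0 * (1 - d)),
           gamma = 0 ->
             exists2 c : R, 0 < c &
               forall u0 : R -> R, datum Delta u0 -> u0 <> (fun=> 0) ->
                 T u0 = c / pair_norm Delta (s + 1) u0 ^+ 2 &
           gamma <> 0 ->
             (exists2 c : R, 0 < c &
                forall e : R, 0 < e -> exists M : R,
                  forall u0 : R -> R, datum Delta u0 ->
                    M <= pair_norm Delta (s + 1) u0 ->
                    `|T u0 * pair_norm Delta (s + 1) u0 ^+ 2 - c| < e)
             /\
             (exists2 c : R, 0 < c &
                forall e : R, 0 < e -> exists2 eta : R, 0 < eta &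
                  forall u0 : R -> R, datum Delta u0 ->
                    pair_norm Delta (s + 1) u0 < eta ->
                    `|T u0 - c| < e)]).
Proof.
split=> [u0 pu au|D s D0 s12].
  have [d [B [d0 Wu]]] := analytic_W pu au.
  exists (d / 2); first by rewrite divr_gt0.
  by move=> s _; apply: W_Gspace Wu; rewrite gtr_pMr // invf_lt1 // ltr1n.
have s0 : 0 <= s by apply: le_trans (ltW s12); rewrite invr_ge0.
have k0 := kappa_gt0 D0.
exists (lifespan gamma D s); split=> [u0 du|g0|/eqP g0].
- exact: lifespanP.
- exists (D / (9 * kappa D)); first by rewrite divr_gt0 // mulr_gt0.
  move=> u0 du u00; have [N0 _ Nz] := datum_pair_norm D0 s0 du.
  rewrite /lifespan; cbv zeta; set N := pair_norm _ _ _ in N0 Nz *.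
  have n0 : N != 0 by apply/eqP => /Nz.
  rewrite (negbTE n0) /= g0 normr0 addr0; clear -k0 n0.
  by move: (kappa D) k0 n0 => k k0 n0; field; rewrite n0 gt_eqF.
have gp : 0 < `|gamma| by rewrite normr_gt0.
have lE u0 : lifespan gamma D s u0 =
    D / (kappa D * ((3 * pair_norm D (s + 1) u0) ^+ 2 + `|gamma|)).
  by rewrite /lifespan (negbTE g0) andbF.
move: (kappa D) (`|gamma|) k0 gp lE => k g k0 gp lE.
split.
(* With N for the norm, the error is D g / (9 k (9 N^2 + g)), which is below e once N >= 1 +
   Dg/(ke). *)
- exists (D / (9 * k)); first by rewrite divr_gt0 // mulr_gt0.
  move=> e e0; pose P := D * g / (k * e).
  have P0 : 0 < P by rewrite !divr_gt0 ?mulr_gt0.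
  exists (1 + P) => u0 du; rewrite lE; move: (pair_norm _ _ _) => N NP.
  have N1 : 1 < N by apply: lt_le_trans NP; rewrite ltrDl.
  have Np : 0 < N by apply: lt_trans N1.
  have Q0 : 0 < (3 * N) ^+ 2 + g by rewrite addr_gt0 // exprn_gt0 // mulr_gt0.
  have -> : D / (k * ((3 * N) ^+ 2 + g)) * N ^+ 2 - D / (9 * k) =
     - (D * g / (9 * k * ((3 * N) ^+ 2 + g))).
    by field; rewrite !gt_eqF.
  rewrite normrN ger0_norm; last by rewrite divr_ge0 ?mulr_ge0 // ltW.
  rewrite ltr_pdivrMr; last by rewrite !mulr_gt0.
  have DP : D * g = P * k * e by rewrite /P; field; rewrite !gt_eqF.
  have PQ : P < 9 * ((3 * N) ^+ 2 + g).
    have : N * 1 < N * N by rewrite ltr_pM2l.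
    by rewrite exprMn expr2; lra.
  have ke : 0 < k * e by rewrite mulr_gt0.
  by rewrite DP; have := ltr_pM2r ke P (9 * ((3 * N) ^+ 2 + g)); rewrite PQ; lra.
(* The error is now 9 D N^2 / (k g (9 N^2 + g)), at most 9 D N / (k g^2) for N <= 1. *)
exists (D / (k * g)); first by rewrite divr_gt0 // mulr_gt0.
move=> e e0; pose P := e * k * g ^+ 2 / (9 * D).
have P0 : 0 < P by rewrite divr_gt0 ?mulr_gt0 ?exprn_gt0.
exists (Num.min 1 P); first by rewrite lt_min ltr01.
move=> u0 du; rewrite lE lt_min => /andP[N1 NP].
have [N0 _ _] := datum_pair_norm D0 s0 du.
move: (pair_norm _ _ _) N0 N1 NP => N N0 N1 NP.
have Q0 : 0 < (3 * N) ^+ 2 + g by rewrite ltr_wpDl // sqr_ge0.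
have -> : D / (k * ((3 * N) ^+ 2 + g)) - D / (k * g) =
   - (9 * D * N ^+ 2 / (k * g * ((3 * N) ^+ 2 + g))).
  by field; rewrite !gt_eqF.
rewrite normrN ger0_norm; last by rewrite divr_ge0 ?mulr_ge0 ?sqr_ge0 // ltW.
rewrite ltr_pdivrMr; last by rewrite !mulr_gt0.
have eP : e * (k * g * g) = P * (9 * D) by rewrite /P; field; rewrite !gt_eqF.
apply: lt_le_trans (_ : e * (k * g * g) <= _); last first.
  by rewrite ler_wpM2l ?(ltW e0) // ler_wpM2l ?mulr_ge0 ?(ltW k0) ?(ltW gp) // lerDr sqr_ge0.
rewrite eP mulrC ltr_pM2r ?mulr_gt0 //; apply: le_lt_trans NP.
by rewrite expr2 ler_piMr // ltW.
Qed.
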